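(* Assume that either (1) $\mathbf{X}$ is uniformly distributed on $\mathcal{X}$, where $\mathcal{X}\subseteq\mathbb{R}^n$ is bounded and convex, or (2) $\mathbf{X}\sim\mathcal{N}(\mathbf{0},\mathbf{I})$ on $\mathbb{R}^n$ (so $\mathcal{X}=\mathbb{R}^n$). Then there is a constant $C>0$ with $$\mathbb{E}_{\mathbf{X}}\big[(f(\mathbf{X})-f_g(\mathbf{X}))^2\big]\le C\,(\lambda_{k+1}+\cdots+\lambda_n),$$ and with this same constant $C$, for every integer $N\ge 1$, $$\mathbb{E}\Big[\mathbb{E}_{\mathbf{X}}\big[(f_g(\mathbf{X})-f_{g_N}(\mathbf{X},\cdot))^2\big]\Big]=\mathbb{E}\Big[\mathbb{E}_{\mathbf{Y}}\big[(g(\mathbf{Y})-g_N(\mathbf{Y},\cdot))^2\big]\Big]\le\frac{C}{N}\,(\lambda_{k+1}+\cdots+\lambda_n).$$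
   Context: Let $n\ge2$ and let $\rho_{\mathbf{X}}:\mathbb{R}^n\to[0,\infty)$ be a probability density with respect to Lebesgue measure. Put $\mathcal{X}=\{\mathbf{x}:\rho_{\mathbf{X}}(\mathbf{x})>0\}$; it is assumed that $\mathcal{X}$ is open, that $\partial\mathcal{X}$ has Lebesgue measure zero, and that $\rho_{\mathbf{X}}$ is bounded and continuous on $\mathcal{X}$. Let $\mathbf{X}$ be a random vector with density $\rho_{\mathbf{X}}$ on a probability space $(\Omega,\mathcal{A},\mathbb{P})$. Let $f:\mathcal{X}\to\mathbb{R}$ be measurable with partial derivatives that are square integrable with respect to $\rho_{\mathbf{X}}$. Define $\mathbf{C}=\int_{\mathcal{X}}\nabla f(\mathbf{x})\nabla f(\mathbf{x})^\top\rho_{\mathbf{X}}(\mathbf{x})\,d\mathbf{x}=\mathbf{W}\Lambda\mathbf{W}^\top$, with $\Lambda=\mathrm{diag}(\lambda_1,\dots,\lambda_n)$, $\lambda_1\ge\dots\ge\lambda_n\ge0$, and $\mathbf{W}$ an orthogonal matrix of eigenvectors. Fix $k\in\{1,\dots,n-1\}$ and split $\mathbf{W}=[\mathbf{W}_1\;\mathbf{W}_2]$ with $\mathbf{W}_1\in\mathbb{R}^{n\times k}$, $\mathbf{W}_2\in\mathbb{R}^{n\times(n-k)}$. Put $\mathbf{Y}=\mathbf{W}_1^\top\mathbf{X}$, $\mathcal{Y}=\mathbf{W}_1^\top\mathcal{X}$, $\rho_{\mathbf{Y},\mathbf{Z}}(\mathbf{y},\mathbf{z})=\rho_{\mathbf{X}}(\mathbf{W}_1\mathbf{y}+\mathbf{W}_2\mathbf{z})$,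 $\rho_{\mathbf{Y}}(\mathbf{y})=\int_{\mathbb{R}^{n-k}}\rho_{\mathbf{Y},\mathbf{Z}}(\mathbf{y},\mathbf{z})\,d\mathbf{z}$ (the density of $\mathbf{Y}$). For $\mathbf{y}\in\mathcal{Y}$ (where $\rho_{\mathbf{Y}}(\mathbf{y})>0$), put $\rho_{\mathbf{Z}|\mathbf{Y}}(\mathbf{z}|\mathbf{y})=\rho_{\mathbf{Y},\mathbf{Z}}(\mathbf{y},\mathbf{z})/\rho_{\mathbf{Y}}(\mathbf{y})$, and let $\mathbb{P}^{\mathbf{y}}_{\mathbf{Z}|\mathbf{Y}}$ be the probability measure on $\mathbb{R}^{n-k}$ with this density. It is assumed that $\mathbf{z}\mapsto f(\mathbf{W}_1\mathbf{y}+\mathbf{W}_2\mathbf{z})$ is integrable with respect to $\mathbb{P}^{\mathbf{y}}_{\mathbf{Z}|\mathbf{Y}}$ for every $\mathbf{y}\in\mathcal{Y}$. For $\mathbf{y}\in\mathcal{Y}$ define $$g(\mathbf{y})=\int f(\mathbf{W}_1\mathbf{y}+\mathbf{W}_2\mathbf{z})\,\rho_{\mathbf{Z}|\mathbf{Y}}(\mathbf{z}|\mathbf{y})\,d\mathbf{z},\qquad g_N(\mathbf{y},\omega)=\frac1N\sum_{j=1}^N f(\mathbf{W}_1\mathbf{y}+\mathbf{W}_2\mathbf{Z}^{\mathbf{y}}_j(\omega)),$$ where, for each $\mathbf{y}\in\mathcal{Y}$, $\mathbf{Z}^{\mathbf{y}}_1,\dots,\mathbf{Z}^{\mathbf{y}}_N$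 are i.i.d. random vectors on $\Omega$ with law $\mathbb{P}^{\mathbf{y}}_{\mathbf{Z}|\mathbf{Y}}$, and each map $(\mathbf{y},\omega)\mapsto\mathbf{Z}^{\mathbf{y}}_j(\omega)$ is $\mathcal{B}(\mathcal{Y})\otimes\mathcal{A}$-measurable. For $\mathbf{x}\in\mathcal{X}$ put $f_g(\mathbf{x})=g(\mathbf{W}_1^\top\mathbf{x})$ and $f_{g_N}(\mathbf{x},\omega)=g_N(\mathbf{W}_1^\top\mathbf{x},\omega)$. $\mathbb{E}_{\mathbf{X}}$ and $\mathbb{E}_{\mathbf{Y}}$ denote integration in $\mathbf{x}$ against $\rho_{\mathbf{X}}(\mathbf{x})d\mathbf{x}$ and in $\mathbf{y}$ against $\rho_{\mathbf{Y}}(\mathbf{y})d\mathbf{y}$, with the sampling variable $\omega$ (of the $\mathbf{Z}^{\mathbf{y}}_j$) held fixed; the outer $\mathbb{E}$ is integration over $\omega$ with respect to $\mathbb{P}$. *)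

(* Defs.v *)
From HB Require Import structures.
From mathcomp Require Import all_boot all_order all_algebra.
From mathcomp Require Import all_classical all_reals all_analysis.
From mathcomp Require Import ring lra.

Set Implicit Arguments.
Unset Strict Implicit.
Unset Printing Implicit Defensive.

Import Order.TTheory GRing.Theory Num.Theory.
Import numFieldNormedType.Exports.

Local Open Scope classical_set_scope.
Local Open Scope ring_scope.

(* R^n is ['cV[R]_n] with the sigma-algebra generated by the coordinates, as
   the library does for [n.-tuple T]; [measurable_cVE] below identifies it with
   the Borel sigma-algebra of the topology of ['cV[R]_n]. *)

Definition measure_cV_display : measure_display -> measure_display.
Proof. exact. Qed.

Section measurable_cV.
Context {d} {T : sigmaRingType d}.
Variable n : nat.

Let coors : 'I_n -> 'cV[T]_n -> T := fun i v => v i 0.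

Let cV_set0 : g_sigma_preimage coors set0.
Proof. exact: sigma_algebra0. Qed.

Let cV_setC A : g_sigma_preimage coors A -> g_sigma_preimage coors (~` A).
Proof. exact: sigma_algebraC. Qed.

Let cV_bigcup (F : _^nat) : (forall i, g_sigma_preimage coors (F i)) ->
  g_sigma_preimage coors (\bigcup_i (F i)).
Proof. exact: sigma_algebra_bigcup. Qed.

HB.instance Definition _ := @isMeasurable.Build (measure_cV_display d)
  'cV[T]_n (g_sigma_preimage coors) cV_set0 cV_setC cV_bigcup.

End measurable_cV.

Lemma measurable_cV_coord d (T : measurableType d) n (i : 'I_n) :
  measurable_fun [set: 'cV[T]_n] (fun v => v i 0).
Proof.
move=> _ Y mY; rewrite setTI; apply: sub_sigma_algebra => /=.
rewrite -bigcup_seq/=; exists i => /=; first by rewrite mem_index_enum.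
by exists Y => //; rewrite setTI.
Qed.

Lemma measurable_fun_cVP d1 d2 (T1 : measurableType d1) (T2 : measurableType d2)
    n (f : T1 -> 'cV[T2]_n) :
  measurable_fun [set: T1] f <->
  forall i, measurable_fun [set: T1] (fun x => f x i 0).
Proof.
split=> [mf i|mf].
  exact: (measurableT_comp (measurable_cV_coord i) mf).
move=> _ A mA; rewrite setTI; move: A mA.
pose G := [set A : set 'cV[T2]_n | measurable (f @^-1` A)].
suff : (g_sigma_preimage (fun (i : 'I_n) (v : 'cV[T2]_n) => v i 0)) `<=` G by [].
apply: smallest_sub.
  split; rewrite /G /=.
  - by rewrite preimage_set0.
  - by move=> A mA; rewrite setTD preimage_setC; exact: measurableC.
  - by move=> F mF; rewrite preimage_bigcup; exact: bigcupT_measurable.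
rewrite -bigcup_seq/= => A [i _ [B mB <-]].
rewrite /G/= setTI; have := mf i measurableT B mB.
by rewrite setTI.
Qed.

Lemma open_measurable_cV (R : realType) n (U : set 'cV[R]_n) :
  open U -> measurable U.
Proof.
move=> oU.
pose box (q : 'cV[rat]_n * rat) : set 'cV[R]_n :=
  [set v | forall i, `|ratr (q.1 i 0) - v i 0| < ratr q.2].
have mbox q : measurable (box q).
  rewrite (_ : box q =
      \bigcap_(i in [set: 'I_n]) [set v | `|ratr (q.1 i 0) - v i 0| < ratr q.2]);
    last by apply/seteqP; split => v /= bv i; [move=> _|]; exact: bv.
  apply: fin_bigcap_measurable => // i _.
  have mc := @measurable_cV_coord _ R n i.
  have := mc measurableT
    [set` `]ratr (q.1 i 0) - ratr q.2, ratr (q.1 i 0) + ratr q.2[].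
  rewrite setTI => /(_ (measurable_itv _)); congr (measurable _).
  by apply/seteqP; split => v; rewrite /= in_itv/= ltr_distlC.
rewrite (_ : U = \bigcup_(q in [set q | box q `<=` U]) box q); last first.
  apply/seteqP; split => [v Uv|v [q /= qU]]; last exact: qU.
  have /nbhs_ballP[e /= e0 veU] := oU v Uv.
  have [r] := rat_in_itvoo (divr_gt0 e0 (ltr0n R 2)).
  rewrite in_itv/= => /andP[r0 re].
  have H i : exists q : rat, `|ratr q - v i 0| < ratr r.
    have [q] := @rat_in_itvoo R (v i 0 - ratr r) (v i 0 + ratr r) ltac:(lra).
    by rewrite in_itv/= => ?; exists q; rewrite ltr_distl; lra.
  have [q Hq] := choice H.
  exists (\col_i q i, r) => /=.
    move=> w /= bw; apply: veU; rewrite -ball_normE /= /Num.norm/= mx_normrE.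
    apply/bigmax_ltP; split => //= -[i j] _ /=; rewrite ord1 !mxE.
    have := bw i; rewrite mxE => bwi; have := Hq i => Hqi.
    rewrite (_ : v i 0 - w i 0 = (ratr (q i) - w i 0) - (ratr (q i) - v i 0)); last by ring.
    apply: (le_lt_trans (ler_normB _ _)); lra.
  by move=> i; rewrite mxE; exact: Hq.
rewrite bigcup_mkcond; apply: countable_bigcupT_measurable => [|q]; first exact: countableP.
by case: ifPn.
Qed.

Lemma measurable_cVE (R : realType) n :
  @measurable _ 'cV[R]_n = <<s [set U : set 'cV[R]_n | open U] >>.
Proof.
apply/seteqP; split; last first.
  apply: smallest_sub; first exact: sigma_algebra_measurable.
  by move=> U; exact: open_measurable_cV.
apply: smallest_sub; first exact: smallest_sigma_algebra.
rewrite -bigcup_seq/= => A [i _ [B mB <-]].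
pose T := g_sigma_algebraType [set U : set 'cV[R]_n | open U].
have : measurable_fun [set: T] (fun v : T => (v : 'cV[R]_n) i 0).
  apply: (measurability _ (measurable_realfun.RGenOInfty.measurableE R)) => _ [_ [x ->] <-].
  apply: sub_sigma_algebra; rewrite setTI /=.
  apply: open_comp; last exact: interval_open.
  by move=> v _; exact: coord_continuous.
by move=> /(_ measurableT B mB).
Qed.

Section lebesgue_cV.
Variable R : realType.

Definition cV_cons n (p : R * 'cV[R]_n) : 'cV[R]_n.+1 := col_mx p.1%:M p.2.

Lemma cV_cons0 n (p : R * 'cV[R]_n) : cV_cons p 0 0 = p.1.
Proof.
have := col_mxEu (p.1%:M : 'M[R]_1) p.2 0 0; rewrite [RHS]mxE eqxx mulr1n => <-.
by congr (col_mx _ _ _ _); exact/val_inj.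
Qed.

Lemma cV_consS n (p : R * 'cV[R]_n) i : cV_cons p (lift 0 i) 0 = p.2 i 0.
Proof.
rewrite -(col_mxEd (p.1%:M : 'M[R]_1) p.2).
by congr (col_mx _ _ _ _); exact/val_inj.
Qed.

Definition cV_uncons n (v : 'cV[R]_n.+1) : R * 'cV[R]_n :=
  (v 0 0, \col_i v (lift 0 i) 0).

Lemma cV_consK n : cancel (@cV_cons n) (@cV_uncons n).
Proof.
move=> [x v]; rewrite /cV_uncons cV_cons0 /=; congr pair.
by apply/colP => i; rewrite mxE cV_consS.
Qed.

Lemma cV_unconsK n : cancel (@cV_uncons n) (@cV_cons n).
Proof.
move=> v; apply/colP => i; case: (unliftP 0 i) => [j ->|->].
- by rewrite cV_consS mxE.
- by rewrite cV_cons0.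
Qed.

Lemma measurable_cV_cons n :
  measurable_fun [set: measurableTypeR R * 'cV[R]_n] (@cV_cons n).
Proof.
apply/measurable_fun_cVP => i; case: (unliftP 0 i) => [j ->|->].
- under eq_fun do rewrite cV_consS.
  exact: (measurableT_comp (measurable_cV_coord j) measurable_snd).
- under eq_fun do rewrite cV_cons0.
  exact: measurable_fst.
Qed.

Lemma measurable_cV_uncons n :
  measurable_fun [set: 'cV[R]_n.+1]
    (@cV_uncons n : _ -> measurableTypeR R * 'cV[R]_n).
Proof.
apply/measurable_fun_pairP; split; first exact: measurable_cV_coord.
apply/measurable_fun_cVP => i /=.
under eq_fun do rewrite mxE.
exact: measurable_cV_coord.
Qed.

Section lebesgue_cVS.
Variables (n : nat) (mu : {sigma_finite_measure set 'cV[R]_n -> \bar R}).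

Definition lebesgue_cVS : set 'cV[R]_n.+1 -> \bar R :=
  pushforward (@lebesgue_measure R \x mu)%E (@cV_cons n).

Let lebesgue_cVS0 : lebesgue_cVS set0 = 0%E.
Proof. by rewrite /lebesgue_cVS /pushforward preimage_set0 measure0. Qed.

Let lebesgue_cVS_ge0 A : (0 <= lebesgue_cVS A)%E.
Proof. exact: (measure_ge0 (@lebesgue_measure R \x mu)%E). Qed.

Let lebesgue_cVS_sigma_additive : semi_sigma_additive lebesgue_cVS.
Proof.
exact: (@measure_semi_sigma_additive _ _ _
  (measure_function_pushforward__canonical__measure_function_Measure
    (@lebesgue_measure R \x mu)%E (@measurable_cV_cons n))).
Qed.

HB.instance Definition _ := isMeasure.Build _ _ _ lebesgue_cVS
  lebesgue_cVS0 lebesgue_cVS_ge0 lebesgue_cVS_sigma_additive.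

Let lebesgue_cVS_sigma_finite : sigma_finite setT lebesgue_cVS.
Proof.
have /sigma_finiteP[F [TF ndF Foo]] := sigma_finiteT (@lebesgue_measure R).
have /sigma_finiteP[G [TG ndG Goo]] := sigma_finiteT mu.
exists (fun i => @cV_uncons n @^-1` (F i `*` G i)).
  rewrite -preimage_bigcup -[LHS](preimage_setT (@cV_uncons n)).
  congr (_ @^-1` _); rewrite -setXTT TF TG predeqE => -[x y]; split.
    move=> [/= [i _ Fix] [j _ Gjy]]; exists (maxn i j) => //; split.
    - by move: x Fix; exact/subsetPset/ndF/leq_maxl.
    - by move: y Gjy; exact/subsetPset/ndG/leq_maxr.
  by move=> [i _ []/= ? ?]; split; exists i.
move=> i; have [mF Fi] := Foo i; have [mG Gi] := Goo i; split.
  rewrite -[X in measurable X]setTI; apply: measurable_cV_uncons => //.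
  exact: measurableX.
rewrite /lebesgue_cVS /pushforward -comp_preimage (_ : _ \o _ = id).
  by rewrite preimage_id product_measure1E// lte_mul_pinfty// ge0_fin_numE.
by apply/funext => x /=; rewrite cV_consK.
Qed.

HB.instance Definition _ := Measure_isSigmaFinite.Build _ _ _ lebesgue_cVS
  lebesgue_cVS_sigma_finite.

End lebesgue_cVS.

Fixpoint lebesgue_cV n : {sigma_finite_measure set 'cV[R]_n -> \bar R} :=
  if n is n'.+1 then lebesgue_cVS (lebesgue_cV n') else \d_(0 : 'cV[R]_0).

End lebesgue_cV.

Lemma lebesgue_cV_box (R : realType) n (A : 'I_n -> set (measurableTypeR R)) :
  (forall i, measurable (A i)) ->
  lebesgue_cV R n [set v | forall i, A i (v i 0)] =
  (\prod_(i < n) lebesgue_measure (A i))%E.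
Proof.
elim: n A => [|n IH] A mA.
  by rewrite big_ord0 /= diracE mem_set//= => -[].
rewrite big_ord_recl -IH//= /lebesgue_cVS /pushforward.
rewrite -product_measure1E//; last first.
  rewrite [X in measurable X](_ : _ = \bigcap_(i in [set: 'I_n])
      [set v : 'cV[R]_n | A (lift 0 i) (v i 0)]); last first.
    by apply/seteqP; split => v /= bv i; [move=> _|]; exact: bv.
  apply: fin_bigcap_measurable => // i _.
  have := @measurable_cV_coord _ (measurableTypeR R) n i measurableT _ (mA (lift 0 i)).
  by rewrite setTI.
congr (product_measure1 _ _ _); apply/seteqP; split => -[x v].
  move=> Av; split; first by have := Av 0; rewrite cV_cons0.
  by move=> i; have := Av (lift 0 i); rewrite cV_consS.
move=> [Ax Av] i; case: (unliftP 0 i) => [j ->|->].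
  by rewrite cV_consS; exact: Av.
by rewrite cV_cons0.
Qed.

Section density.
Variables (R : realType) (n : nat).
Implicit Types (rho f : 'cV[R]_n -> R) (D : set 'cV[R]_n) (x : 'cV[R]_n).

Definition dsupp rho : set 'cV[R]_n := [set x | 0 < rho x].

Definition uniform_density D x : R := \1_D x / fine (lebesgue_cV R n D).

Definition std_normal_density x : R :=
  Num.sqrt (2 * pi) ^- n * expR (- (\sum_(i < n) x i 0 ^+ 2) / 2).

Definition grad f x : 'cV[R]_n := \col_i 'D_(delta_mx i 0) f x.

Definition grad_outer rho f : 'M[R]_n :=
  \matrix_(i, j) \int[lebesgue_cV R n]_(x in dsupp rho)
    ((grad f x *m (grad f x)^T) i j * rho x).

Definition EX rho (h : 'cV[R]_n -> R) : \bar R :=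
  (\int[lebesgue_cV R n]_(x in dsupp rho) (h x * rho x)%:E)%E.

End density.

Section active_subspace.
Variables (R : realType) (k m : nat).
Variables (W : 'M[R]_(k + m)) (rho f : 'cV[R]_(k + m) -> R).
Implicit Types (y : 'cV[R]_k) (z : 'cV[R]_m) (x : 'cV[R]_(k + m)).

Local Notation W1 := (lsubmx W).
Local Notation W2 := (rsubmx W).

Definition Yset : set 'cV[R]_k := (fun x => W1^T *m x) @` dsupp rho.

Definition rhoYZ y z : R := rho (W1 *m y + W2 *m z).

Definition rhoY y : R := \int[lebesgue_cV R m]_z rhoYZ y z.

Definition rhoZY y z : R := rhoYZ y z / rhoY y.

Definition lawZY y (B : set 'cV[R]_m) : \bar R :=
  (\int[lebesgue_cV R m]_(z in B) (rhoZY y z)%:E)%E.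

Definition EY (h : 'cV[R]_k -> R) : \bar R :=
  (\int[lebesgue_cV R k]_(y in Yset) (h y * rhoY y)%:E)%E.

(* The values of [f] outside [dsupp rho] play no role: [rhoZY y z] vanishes
   when [W1 *m y + W2 *m z] is not in [dsupp rho]. *)
Definition gfun y : R :=
  \int[lebesgue_cV R m]_z (f (W1 *m y + W2 *m z) * rhoZY y z).

Definition fg x : R := gfun (W1^T *m x).

Section monte_carlo.
Variables (Omega : Type) (N : nat) (Z : 'I_N -> 'cV[R]_k -> Omega -> 'cV[R]_m).

(* A sample [Z j y w] may leave the slice of [dsupp rho] over [y], on an event
   of probability zero; [f] is then read as 0. *)
Definition gN y (w : Omega) : R :=
  N%:R^-1 * \sum_(j < N)
    (f \* \1_(dsupp rho)) (W1 *m y + W2 *m Z j y w).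

Definition fgN x (w : Omega) : R := gN (W1^T *m x) w.

End monte_carlo.
End active_subspace.

Section iid.
Context d d' (Omega : measurableType d) (T : measurableType d') (R : realType).
Variables (P : probability Omega R) (N : nat) (Z : 'I_N -> Omega -> T).
Local Open Scope ereal_scope.

Definition mutual_indep : Prop :=
  forall (J : {set 'I_N}) (B : 'I_N -> set T), (forall j, measurable (B j)) ->
    P (\bigcap_(j in [set` J]) Z j @^-1` B j) =
    \prod_(j in J) P (Z j @^-1` B j).

Definition iid_law (mu : set T -> \bar R) : Prop :=
  [/\ forall j, measurable_fun [set: Omega] (Z j),
      mutual_indep &
      forall j (B : set T), measurable B -> P (Z j @^-1` B) = mu B].

End iid.

(* Main.v *)
(* By Jensen, |f(x) - f_g(x)|^2 is at most the average of |f(x) - f(x + W2 z)|^2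
   against the conditional density, and the increment of f is the integral of
   its gradient along the segment from x to x + W2 z. Exchanging the integrals
   and translating x turns the average over x into the integral of
   |W2^T grad f(x)|^2 K(x) / r(x), where r(x) is the integral of rho(x + W2 z)
   over z and
     K(x) = int_0^1 int |z|^2 rho(x - t W2 z) rho(x + (1 - t) W2 z) dz dt.
   Since the integral of |W2^T grad f|^2 rho is the sum of the last eigenvalues,
   it remains to show K <= C r rho. For a uniform density z is bounded and one of
   t, 1 - t is at least 1/2, so that a dilation of z suffices; for a Gaussian
   density one completes the square.

   As f is not assumed to be C^1, the formula for its increments is not given by
   the usual calculus. Along almost every line parallel to a coordinate axis, f
   is differentiable everywhere with an integrable derivative, hence is the
   integral of this derivative (Vitali-Caratheodory). A sum of two directions is
   approximated by staircases with N steps, the error being controlled by the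
   continuity of translations in L^1.

   The sampling error at y is the variance of a mean of N i.i.d. variables, that
   is 1/N times a conditional variance whose integral over y is
   E[(f - f_g)^2]. *)
Require Import Defs.
From HB Require Import structures.
From mathcomp Require Import all_boot all_order all_algebra.
From mathcomp Require Import all_classical all_reals all_analysis.
From mathcomp Require Import measurable_realfun ring lra.

Set Implicit Arguments.
Unset Strict Implicit.
Unset Printing Implicit Defensive.

Import Order.TTheory GRing.Theory Num.Theory.
Import numFieldNormedType.Exports.

Local Open Scope classical_set_scope.
Local Open Scope ring_scope.

(** * Increments of everywhere differentiable functions *)

(** The order of the integrals is dictated by null sets: the increment formula holds, for each fixed
    [z], for almost every [x] only. So [z] is made the outermost variable before the formula is
    used, [x] is translated at fixed [z] and [t], and only then is [x] brought outside again, where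
    the kernel is estimated pointwise. The gradient is square integrable only against [rho]. As
    [rho] is bounded below on bounded parts of its support, the gradient is integrable on boxes, and
    by convexity each segment between two points of the support lies in such a box intersected with
    the support. Orthogonal and scaling changes of variables use no determinant: a
    translation-invariant measure is a multiple of Lebesgue measure, and the factor is read off from
    one symmetric test set. The two laws enter only through [poincare_density]. In its constants,
    [2 ^+ m] is the cost of a dilation by a factor at least 1/2, [n (2B)^2] bounds [|z|^2] on a
    bounded support, and [48] is the total weight of an explicit integral over [t]. None of them
    involves [f] or the sample size, so one [C] serves both estimates. *)

Lemma lebesgue_itvcc_lty (R : realType) (a b : R) :
  (lebesgue_measure `[a, b]%classic < +oo)%E.
Proof. by rewrite lebesgue_measure_itv/=; case: ifP; rewrite ?ltry// -EFinD ltry. Qed.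

Lemma integrable_itvcc_cst (R : realType) (a b c : R) :
  lebesgue_measure.-integrable `[a, b] (EFin \o cst c).
Proof.
apply: measurable_bounded_integrable => //; first exact: lebesgue_itvcc_lty.
exact: bounded_cst.
Qed.

(** Supremum argument: let [c] be the supremum of the points [x] with [H a <= H x]. The left half of
    the local condition at [c] puts [c] itself in this set; the right half produces a larger element
    unless [c = b]. *)
Lemma locally_monotone_le (R : realType) (H : R -> R) (a b : R) : a <= b ->
  (forall x, a <= x <= b -> exists2 e, 0 < e &
    forall t, a <= t <= b -> (x - e < t <= x -> H t <= H x) /\
                             (x <= t < x + e -> H x <= H t)) ->
  H a <= H b.
Proof.
move=> ab loc; pose S := [set x | a <= x <= b /\ H a <= H x].
have Sa : S a by split => //; rewrite lexx.
have supS : has_sup S by split; [exists a|exists b => x [/andP[]]].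
have ubS : ubound S (sup S) by move=> x; apply: sup_upper_bound.
set c := sup S in ubS *.
have cab : a <= c <= b.
  by rewrite ubS//=; apply: ge_sup; [exists a|move=> x [/andP[]]].
have [e e0 He] := loc _ cab.
have [t [tab Ht] ct] := sup_adherent e0 supS.
have Hc : H a <= H c.
  by apply: (le_trans Ht); apply: (He t tab).1; rewrite ct ubS.
have [cb|bc] := ltP c b; last by rewrite (_ : b = c)//; lra.
pose t' := Num.min b (c + e / 2).
have t'b : t' <= b by rewrite ge_min lexx.
have ct' : c < t' by rewrite lt_min cb/=; lra.
have t'e : t' < c + e by rewrite gt_min; apply/orP; right; lra.
have : t' <= c; last by lra.
apply: ubS; split; first by lra.
by apply: (le_trans Hc); apply: (He t' _).2; lra.
Qed.

(** The sum counts the [j] with [j < v / eta], which is [v / eta] rounded up; the [1] pays for the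
    rounding. *)
Lemma layer_cake_count (R : realType) (eta v : R) n : 0 < eta -> 0 <= v ->
  \sum_(0 <= j < n) ((j%:R * eta < v)%R)%:R <= v / eta + 1 :> R.
Proof.
move=> eta0 v0; elim: n => [|n IH].
  by rewrite big_nil; have := divr_ge0 v0 (ltW eta0); lra.
rewrite big_nat_recr//=; case: (boolP (_ < v)) => [nv|_]; last by rewrite addr0.
apply: (@le_trans _ _ (n%:R + 1)).
  rewrite lerD2r (@le_trans _ _ (\sum_(0 <= j < n) 1))//.
    by apply: ler_sum => i _; case: (_ < _).
  by rewrite big_const_nat iter_addr_0 subn0.
by rewrite lerD2r ler_pdivlMr// ltW.
Qed.

(* [G] is [eta] times the integral of the number of [j] with [x] in [U_j], where
   [U_j] is an open set barely larger than [{v > j eta}]: this count is lower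
   semicontinuous, at least [v / eta], and its integral is close to that of
   [v / eta]. *)
Lemma lsc_majorant_primitive (R : realType) (v : R -> R) (a b eps : R) :
  a <= b -> (forall x, 0 <= v x) ->
  lebesgue_measure.-integrable `[a, b] (EFin \o v) -> 0 < eps ->
  exists G : R -> R,
    (forall x, a <= x <= b -> exists2 e, 0 < e & forall t, a <= t <= b ->
       (x - e < t <= x -> v x * (x - t) <= G x - G t) /\
       (x <= t < x + e -> v x * (t - x) <= G t - G x)) /\
    G b - G a <= \int[lebesgue_measure]_(x in `[a, b]) v x + eps.
Proof.
move=> ab v0 iv eps0; pose mu := @lebesgue_measure R.
have mv : measurable_fun `[a, b] v by case/integrableP : iv => /measurable_EFinP.
(* The total excess is [eta * (b - a + 1)]: the rounding in [layer_cake_count] costs [eta] per unit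
   of length, and the sets [U j] exceed the [E j] by measures [2^-(j+1)], of sum 1. *)
pose eta := eps / (b - a + 1).
have eta0 : 0 < eta by rewrite divr_gt0//; lra.
pose E j := `[a, b] `&` [set x | j%:R * eta < v x].
have mE j : measurable (E j).
  have := mv (measurable_itv _) _ (measurable_itv `]j%:R * eta, +oo[).
  congr (measurable _); apply/seteqP; split => x /=; rewrite /= ?in_itv/= ?andbT; by [].
have Efin j : (mu (E j) < +oo)%E.
  apply: (@le_lt_trans _ _ (mu `[a, b]%classic)); last first.
    exact: lebesgue_itvcc_lty.
  by apply: le_measure; [rewrite inE; exact: mE|rewrite inE; exact: measurable_itv|exact: subIsetl].
have H j : exists U : set R, [/\ open U, E j `<=` U &
    (mu (U `\` E j) < (1 / (2 ^ j.+1)%:R)%:E)%E].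
  apply: lebesgue_regularity_outer; [exact: mE|exact: Efin|].
  by rewrite divr_gt0// ltr0n expn_gt0.
have [U HU] := choice H.
have mU j : measurable (U j) by apply: open_measurable; case: (HU j).
(* The integral of the count is written as a series of restricted Lebesgue measures, so that
   additivity on adjacent intervals comes for free. *)
pose nu : {measure set _ -> \bar R} := mseries (fun j => mrestr mu (mU j)) 0.
have nuE A : nu A = (\sum_(0 <= j <oo) mu (A `&` U j))%E by [].
have sumE : (\sum_(0 <= j <oo) mu (E j) <=
    (\int[mu]_(x in `[a, b]) (v x / eta + 1))%:E)%E.
  have mind j : measurable_fun `[a, b] (fun x => (\1_(E j) x : R)%:E).
    by apply/measurable_EFinP; apply: measurable_indic.
  rewrite (eq_eseriesr (g := fun j => (\int[mu]_(x in `[a, b]) (\1_(E j) x)%:E)%E)); last first.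
    move=> j _; rewrite -[in LHS](@setIidl _ (E j) `[a, b]%classic); last exact: subIsetl.
    exact/esym/(integral_indic mu (measurable_itv `[a, b]) (mE j)).
  have ivE : mu.-integrable `[a, b] (EFin \o (fun x => v x / eta + 1)).
    rewrite (_ : _ \o _ = (fun x => (eta^-1%:E * (v x)%:E)%E) \+ cst 1%E); last first.
      by apply/funext => x /=; rewrite -EFinM -EFinD mulrC.
    apply: integrableD => //; first exact: integrableZl.
    exact: integrable_itvcc_cst.
  rewrite -integral_nneseries//.
  rewrite /Rintegral fineK; last exact: integrable_fin_num.
  apply: ge0_le_integral => //.
  - by move=> x _; apply: nneseries_ge0 => j _ _; rewrite lee_fin.
  - have h0 j x : `[a, b]%classic x -> xpredT j -> (0 <= (\1_(E j) x : R)%:E)%E.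
      by rewrite lee_fin.
    exact: (ge0_emeasurable_sum h0 (fun j _ => mind j)).
  - by have /integrableP[] := ivE.
  - move=> x xab; apply: lime_le.
      by apply: is_cvg_nneseries => j _ _; rewrite lee_fin.
    near=> n; rewrite sumEFin lee_fin.
    rewrite (le_trans _ (layer_cake_count n eta0 (v0 x)))//.
    apply: ler_sum => j _; rewrite indicE /E.
    case: (boolP (_ < v x)) => [_|/negP nv]; first by rewrite ler_nat leq_b1.
    by rewrite memNset// => -[_ /nv].
have nuab : (nu `[a, b]%classic <= (\int[mu]_(x in `[a, b]) (v x / eta + 1) + 1)%:E)%E.
  rewrite nuE EFinD; apply: le_trans; last exact: (leeD2r _ sumE).
  apply: le_trans; last exact: (epsilon_trick xpredT).
  apply: lee_nneseries => // j _.
  have [oU EU UE] := HU j.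
  apply: (@le_trans _ _ (mu (E j `|` (U j `\` E j)))).
    apply: le_measure; rewrite ?inE.
    - by apply: measurableI; [exact: measurable_itv|exact: mU].
    - by apply: measurableU; [|apply: measurableD]; (exact: mE || exact: mU).
    - by move=> x [_ Ux]; case: (pselect (E j x)) => Ex; [left|right].
  rewrite /mu measureU; [|exact: mE|apply: measurableD; [exact: mU|exact: mE]|]; last first.
    by rewrite setIDA setIC -setIDA setDv setI0.
  by rewrite leeD2l// ltW.
have nufin (A : set R) : measurable A -> A `<=` `[a, b] -> nu A \is a fin_num.
  move=> mA Aab; rewrite ge0_fin_numE//.
  apply: (@le_lt_trans _ _ (nu `[a, b]%classic)); first by apply: le_measure; rewrite ?inE//; exact: measurable_itv.
  exact: le_lt_trans nuab (ltry _).
have sub x t : x <= t -> t <= b -> a <= x ->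
    fine (nu `[a, t]%classic) - fine (nu `[a, x]%classic) = fine (nu `]x, t]%classic).
  move=> xt tb ax; rewrite (_ : `[a, t]%classic = `[a, x] `|` `]x, t]); last first.
    by apply/seteqP; split => y /=; rewrite !in_itv/=;
      [move=> ?; case: (leP y x) => ?; [left|right]|move=> []]; lra.
  rewrite measureU//; last first.
    by apply/seteqP; split => y //= []; rewrite !in_itv/=; lra.
  rewrite fineD; [lra| |]; apply: nufin => // y; rewrite /= !in_itv/=; lra.
have nuge x t J : x <= t -> t <= b -> a <= x ->
    (forall j, (j < J)%N -> `]x, t] `<=` U j) ->
    J%:R * (t - x) <= fine (nu `]x, t]%classic).
  move=> xt tb ax tU; rewrite -lee_fin fineK; last first.
    by apply: nufin => // y; rewrite /= !in_itv/=; lra.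
  rewrite nuE; apply: le_trans; last first.
    by apply: (nneseries_lim_ge J).
  rewrite (eq_big_nat _ _ (F2 := fun=> (t - x)%:E)).
    rewrite sumEFin big_const_nat iter_addr_0 subn0 mulr_natl//.
  move=> j /andP[_ jJ]; rewrite setIidl; last exact: tU.
  rewrite /mu lebesgue_measure_itv/= lte_fin; case: ltP => //= tx.
  by rewrite (_ : t = x) ?subrr//; lra.
exists (fun x => eta * fine (nu `[a, x]%classic)); split; last first.
  have abT : fine (nu `[a, b]%classic) - fine (nu `[a, a]%classic) <= fine (nu `[a, b]%classic).
    by rewrite gerBl fine_ge0.
  rewrite -mulrBr (le_trans (ler_wpM2l (ltW eta0) abT))//.
  have := fine_le (nufin _ (measurable_itv `[a, b]) (fun=> id)) _ nuab.
  move=> /(_ isT) /=.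
  rewrite RintegralD//=; last 2 first.
  - rewrite (_ : _ \o _ = (fun x => (eta^-1%:E * (v x)%:E)%E)); last first.
      by apply/funext => x /=; rewrite -EFinM mulrC.
    exact: integrableZl.
  - exact: integrable_itvcc_cst.
  rewrite RintegralZr// Rintegral_cst//.
  move=> h; rewrite (le_trans (ler_wpM2l (ltW eta0) h))//.
  have abE : fine (lebesgue_measure `[a, b]%classic) = b - a.
    by rewrite lebesgue_measure_itv/= lte_fin; case: ltP => //= ?; lra.
  rewrite mul1r [X in _ + X + 1](abE : fine _ = _).
  rewrite -addrA mulrDr (mulrC _ eta^-1) mulrA divff ?gt_eqF// mul1r lerD2l.
  by rewrite divfK// gt_eqF//; lra.
move=> x xab.
(* [K] is the least integer with [v x <= K eta]. By minimality [x] lies in [E j] for all [j < K],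
   hence in finitely many open sets [U j], which share an interval around [x]; there [nu] is at
   least [K] times length. *)
pose J := Num.bound (v x / eta).
have [K [vK KU]] : exists K, v x <= K%:R * eta /\
    forall j, (j < K)%N -> j%:R * eta < v x.
  have vJ : v x <= J%:R * eta.
    rewrite -ler_pdivrMr//; apply: ltW; apply: archi_boundP.
    by rewrite divr_ge0// ltW.
  have exK : exists K, v x <= K%:R * eta by exists J.
  case: (ex_minnP exK) => K vK minK; exists K; split => // j jK.
  by rewrite ltNge; apply/negP => /minK; rewrite leqNgt jK.
have nearU : \forall t \near x, forall j, (j < K)%N -> U j t.
  suff : \forall t \near x, forall j : 'I_K, U j t.
    by apply: filterS => t Ut j jK; exact: (Ut (Ordinal jK)).
  have Ux (j : 'I_K) : nbhs x (U j).
    have [oU EU _] := HU j.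
    apply: open_nbhs_nbhs; split => //; apply: EU; split; last exact: KU.
    by rewrite /= in_itv.
  exact: (@filter_forall R 'I_K (fun j : 'I_K => U j) (nbhs x) _ Ux).
have /nbhs_ballP[e /= e0 eU] := nearU.
exists e => // t tab; split => tx; rewrite -mulrBr.
- rewrite sub; [|lra..].
  apply: (@le_trans _ _ (K%:R * eta * (x - t))).
    by rewrite ler_wpM2r//; lra.
  rewrite mulrAC mulrC ler_wpM2l ?(ltW eta0)//; apply: nuge; [lra..|].
  move=> j jK y; rewrite /= in_itv/= => yt; apply: eU => //.
  by rewrite /ball/= ltr_norml; lra.
- rewrite sub; [|lra..].
  apply: (@le_trans _ _ (K%:R * eta * (t - x))).
    by rewrite ler_wpM2r//; lra.
  rewrite mulrAC mulrC ler_wpM2l ?(ltW eta0)//; apply: nuge; [lra..|].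
  move=> j jK y; rewrite /= in_itv/= => yt; apply: eU => //.
  by rewrite /ball/= ltr_norml; lra.
Unshelve. all: by end_near. Qed.

Lemma is_derive_affine_bound (R : realType) (F : R -> R) (x d eta : R) :
  0 < eta -> is_derive x (1 : R) F d ->
  exists2 e, 0 < e & forall t, `|t - x| < e ->
    `|F t - F x - d * (t - x)| <= eta * `|t - x|.
Proof.
move=> eta0 [dF dFx].
have /cvgrPdist_le/(_ _ eta0) := dF; rewrite /= -/('D_1 F x) dFx => H.
have /nbhs_ballP[e /= e0 He] := H.
exists e => // t tx; have [->|tnx] := eqVneq t x.
  by rewrite !subrr mulr0 subr0 normr0 mulr0.
have := He (t - x); rewrite /ball/= sub0r normrN => /(_ tx).
rewrite subr_eq0 => /(_ tnx); rewrite [_%:A]mulr1 subrK => h.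
have tx0 : 0 < `|t - x| by rewrite normr_gt0 subr_eq0.
rewrite -ler_pdivrMr// -normfV -normrM distrC in h *.
apply: le_trans h; rewrite le_eqVlt; apply/orP; left; apply/eqP.
congr (`|_|); rewrite /GRing.scale/=; field.
by rewrite subr_eq0.
Qed.

(** With [G] the majorant primitive of [|F'|], the function [G + eta x - F] is locally
    nondecreasing: near [x], the increments of [G] are at least [|F' x|] times the step, and those
    of [F] exceed [F' x] times the step by at most [eta] times its length. Half of [eps] pays for
    [G], the other half for the slope [eta]. *)
Lemma increment_le_integral_pos_derive (R : realType) (F F' : R -> R) (a b : R) :
  a <= b -> (forall x, a <= x <= b -> is_derive x (1 : R) F (F' x)) ->
  lebesgue_measure.-integrable `[a, b] (EFin \o F') ->
  F b - F a <= \int[lebesgue_measure]_(x in `[a, b]) `|F' x|.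
Proof.
move=> ab dF iF; apply/ler_addgt0Pr => eps eps0.
pose eta := eps / 2 / (b - a + 1).
have eta0 : 0 < eta by rewrite divr_gt0//; lra.
have [G [locG Gab]] := @lsc_majorant_primitive _ (fun x => `|F' x|) a b (eps / 2) ab
  (fun x => normr_ge0 _) (integrable_norm iF) ltac:(lra).
suff : G a + eta * a - F a <= G b + eta * b - F b.
  have : eta * (b - a) <= eps / 2.
    rewrite /eta -mulrA ler_piMr//; first lra.
    by rewrite mulrC ler_pdivrMr; lra.
  by move: Gab; lra.
apply: (@locally_monotone_le _ (fun x => G x + eta * x - F x) _ _ ab) => x xab.
have [e1 e10 He1] := locG _ xab.
have [e2 e20 He2] := is_derive_affine_bound eta0 (dF _ xab).
exists (Num.min e1 e2); first by rewrite lt_min e10.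
move=> t tab; have [Hl Hr] := He1 _ tab.
split=> /andP[xt tx].
- have xte1 : x - e1 < t.
    by apply: le_lt_trans xt; rewrite lerD2l lerN2 ge_min lexx.
  have txe2 : `|t - x| < e2.
    have : x - e2 < t by apply: le_lt_trans xt; rewrite lerD2l lerN2 ge_min lexx orbT.
    by rewrite ltr_norml; lra.
  have := Hl; rewrite xte1 tx => /(_ isT) Hl'.
  have := He2 _ txe2; rewrite (_ : `|t - x| = x - t); last by rewrite ler0_norm; lra.
  rewrite ler_norml => /andP[h1 h2].
  have : F' x * (x - t) <= `|F' x| * (x - t) by rewrite ler_wpM2r ?ler_norm//; lra.
  by move: h1 h2 Hl'; lra.
- have xte1 : t < x + e1.
    by apply: lt_le_trans tx _; rewrite lerD2l ge_min lexx.
  have txe2 : `|t - x| < e2.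
    have : t < x + e2 by apply: lt_le_trans tx _; rewrite lerD2l ge_min lexx orbT.
    by rewrite ltr_norml; lra.
  have := Hr; rewrite xte1 xt => /(_ isT) Hr'.
  have := He2 _ txe2; rewrite (_ : `|t - x| = t - x); last by rewrite ger0_norm; lra.
  rewrite ler_norml => /andP[h1 h2].
  have : F' x * (t - x) <= `|F' x| * (t - x) by rewrite ler_wpM2r ?ler_norm//; lra.
  by move: h1 h2 Hr'; lra.
Qed.

(** Continuous functions [g n] approximate [F'] in L^1 and have genuine primitives [Psi]. The
    one-sided bound above, applied to [F - Psi] and to [Psi - F], leaves an error of at most twice
    the L^1 distance of [F'] and [g n]; a crude bound therefore yields an equality. *)
Lemma FTC2_everywhere_derivable (R : realType) (F F' : R -> R) (a b : R) :
  a <= b -> (forall x, a <= x <= b -> is_derive x (1 : R) F (F' x)) ->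
  lebesgue_measure.-integrable `[a, b] (EFin \o F') ->
  \int[lebesgue_measure]_(x in `[a, b]) F' x = F b - F a.
Proof.
move=> ab dF iF; pose mu := @lebesgue_measure R.
have [g [cg ig ug]] := approximation_continuous_integrable (measurable_itv _)
  (lebesgue_itvcc_lty a b) iF.
have intg n c d : mu.-integrable `[c, d] (EFin \o g n).
  apply: continuous_compact_integrable; first exact: segment_compact.
  exact/continuous_subspaceT/cg.
have psi n : exists2 Psi : R -> R, (forall x, a <= x <= b -> is_derive x (1 : R) Psi (g n x)) &
    Psi b - Psi a = \int[mu]_(x in `[a, b]) g n x.
  (* Starting at [a - 1] (and working up to [b + 1]) makes [a] and [b] interior points, so that the
     primitive has a two-sided derivative there too. *)
  exists (fun x => \int[mu]_(t in `[a - 1, x]) g n t).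
    move=> x xab.
    have [||D1 D2] := @continuous_FTC1_closed _ (g n) (a - 1) x (b + 1)
      _ (intg n _ _) _ (cg n x); [lra|lra|].
    by apply: DeriveDef => //; rewrite -derive1E.
  rewrite Rintegral_itvB ?bnd_simp; [|exact: intg|lra|done].
  by apply: Rintegral_itv_obnd_cbnd; apply: integrableS (intg n a b) => //;
    apply: subset_itvr; rewrite bnd_simp.
have bound n : `|(F b - F a) - \int[mu]_(x in `[a, b]) F' x| <=
    2 * \int[mu]_(x in `[a, b]) `|F' x - g n x|.
  have [Psi dPsi PsiE] := psi n.
  have iFg : mu.-integrable `[a, b] (EFin \o (fun x => F' x - g n x)).
    by rewrite (_ : _ \o _ = ((EFin \o F') \- (EFin \o g n))%E)//; exact: integrableB.
  have igF : mu.-integrable `[a, b] (EFin \o (fun x => g n x - F' x)).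
    by rewrite (_ : _ \o _ = ((EFin \o g n) \- (EFin \o F'))%E)//; exact: integrableB.
  have h1 := @increment_le_integral_pos_derive _ (F \- Psi) _ _ _ ab
    (fun x xab => is_deriveB (dF x xab) (dPsi x xab)) iFg.
  have h2 := @increment_le_integral_pos_derive _ (Psi \- F) _ _ _ ab
    (fun x xab => is_deriveB (dPsi x xab) (dF x xab)) igF.
  have h3 : `|\int[mu]_(x in `[a, b]) g n x - \int[mu]_(x in `[a, b]) F' x| <=
      \int[mu]_(x in `[a, b]) `|F' x - g n x|.
    rewrite distrC -RintegralB//.
    exact: le_normr_Rintegral.
  move: h2; under eq_Rintegral do rewrite distrC.
  rewrite -PsiE in h3; move: h1 h3; rewrite /= !ler_norml; lra.
apply/eqP; rewrite eq_sym -subr_eq0 -normr_eq0 eq_le normr_ge0 andbT.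
apply/ler_addgt0Pr => e e0; rewrite add0r.
have e20 : 0 < e / 2 by lra.
have /fine_cvgP[_ /cvgrPdist_lt/(_ _ e20)[n _ /(_ n (leqnn n))]] := ug.
rewrite sub0r normrN => /(le_lt_trans (ler_norm _)) h.
by rewrite (le_trans (bound n))// mulrC -ler_pdivlMr// ltW.
Qed.

(** * Invariance of Lebesgue measure *)

Section integral_swap.
Context d1 d2 (T1 : measurableType d1) (T2 : measurableType d2) (R : realType).
Variables (m1 : {sigma_finite_measure set T1 -> \bar R})
  (m2 : {sigma_finite_measure set T2 -> \bar R}).

Lemma ge0_integral_swap (F : T1 -> T2 -> \bar R) :
  measurable_fun setT (fun p : T1 * T2 => F p.1 p.2) ->
  (forall x y, 0 <= F x y)%E ->
  (\int[m1]_x \int[m2]_y F x y = \int[m2]_y \int[m1]_x F x y)%E.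
Proof. by move=> mF F0; exact: (fubini_tonelli (fun p => F p.1 p.2)). Qed.

Lemma measurable_integral_snd (F : T1 -> T2 -> \bar R) :
  measurable_fun setT (fun p : T1 * T2 => F p.1 p.2) ->
  (forall x y, 0 <= F x y)%E ->
  measurable_fun setT (fun x => \int[m2]_y F x y)%E.
Proof.
by move=> mF F0; exact: (measurable_fun_fubini_tonelli_F (fun p => F p.1 p.2)).
Qed.

End integral_swap.

Section measure_preserving.
Context d1 d2 (T1 : measurableType d1) (T2 : measurableType d2) (R : realType).
Variables (mu : {measure set T1 -> \bar R}) (nu : {measure set T2 -> \bar R}).

Lemma ge0_integral_measure_preserving (phi : T1 -> T2) (h : T2 -> \bar R) :
  measurable_fun [set: T1] phi ->
  (forall A, measurable A -> mu (phi @^-1` A) = nu A) ->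
  measurable_fun [set: T2] h -> (forall x, (0 <= h x)%E) ->
  (\int[mu]_x h (phi x) = \int[nu]_x h x)%E.
Proof.
move=> mphi muphi mh h0.
rewrite -(preimage_setT phi) -(ge0_integral_pushforward mphi mu measurableT mh)//.
by apply: eq_measure_integral => A mA _; exact: muphi.
Qed.

End measure_preserving.

Section measurable_cV_ops.
Context d (T : measurableType d) (R : realType).

Lemma measurable_cVD n (f g : T -> 'cV[R]_n) :
  measurable_fun [set: T] f -> measurable_fun [set: T] g ->
  measurable_fun [set: T] (fun x => f x + g x).
Proof.
move=> /measurable_fun_cVP mf /measurable_fun_cVP mg; apply/measurable_fun_cVP => i.
under eq_fun do rewrite mxE.
exact: measurable_funD.
Qed.

Lemma measurable_cVN n (f : T -> 'cV[R]_n) :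
  measurable_fun [set: T] f -> measurable_fun [set: T] (fun x => - f x).
Proof.
move=> /measurable_fun_cVP mf; apply/measurable_fun_cVP => i.
under eq_fun do rewrite mxE.
exact: measurableT_comp.
Qed.

Lemma measurable_cVZ n (s : T -> R) (f : T -> 'cV[R]_n) :
  measurable_fun [set: T] s -> measurable_fun [set: T] f ->
  measurable_fun [set: T] (fun x => s x *: f x).
Proof.
move=> ms /measurable_fun_cVP mf; apply/measurable_fun_cVP => i.
under eq_fun do rewrite mxE.
exact: measurable_funM.
Qed.

Lemma measurable_cV_mulmx n p (M : 'M[R]_(n, p)) (f : T -> 'cV[R]_p) :
  measurable_fun [set: T] f -> measurable_fun [set: T] (fun x => M *m f x).
Proof.
move=> /measurable_fun_cVP mf; apply/measurable_fun_cVP => i.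
under eq_fun do rewrite mxE.
by apply: measurable_sum => j; exact: measurable_funM.
Qed.

End measurable_cV_ops.

Section lebesgue_cV_translation.
Variable R : realType.

Lemma lebesgue_measure_translation (a : R) (A : set (measurableTypeR R)) :
  measurable A -> lebesgue_measure ((fun x => x + a) @^-1` A) = lebesgue_measure A.
Proof.
move=> mA; have ma : measurable_fun [set: measurableTypeR R]
    ((fun x => x + a) : measurableTypeR R -> measurableTypeR R).
  exact: measurable_funD.
apply/esym; apply: (@lebesgue_measure_unique _
  (measure_function_pushforward__canonical__measure_function_Measure lebesgue_measure ma)) => //.
move=> _ [[u v]] _ <-; rewrite /= /pushforward.
rewrite (_ : _ @^-1` _ = `]u - a, v - a]%classic).
  rewrite !lebesgue_measure_itv/= !lte_fin ltrD2r; case: ifP => // _.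
  by rewrite -!EFinD; congr EFin; lra.
by apply/seteqP; split => x; rewrite /= !in_itv/=; lra.
Qed.

Lemma ge0_integral_lebesgue_cVS n (h : 'cV[R]_n.+1 -> \bar R) :
  measurable_fun setT h -> (forall x, 0 <= h x)%E ->
  (\int[lebesgue_cV R n.+1]_x h x =
   \int[lebesgue_measure]_x \int[lebesgue_cV R n]_v h (cV_cons (x, v)))%E.
Proof.
move=> mh h0; have mcons := @measurable_cV_cons R n.
rewrite -(@ge0_integral_measure_preserving _ _ _ _ _
  (lebesgue_measure \x lebesgue_cV R n)%E _ (@cV_cons R n))//.
rewrite fubini_tonelli1//.
exact: measurableT_comp mh mcons.
Qed.

Lemma ge0_integral_lebesgue_cV0 (h : 'cV[R]_0 -> \bar R) :
  measurable_fun setT h -> (\int[lebesgue_cV R 0]_x h x = h (0%R : 'cV[R]_0))%E.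
Proof. by move=> mh; rewrite /= integral_dirac// diracT mul1e. Qed.

(** Induction on the dimension: [lebesgue_cV] adds one coordinate at a time, so a translation splits
    into one of [R] and one in dimension [n]. *)
Lemma ge0_integral_cV_translation n (a : 'cV[R]_n) (h : 'cV[R]_n -> \bar R) :
  measurable_fun setT h -> (forall x, 0 <= h x)%E ->
  (\int[lebesgue_cV R n]_x h (x + a)%R = \int[lebesgue_cV R n]_x h x)%E.
Proof.
elim: n a h => [|n IH] a h mh h0.
  by congr (integral _ _ _); apply/funext => x; congr h; rewrite !flatmx0.
have mha (b : 'cV[R]_n.+1) : measurable_fun setT (fun x : 'cV[R]_n.+1 => h (x + b)).
  by apply: (measurableT_comp mh); apply: measurable_cVD.
rewrite !ge0_integral_lebesgue_cVS//.
have consD x v : cV_cons (x, v) + a =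
    cV_cons (x + (cV_uncons a).1, v + (cV_uncons a).2).
  apply/colP => i; rewrite mxE; case: (unliftP 0 i) => [j ->|->].
    by rewrite !cV_consS/= !mxE.
  by rewrite !cV_cons0.
under eq_integral => x _.
  under eq_integral => v _ do rewrite consD.
  rewrite (IH _ (fun v => h (cV_cons (x + (cV_uncons a).1, v))))//; last first.
    apply: (measurableT_comp mh); apply: (measurableT_comp (@measurable_cV_cons R n)).
    exact: measurable_pair1.
  over.
have mF : measurable_fun [set: measurableTypeR R]
    (fun x => \int[lebesgue_cV R n]_v h (cV_cons (x, v)))%E.
  apply: (measurable_fun_fubini_tonelli_F (fun p => h (cV_cons p))) => //.
  exact: (measurableT_comp mh (@measurable_cV_cons R n)).
apply: (@ge0_integral_measure_preserving _ _ _ _ _ lebesgue_measure lebesgue_measure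
  ((fun x => x + (cV_uncons a).1) : measurableTypeR R -> measurableTypeR R)
  (fun x => \int[lebesgue_cV R n]_v h (cV_cons (x, v)))%E) => //.
- exact: measurable_funD.
- by move=> A mA; exact: lebesgue_measure_translation.
- by move=> x; exact: integral_ge0.
Qed.

Lemma lebesgue_cV_translation n (a : 'cV[R]_n) (A : set 'cV[R]_n) : measurable A ->
  lebesgue_cV R n ((fun x : 'cV[R]_n => x + a) @^-1` A) = lebesgue_cV R n A.
Proof.
move=> mA; have ma : measurable_fun [set: 'cV[R]_n] (fun x : 'cV[R]_n => x + a).
  exact: measurable_cVD.
have mpA : measurable ((fun x : 'cV[R]_n => x + a) @^-1` A).
  by rewrite -[X in measurable X]setTI; exact: ma.
have lamE (B : set 'cV[R]_n) : measurable B ->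
    lebesgue_cV R n B = (\int[lebesgue_cV R n]_x (\1_B x)%:E)%E.
  by move=> mB; rewrite integral_indic// setIT.
rewrite !lamE//.
apply: (@ge0_integral_cV_translation n a (fun x => (\1_A x)%:E)).
  exact/measurable_EFinP/measurable_indic.
by move=> x; rewrite lee_fin.
Qed.

Lemma measurable_cV_col_mx d (T : measurableType d) k m
    (f : T -> 'cV[R]_k) (g : T -> 'cV[R]_m) :
  measurable_fun setT f -> measurable_fun setT g ->
  measurable_fun setT (fun x => col_mx (f x) (g x)).
Proof.
move=> /measurable_fun_cVP mf /measurable_fun_cVP mg; apply/measurable_fun_cVP => i.
case: (split_ordP i) => j ->.
  by under eq_fun do rewrite col_mxEu; exact: mf.
by under eq_fun do rewrite col_mxEd; exact: mg.
Qed.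

Lemma ge0_integral_lebesgue_cV_col_mx k m (h : 'cV[R]_(k + m) -> \bar R) :
  measurable_fun setT h -> (forall x, 0 <= h x)%E ->
  (\int[lebesgue_cV R (k + m)]_x h x =
   \int[lebesgue_cV R k]_y \int[lebesgue_cV R m]_z h (col_mx y z))%E.
Proof.
elim: k h => [|k IH] h mh h0.
  rewrite ge0_integral_lebesgue_cV0.
    apply: eq_integral => z _; congr h.
    by apply/colP => i; rewrite -[i in RHS](_ : rshift 0 i = i) ?col_mxEd//; exact/val_inj.
  apply: (measurable_fun_fubini_tonelli_F (fun p : 'cV_0 * 'cV_m => h (col_mx p.1 p.2))) => //.
  exact: (measurableT_comp mh (measurable_cV_col_mx measurable_fst measurable_snd)).
rewrite (ge0_integral_lebesgue_cVS (n := k + m))//.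
have colS x (y : 'cV[R]_k) (z : 'cV[R]_m) :
    cV_cons (x, col_mx y z) = col_mx (cV_cons (x, y)) z.
  apply/colP => i; case: (unliftP 0 i) => [j ->|->].
    rewrite (@cV_consS _ (k + m)) /=.
    case: (split_ordP j) => l ->.
      rewrite col_mxEu -[LHS](@cV_consS _ _ (x, y)).
      rewrite -(@col_mxEu _ _ m _ _ z); congr (col_mx _ _ _ _); exact/val_inj.
    rewrite col_mxEd -(@col_mxEd _ _ m _ (cV_cons (x, y)) z).
    by congr (col_mx _ _ _ _); exact/val_inj.
  rewrite (@cV_cons0 _ (k + m)) -[LHS](@cV_cons0 _ _ (x, y)).
  rewrite -(@col_mxEu _ _ m _ _ z); congr (col_mx _ _ _ _); exact/val_inj.
rewrite ge0_integral_lebesgue_cVS; last 2 first.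
- apply: (measurable_fun_fubini_tonelli_F
    (fun p : 'cV_k.+1 * 'cV_m => h (col_mx p.1 p.2))) => //.
  exact: (measurableT_comp mh (measurable_cV_col_mx measurable_fst measurable_snd)).
- by move=> x; exact: integral_ge0.
apply: eq_integral => x _; rewrite IH//.
  by under eq_integral => y _ do under eq_integral => z _ do rewrite colS.
apply: (measurableT_comp mh); apply: (measurableT_comp (@measurable_cV_cons R (k + m))).
exact: measurable_pair1.
Qed.

End lebesgue_cV_translation.

(** * Uniqueness of translation-invariant measures, and linear changes of variables *)

Definition translation_invariant (R : realType) n
    (mu : {measure set 'cV[R]_n -> \bar R}) :=
  forall (a : 'cV[R]_n) (A : set 'cV[R]_n), measurable A ->
    mu ((fun x : 'cV[R]_n => x + a) @^-1` A) = mu A.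

Section translation_invariant_unique.
Variables (R : realType) (n : nat).
Variables (mu nu : {sigma_finite_measure set 'cV[R]_n -> \bar R}).
Hypotheses (mui : translation_invariant mu) (nui : translation_invariant nu).

Let mu_translation (a : 'cV[R]_n) (h : 'cV[R]_n -> \bar R) :
  measurable_fun setT h -> (forall x, 0 <= h x)%E ->
  (\int[mu]_x h (x + a)%R = \int[mu]_x h x)%E.
Proof.
move=> mh h0; apply: (@ge0_integral_measure_preserving _ _ _ _ _ mu mu
  (fun x : 'cV[R]_n => x + a) h) => //; last exact: mui.
exact: measurable_cVD.
Qed.

Let nu_translation (a : 'cV[R]_n) (h : 'cV[R]_n -> \bar R) :
  measurable_fun setT h -> (forall x, 0 <= h x)%E ->
  (\int[nu]_x h (x + a)%R = \int[nu]_x h x)%E.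
Proof.
move=> mh h0; apply: (@ge0_integral_measure_preserving _ _ _ _ _ nu nu
  (fun x : 'cV[R]_n => x + a) h) => //; last exact: nui.
exact: measurable_cVD.
Qed.

(* Both sides equal [\int\int 1_A(x) 1_B(y - x)], as one sees by translating
   first [y] by [x], then [x] by [y]. *)
Lemma translation_invariant_proportional (A B : set 'cV[R]_n) :
  measurable A -> measurable B ->
  (nu A * mu B = nu (-%R @^-1` B) * mu A)%E.
Proof.
move=> mA mB.
have mN : measurable_fun setT (-%R : 'cV[R]_n -> 'cV[R]_n) by exact: measurable_cVN.
have mNB : measurable (-%R @^-1` B) by rewrite -[X in measurable X]setTI; exact: mN.
have mind (C : set 'cV[R]_n) : measurable C ->
    measurable_fun setT (fun x => (\1_C x : R)%:E).
  by move=> mC; exact/measurable_EFinP/measurable_indic.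
have massE (m : {measure set 'cV[R]_n -> \bar R}) (C : set 'cV[R]_n) :
    measurable C -> m C = (\int[m]_x (\1_C x)%:E)%E.
  by move=> mC; rewrite integral_indic// setIT.
have mcomp (C : set 'cV[R]_n) (phi : 'cV[R]_n * 'cV[R]_n -> 'cV[R]_n) :
    measurable C -> measurable_fun setT phi ->
    measurable_fun setT (fun p => (\1_C (phi p) : R)%:E).
  by move=> mC mphi; exact: measurableT_comp (mind _ mC) mphi.
have maddr (x : 'cV[R]_n) : measurable_fun setT (fun y : 'cV[R]_n => y + x).
  exact: measurable_cVD.
have msubr (x : 'cV[R]_n) : measurable_fun setT (fun y : 'cV[R]_n => y - x).
  exact: measurable_cVD.
have msubl (x : 'cV[R]_n) : measurable_fun setT (fun y : 'cV[R]_n => x - y).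
  by apply: measurable_cVD; [exact: measurable_cst|exact: measurable_cVN].
have mcomp1 (C : set 'cV[R]_n) (phi : 'cV[R]_n -> 'cV[R]_n) :
    measurable C -> measurable_fun setT phi ->
    measurable_fun setT (fun x => (\1_C (phi x) : R)%:E).
  by move=> mC mphi; exact: measurableT_comp (mind _ mC) mphi.
have msub : measurable_fun setT (fun p : 'cV[R]_n * 'cV[R]_n => p.2 - p.1).
  by apply: measurable_cVD => //; exact: measurable_cVN.
have madd : measurable_fun setT (fun p : 'cV[R]_n * 'cV[R]_n => p.2 + p.1).
  exact: measurable_cVD.
have mopp : measurable_fun setT (fun p : 'cV[R]_n * 'cV[R]_n => - p.2).
  exact: measurable_cVN.
transitivity (\int[nu]_x \int[mu]_y ((\1_A x)%:E * (\1_B (y - x)%R)%:E))%E.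
  rewrite !massE// -ge0_integralZr//; [|exact: mind|exact: integral_ge0].
  apply: eq_integral => x _; rewrite ge0_integralZl//; last exact: (mcomp1 B (fun y => y - x) mB (msubr x)).
  congr (_ * _)%E; rewrite -(mu_translation (- x) (mind _ mB))//.
etransitivity.
  apply: (@ge0_integral_swap _ _ _ _ _ nu mu (fun x y => (\1_A x)%:E * (\1_B (y - x)%R)%:E)%E).
- by apply: emeasurable_funM; exact: mcomp.
- by move=> x y; rewrite mule_ge0.
under eq_integral => y _.
  rewrite -(@nu_translation y (fun x => ((\1_A x)%:E * (\1_B (y - x)%R)%:E)%E)); last 2 first.
  - apply: emeasurable_funM; first exact: mind.
    exact: (mcomp1 B (fun x => y - x) mB (msubl y)).
  - by move=> x; rewrite mule_ge0.
  under eq_integral => x _ do rewrite opprD addrCA subrr addr0.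
  over.
etransitivity.
  apply: (@ge0_integral_swap _ _ _ _ _ mu nu (fun y x => (\1_A (x + y)%R)%:E * (\1_B (- x)%R)%:E)%E).
- apply: emeasurable_funM; first exact: mcomp.
  exact: (mcomp B (fun p => - p.2)).
- by move=> x y; rewrite mule_ge0.
rewrite [RHS](_ : _ = (\int[nu]_x ((\1_B (- x)%R)%:E * mu A)))%E; last first.
  rewrite ge0_integralZr//; last exact: (mcomp1 B -%R mB mN).
  by rewrite massE.
apply: eq_integral => x _.
under eq_integral => y _ do rewrite muleC addrC.
rewrite ge0_integralZl//; last first.
  exact: (mcomp1 A (fun y => y + x) mA (maddr x)).
congr (_ * _)%E; rewrite (mu_translation x (mind _ mA))//.
by rewrite massE.
Qed.

End translation_invariant_unique.

Section lebesgue_cV_linear.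
Variables (R : realType) (n : nat) (Q Q' : 'M[R]_n).
Hypotheses (QQ' : Q *m Q' = 1%:M) (Q'Q : Q' *m Q = 1%:M).

Let mQ : measurable_fun setT (fun x : 'cV[R]_n => Q *m x).
Proof. exact: measurable_cV_mulmx. Qed.

Definition linear_lebesgue_cV : set 'cV[R]_n -> \bar R :=
  pushforward (lebesgue_cV R n) (fun x : 'cV[R]_n => Q *m x).

Let linear_lebesgue_cV0 : linear_lebesgue_cV set0 = 0%E.
Proof. by rewrite /linear_lebesgue_cV /pushforward preimage_set0 measure0. Qed.

Let linear_lebesgue_cV_ge0 A : (0 <= linear_lebesgue_cV A)%E.
Proof. exact: (measure_ge0 (lebesgue_cV R n)). Qed.

Let linear_lebesgue_cV_sigma_additive : semi_sigma_additive linear_lebesgue_cV.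
Proof.
exact: (@measure_semi_sigma_additive _ _ _
  (measure_function_pushforward__canonical__measure_function_Measure
    (lebesgue_cV R n) mQ)).
Qed.

HB.instance Definition _ := isMeasure.Build _ _ _ linear_lebesgue_cV
  linear_lebesgue_cV0 linear_lebesgue_cV_ge0 linear_lebesgue_cV_sigma_additive.

Let linear_lebesgue_cV_sigma_finite : sigma_finite setT linear_lebesgue_cV.
Proof.
have [F TF Foo] := sigma_finiteT (lebesgue_cV R n).
exists (fun i => (fun x : 'cV[R]_n => Q' *m x) @^-1` F i).
  by rewrite -preimage_bigcup -TF preimage_setT.
move=> i; have [mF Fi] := Foo i; split.
  by rewrite -[X in measurable X]setTI; exact: measurable_cV_mulmx.
rewrite /linear_lebesgue_cV /pushforward -comp_preimage (_ : _ \o _ = id)//.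
by apply/funext => x /=; rewrite mulmxA Q'Q mul1mx.
Qed.

HB.instance Definition _ := Measure_isSigmaFinite.Build _ _ _ linear_lebesgue_cV
  linear_lebesgue_cV_sigma_finite.

Lemma linear_lebesgue_cV_translation :
  translation_invariant (linear_lebesgue_cV : {measure set 'cV[R]_n -> \bar R}).
Proof.
move=> a A mA; rewrite /= /linear_lebesgue_cV /pushforward.
have mQA : measurable ((fun x : 'cV[R]_n => Q *m x) @^-1` A).
  by rewrite -[X in measurable X]setTI; exact: mQ.
rewrite -[RHS](lebesgue_cV_translation (Q' *m a))//.
congr (lebesgue_cV R n _); apply/funext => x /=.
by rewrite mulmxDr mulmxA QQ' mul1mx.
Qed.

(** The image of Lebesgue measure under [Q] is translation invariant. For a set [B] equal to [-B],
    [translation_invariant_proportional] compares the masses of any [A] with those of [B], and since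
    the measure of [B] is neither 0 nor infinite it can be cancelled: one test set determines the
    factor [c]. *)
Lemma ge0_integral_cV_linear (B : set 'cV[R]_n) (c : R) :
  measurable B -> (forall x, B (- x) <-> B x) ->
  (0 < lebesgue_cV R n B)%E -> (lebesgue_cV R n B < +oo)%E -> 0 <= c ->
  lebesgue_cV R n ((fun x : 'cV[R]_n => Q *m x) @^-1` B) =
    (c%:E * lebesgue_cV R n B)%E ->
  forall h : 'cV[R]_n -> \bar R, measurable_fun setT h -> (forall x, 0 <= h x)%E ->
  (\int[lebesgue_cV R n]_x h (Q *m x) = c%:E * \int[lebesgue_cV R n]_x h x)%E.
Proof.
move=> mB symB B0 Boo c0 cB h mh h0.
have cE A : measurable A -> linear_lebesgue_cV A = (c%:E * lebesgue_cV R n A)%E.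
  move=> mA.
  have trans : translation_invariant (lebesgue_cV R n).
    by move=> a C mC; exact: lebesgue_cV_translation.
  have : (linear_lebesgue_cV A * lebesgue_cV R n B =
      linear_lebesgue_cV (-%R @^-1` B) * lebesgue_cV R n A)%E.
    exact: translation_invariant_proportional linear_lebesgue_cV_translation _ _ _ _.
  rewrite (_ : -%R @^-1` B = B); last by apply/seteqP; split => x /=; rewrite symB.
  rewrite [X in _ = (X * _)%E -> _](cB : linear_lebesgue_cV B = _).
  have Bfin : lebesgue_cV R n B \is a fin_num by rewrite ge0_fin_numE// ltW.
  have b0 : fine (lebesgue_cV R n B) != 0 by rewrite gt_eqF// fine_gt0// B0.
  rewrite muleAC -(fineK Bfin).
  have cancel (x : \bar R) : (x * (fine (lebesgue_cV R n B))%:E *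
      (fine (lebesgue_cV R n B))^-1%:E = x)%E.
    by rewrite -muleA -EFinM divff// mule1.
  by move=> /(congr1 (fun x => x * (fine (lebesgue_cV R n B))^-1%:E)%E); rewrite !cancel.
rewrite (ge0_integral_measure_preserving (nu := linear_lebesgue_cV) mQ _ mh h0)//.
rewrite -(ge0_integral_mscale (lebesgue_cV R n) measurableT (NngNum c0) mh)//.
by apply: eq_measure_integral => A mA _; rewrite /= cE.
Qed.

End lebesgue_cV_linear.

Section lebesgue_cV_orthogonal.
Variable R : realType.

Definition sqnorm n (x : 'cV[R]_n) : R := \sum_(i < n) x i 0 ^+ 2.

Lemma sqnorm_ge0 n (x : 'cV[R]_n) : 0 <= sqnorm x.
Proof. by apply: sumr_ge0 => i _; exact: sqr_ge0. Qed.

Lemma sqnormE n (x : 'cV[R]_n) : sqnorm x = (x^T *m x) 0 0.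
Proof. by rewrite mxE; apply: eq_bigr => i _; rewrite mxE expr2. Qed.

Lemma sqnorm_isometry n p (Q : 'M[R]_(p, n)) (x : 'cV[R]_n) :
  Q^T *m Q = 1%:M -> sqnorm (Q *m x) = sqnorm x.
Proof.
by move=> QQ; rewrite !sqnormE trmx_mul mulmxA -(mulmxA x^T) QQ mulmx1.
Qed.

Lemma sqnormZ n (c : R) (x : 'cV[R]_n) : sqnorm (c *: x) = c ^+ 2 * sqnorm x.
Proof. by rewrite /sqnorm mulr_sumr; apply: eq_bigr => i _; rewrite mxE exprMn. Qed.

Lemma measurable_sqnorm d (T : measurableType d) n (f : T -> 'cV[R]_n) :
  measurable_fun setT f -> measurable_fun setT (fun x => sqnorm (f x)).
Proof.
move=> /measurable_fun_cVP mf; apply: measurable_sum => i.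
exact: measurable_funX.
Qed.

Lemma lebesgue_cV_symbox n (r : R) : 0 <= r ->
  lebesgue_cV R n [set v | forall i, `[- r, r]%classic (v i 0)] = ((2 * r) ^+ n)%:E.
Proof.
move=> r0; rewrite (@lebesgue_cV_box R n (fun=> `[- r, r]%classic))//.
under eq_bigr do rewrite lebesgue_measure_itv/= lte_fin.
rewrite (eq_bigr (fun=> (2 * r)%:E)); last first.
  move=> i _; case: ltP => rr; last by congr EFin; lra.
  by rewrite -EFinD; congr EFin; lra.
by rewrite prodEFin prodr_const card_ord.
Qed.

Lemma measurable_cV_symbox n (r : R) :
  measurable [set v : 'cV[R]_n | forall i, `[- r, r]%classic (v i 0)].
Proof.
rewrite [X in measurable X](_ : _ = \bigcap_(i in [set: 'I_n])
    [set v : 'cV[R]_n | `[- r, r]%classic (v i 0)]); last first.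
  by apply/seteqP; split => v /= bv i; [move=> _|]; exact: bv.
apply: fin_bigcap_measurable => // i _.
have := @measurable_cV_coord _ (measurableTypeR R) n i measurableT
  _ (measurable_itv `[- r, r]).
by rewrite setTI.
Qed.

(** The test set is the Euclidean unit ball, which [Q] preserves, so the factor is 1. The ball
    contains the cube of half side [1 / (n + 1)] and lies in the cube of half side 1, whence its
    measure is positive and finite. *)
Lemma ge0_integral_cV_orthogonal n (Q : 'M[R]_n) (h : 'cV[R]_n -> \bar R) :
  Q^T *m Q = 1%:M -> measurable_fun setT h -> (forall x, 0 <= h x)%E ->
  (\int[lebesgue_cV R n]_x h (Q *m x) = \int[lebesgue_cV R n]_x h x)%E.
Proof.
move=> QQ mh h0; have QQ' := mulmx1C QQ.
rewrite -[RHS]mul1e.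
pose B := [set x : 'cV[R]_n | sqnorm x <= 1].
have mB : measurable B.
  have := measurable_sqnorm (@measurable_id _ 'cV[R]_n setT) measurableT
    (measurable_itv `]-oo, (1 : R)]).
  by rewrite setTI (_ : _ @^-1` _ = B).
apply: (ge0_integral_cV_linear QQ' QQ mB) => //.
- by move=> x; rewrite /B/= /sqnorm; under eq_bigr do rewrite mxE sqrrN.
- apply: (@lt_le_trans _ _ (lebesgue_cV R n
    [set v | forall i, `[- n.+1%:R^-1, n.+1%:R^-1]%classic (v i 0)])).
    by rewrite lebesgue_cV_symbox ?invr_ge0// lte_fin exprn_gt0// mulr_gt0// invr_gt0.
  apply: le_measure; rewrite ?inE//; first exact: measurable_cV_symbox.
  move=> x /= xn; rewrite /B/=/sqnorm.
  apply: (@le_trans _ _ (\sum_(i < n) n.+1%:R^-1)).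
    apply: ler_sum => i _; have := xn i; rewrite /= in_itv/= => xi.
    apply: (@le_trans _ _ (n.+1%:R^-1 ^+ 2)).
      rewrite -real_normK ?num_real// lerXn2r// ?nnegrE// ?invr_ge0//.
      by rewrite ler_norml.
    by rewrite expr2 ler_piMl ?invr_ge0// invf_le1// ler1n.
  by rewrite sumr_const card_ord -[X in X <= _]mulr_natl ler_pdivrMr// mul1r ler_nat.
- apply: (@le_lt_trans _ _ (lebesgue_cV R n
    [set v | forall i, `[- 1, 1]%classic (v i 0)])).
    apply: le_measure; rewrite ?inE//; first exact: measurable_cV_symbox.
    move=> x /= x1 i; rewrite in_itv/= -ler_norml -(@expr_le1 _ 2)// real_normK ?num_real//.
    apply: le_trans x1; rewrite /sqnorm (bigD1 i)//=.
    by rewrite lerDl sumr_ge0// => j _; exact: sqr_ge0.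
  by rewrite lebesgue_cV_symbox// ltry.
- rewrite mul1e (_ : _ @^-1` B = B)//; apply/seteqP.
  by split => x; rewrite /B/= sqnorm_isometry.
Qed.

(** Here the test set is the cube [[-1, 1]^n], whose preimage is again a cube of known measure. *)
Lemma ge0_integral_cV_scale n (c : R) (h : 'cV[R]_n -> \bar R) :
  c != 0 -> measurable_fun setT h -> (forall x, 0 <= h x)%E ->
  (\int[lebesgue_cV R n]_x h (c *: x)%R =
   (`|c|^-1 ^+ n)%:E * \int[lebesgue_cV R n]_x h x)%E.
Proof.
move=> c0 mh h0.
have cc : c%:M *m c^-1%:M = 1%:M :> 'M[R]_n by rewrite -scalar_mxM divff.
have cc' : c^-1%:M *m c%:M = 1%:M :> 'M[R]_n by rewrite -scalar_mxM mulVf.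
under eq_integral do rewrite -mul_scalar_mx.
apply: (ge0_integral_cV_linear cc cc' (@measurable_cV_symbox n 1)) => //.
- by move=> x; split => + i => /(_ i) /=; rewrite !in_itv/= mxE; lra.
- by rewrite lebesgue_cV_symbox// lte_fin exprn_gt0// mulr_gt0.
- by rewrite lebesgue_cV_symbox// ltry.
- rewrite lebesgue_cV_symbox// -EFinM -exprMn mulrC mulr1.
  rewrite -lebesgue_cV_symbox ?invr_ge0//; congr (lebesgue_cV R n _).
  have E (x : 'cV[R]_n) i : (`|c * x i 0| <= 1) = (`|x i 0| <= `|c|^-1).
    by rewrite normrM -[X in _ = (_ <= X)]mulr1 ler_pdivlMl ?normr_gt0.
  apply/seteqP; split => x + i => /(_ i) /=;
    by rewrite !in_itv/= mul_scalar_mx mxE -!ler_norml E.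
Qed.

End lebesgue_cV_orthogonal.

(** * Increments along the gradient *)

Lemma measurable_patchT d (T : measurableType d) (R : realType) (D : set T)
    (f : T -> \bar R) :
  measurable D -> measurable_fun setT f -> measurable_fun setT (f \_ D).
Proof.
by move=> mD mf; apply/(measurable_restrictT _ mD); exact: measurable_funTS.
Qed.

Section integral_swap_in.
Context d1 d2 (T1 : measurableType d1) (T2 : measurableType d2) (R : realType).
Variables (m1 : {sigma_finite_measure set T1 -> \bar R})
  (m2 : {sigma_finite_measure set T2 -> \bar R}).
Variables (D1 : set T1) (D2 : set T2).
Hypotheses (mD1 : measurable D1) (mD2 : measurable D2).
Variable F : T1 -> T2 -> \bar R.
Hypotheses (mF : measurable_fun setT (fun p : T1 * T2 => F p.1 p.2))
  (F0 : forall x y, (0 <= F x y)%E).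

Let G := fun x y => ((fun p : T1 * T2 => F p.1 p.2) \_ (D1 `*` D2)) (x, y).

Let mG : measurable_fun setT (fun p : T1 * T2 => G p.1 p.2).
Proof.
rewrite (_ : (fun p => _) = (fun p : T1 * T2 => F p.1 p.2) \_ (D1 `*` D2)).
  exact: measurable_patchT (measurableX mD1 mD2) mF.
by apply/funext => -[].
Qed.

Let G0 x y : (0 <= G x y)%E.
Proof. by rewrite /G/= patchE; case: ifP. Qed.

Lemma ge0_integral_swap_in :
  (\int[m1]_(x in D1) \int[m2]_(y in D2) F x y =
   \int[m2]_(y in D2) \int[m1]_(x in D1) F x y)%E.
Proof.
transitivity (\int[m1]_x \int[m2]_y G x y)%E.
  rewrite integral_mkcond; apply: eq_integral => x _; rewrite patchE.
  case: ifPn => xD; last first.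
    rewrite integral0_eq// => y _; rewrite /G patchE ifF//.
    by apply/negP => /set_mem[/mem_set]; rewrite (negbTE xD).
  rewrite integral_mkcond; apply: eq_integral => y _; rewrite /G !patchE.
  congr (if _ then _ else _); apply/idP/idP => [yD|/set_mem[_ /mem_set]//].
  by rewrite inE; split; exact: set_mem.
rewrite (@ge0_integral_swap _ _ _ _ _ m1 m2 G mG G0).
rewrite [RHS]integral_mkcond; apply: eq_integral => y _; rewrite patchE.
case: ifPn => yD; last first.
  rewrite integral0_eq// => x _; rewrite /G patchE ifF//.
  by apply/negP => /set_mem[_ /mem_set]; rewrite (negbTE yD).
rewrite [RHS]integral_mkcond; apply: eq_integral => x _; rewrite /G !patchE.
congr (if _ then _ else _); apply/idP/idP => [/set_mem[/mem_set]//|xD].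
by rewrite inE; split; exact: set_mem.
Qed.

Lemma measurable_integral_in : measurable_fun setT (fun x => \int[m2]_(y in D2) F x y)%E.
Proof.
under eq_fun do rewrite integral_mkcond.
apply: (@measurable_integral_snd _ _ _ _ _ m2 (fun x => (F x) \_ D2)).
- rewrite (_ : (fun p => _) = (fun p : T1 * T2 => F p.1 p.2) \_ (setT `*` D2)).
    exact: measurable_patchT (measurableX measurableT mD2) mF.
  apply/funext => -[x y] /=; rewrite !patchE; congr (if _ then _ else _).
  by apply/idP/idP => [yD|/set_mem[_ /mem_set]//]; rewrite inE; split => //; exact: set_mem.
- by move=> x y; rewrite patchE; case: ifP.
Qed.

End integral_swap_in.

Lemma cvge0P (R : realType) (u : nat -> \bar R) : (forall n, 0 <= u n)%E ->
  (u @ \oo --> 0%E) <->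
  (forall e, 0 < e -> exists N, forall n, (N <= n)%N -> (u n <= e%:E)%E).
Proof.
move=> u0; split => [/fine_cvgP[ufin uc] e e0|H].
  have /cvgrPdist_le/(_ _ e0)[N2 _ H2] := uc; have [N1 _ H1] := ufin.
  exists (maxn N1 N2) => n; rewrite geq_max => /andP[/H1 un /H2].
  by rewrite sub0r normrN -lee_fin -abse_EFin fineK// gee0_abs.
apply/fine_cvgP; split.
  have [N HN] := H 1 ltac:(by []); exists N => // n /= /HN un.
  by rewrite ge0_fin_numE// (le_lt_trans un)// ltry.
apply/cvgrPdist_le => e e0; have [N HN] := H e e0; exists N => // n /= /HN un.
have unfin : u n \is a fin_num by rewrite ge0_fin_numE// (le_lt_trans un)// ltry.
by rewrite sub0r normrN -lee_fin -abse_EFin fineK// gee0_abs.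
Qed.

(** * Continuity of translations in L^1 *)

Section L1_translation_R.
Variable R : realType.
Let mu := @lebesgue_measure R.

(** The unit interval shifted by at most 1 stays inside [[-1, 2]]; this window is the origin of the
    interval on which integrability is asked below. *)
Lemma ge0_integral_itv_translation (s : R) (h : R -> \bar R) : `|s| <= 1 ->
  measurable_fun setT h -> (forall x, 0 <= h x)%E ->
  (\int[mu]_(r in `[0%R, 1%R]) h (r + s)%R <= \int[mu]_(r in `[(- 1)%R, 2%R]) h r)%E.
Proof.
move=> s1 mh h0; rewrite [leLHS]integral_mkcond [leRHS]integral_mkcond.
pose k := h \_ `[(- 1)%R, 2%R]%classic.
have mk : measurable_fun setT k.
  exact: measurable_patchT.
have k0 x : (0 <= k x)%E by rewrite /k patchE; case: ifP.
have mt : measurable_fun [set: measurableTypeR R]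
    ((fun x => x + s) : measurableTypeR R -> measurableTypeR R).
  exact: measurable_funD.
have mht : measurable_fun [set: measurableTypeR R] (fun r : measurableTypeR R => h (r + s)%R).
  exact: measurableT_comp mh mt.
rewrite -[leRHS](@ge0_integral_measure_preserving _ _ _ _ _ mu mu
  ((fun x => x + s) : measurableTypeR R -> measurableTypeR R))//; last first.
  by move=> A mA; exact: lebesgue_measure_translation.
apply: ge0_le_integral => //.
- by move=> x _; rewrite patchE; case: ifP.
- exact: (measurable_patchT (T := measurableTypeR R) (measurable_itv _) mht).
- exact: measurableT_comp mk mt.
- move=> x _; rewrite /k !patchE; case: ifPn => [|_]; last by case: ifP.
  rewrite inE/= in_itv/= => x01; rewrite mem_set//= in_itv/=.
  by move: s1; rewrite ler_norml; lra.
Qed.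

(** Three parts of size [e / 3]: a continuous [g n] replaces [F] at [r + s j] and at [r], both at
    the price of its L^1 distance to [F] on [[-1, 2]], and for [g n] itself dominated convergence
    applies, with its bound on the compact interval. *)
Lemma L1_translation_cvg_itv (F : R -> R) (s : R ^nat) :
  measurable_fun setT F -> mu.-integrable `[- 1, 2] (EFin \o F) ->
  (forall n, `|s n| <= 1) -> s @ \oo --> 0 ->
  (\int[mu]_(r in `[0%R, 1%R]) `|F (r + s n) - F r|%:E)%E @[n --> \oo] --> 0%E.
Proof.
move=> mF iF s1 s0.
have [g [cg ig ug]] := approximation_continuous_integrable (measurable_itv _)
  (lebesgue_itvcc_lty (- 1) 2) iF.
have mg n : measurable_fun setT (g n) by exact: continuous_measurable_fun.
have mabs (u v : R -> R) : measurable_fun setT u -> measurable_fun setT v ->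
    measurable_fun setT (fun r => `|u r - v r|%:E).
  by move=> mu' mv; apply/measurable_EFinP; apply: measurableT_comp => //; exact: measurable_funB.
have mshift (u : R -> R) (t : R) : measurable_fun setT u ->
    measurable_fun setT (fun r : R => u (r + t)).
  by move=> mu'; apply: (measurableT_comp mu'); exact: measurable_funD.
have gcvg n : (\int[mu]_(r in `[0%R, 1%R]) `|g n (r + s j) - g n r|%:E)%E
    @[j --> \oo] --> 0%E.
  have [M gM] : exists M, forall r, -1 <= r <= 2 -> `|g n r| <= M.
    have : compact (g n @` `[- 1, 2]).
      apply: continuous_compact; last exact: segment_compact.
      exact/continuous_subspaceT/cg.
    move=> /compact_bounded[M [_ HM]]; exists (M + 1) => r r12.
    by apply: (HM (M + 1)); [rewrite ltrDl|exists r => //=; rewrite in_itv].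
  have -> : 0%E = (\int[mu]_(r in `[0%R, 1%R]) cst 0 r)%E :> \bar R by rewrite integral_cst// mul0e.
  apply: (@dominated_cvg _ _ _ mu _ _ _ _ (EFin \o cst (M + M))) => //.
  - move=> j; apply: measurable_funTS; exact: mabs (mshift _ _ (mg n)) (mg n).
  - move=> r _; rewrite [X in _ --> X](_ : _ = `|g n r - g n r|%:E); last by rewrite subrr normr0.
    apply: cvg_EFin; first by near=> j.
    apply: cvg_norm; apply: cvgB; last exact: cvg_cst.
    apply: (@cvg_comp _ _ _ (fun j => r + s j) (g n) _ (nbhs r)); last exact: cg.
    have : r + s j @[j --> \oo] --> r + 0 by apply: cvgD => //; exact: cvg_cst.
    by rewrite addr0.
  - exact: integrable_itvcc_cst.
  - move=> j r; rewrite /= in_itv/= => r01; rewrite ?normr_id lee_fin.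
    have := s1 j; rewrite ler_norml => sj.
    by rewrite (le_trans (ler_normB _ _))// lerD// gM; lra.
apply/cvge0P => [n|e e0]; first exact: integral_ge0.
have e30 : 0 < e / 3 by lra.
have ug0 n : (0 <= \int[mu]_(z in `[(- 1)%R, 2%R]) `|(F z - g n z)%:E|)%E.
  by apply: integral_ge0.
have /(cvge0P ug0)/(_ _ e30)[n /(_ _ (leqnn n)) ugn] := ug.
have gs0 j : (0 <= \int[mu]_(r in `[0%R, 1%R]) `|g n (r + s j) - g n r|%:E)%E.
  by apply: integral_ge0.
have /(cvge0P gs0)/(_ _ e30)[N HN] := gcvg n.
exists N => j /HN gsj.
have mFg := mabs _ _ mF (mg n).
have m1 := mshift (fun r => `|F r - g n r|) (s j) ltac:(exact/measurable_EFinP).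
have m2 := mabs _ _ (mshift _ (s j) (mg n)) (mg n).
apply: (@le_trans _ _ (\int[mu]_(r in `[0%R, 1%R]) (`|F (r + s j) - g n (r + s j)|%:E +
    (`|g n (r + s j) - g n r|%:E + `|F r - g n r|%:E)))%E).
  apply: ge0_le_integral => //.
  - by apply: measurable_funTS; exact: mabs (mshift _ _ mF) mF.
  - apply: measurable_funTS; apply: emeasurable_funD; first exact/measurable_EFinP.
    exact: emeasurable_funD.
  - move=> r _; rewrite -!EFinD lee_fin.
    rewrite (_ : F (r + s j) - F r = (F (r + s j) - g n (r + s j)) +
      ((g n (r + s j) - g n r) - (F r - g n r))); last by lra.
    by rewrite (le_trans (ler_normD _ _))// lerD2l ler_normB.
have tr t : `|t| <= 1 ->
    (\int[mu]_(r in `[0%R, 1%R]) `|F (r + t) - g n (r + t)|%:E <= (e / 3)%:E)%E.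
  move=> t1; apply: le_trans ugn.
  exact: (@ge0_integral_itv_translation t (fun r => `|F r - g n r|%:E)).
rewrite ge0_integralD//; last 3 first.
- by apply: measurable_funTS; exact/measurable_EFinP.
- by move=> r _; rewrite adde_ge0.
- by apply: measurable_funTS; exact: emeasurable_funD.
rewrite ge0_integralD//; last 2 first.
- exact: measurable_funTS.
- exact: measurable_funTS.
rewrite (_ : e%:E = (e / 3)%:E + ((e / 3)%:E + (e / 3)%:E))%E; last first.
  by rewrite -!EFinD; congr EFin; lra.
apply: leeD; first exact: tr.
apply: leeD => //.
apply: le_trans (tr 0 _); last by rewrite normr0.
rewrite le_eqVlt; apply/orP; left; apply/eqP.
by apply: eq_integral => r _; rewrite !addr0.
Unshelve. all: by end_near. Qed.

End L1_translation_R.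

Lemma lebesgue_itv01 (R : realType) :
  lebesgue_measure (`[0, 1]%classic : set R) = 1%E.
Proof. by rewrite lebesgue_measure_itv/= lte_fin ltr01 oppr0 adde0. Qed.

Section L1_translation_cV.
Variables (R : realType) (n : nat).
Let leb := @lebesgue_measure R.
Let lam := lebesgue_cV R n.
Implicit Types (u : 'cV[R]_n -> R) (a b x : 'cV[R]_n).

Lemma measurable_along (u : 'cV[R]_n -> R) a : measurable_fun setT u ->
  measurable_fun setT (fun p : 'cV[R]_n * measurableTypeR R => u (p.1 + p.2 *: a)).
Proof.
by move=> mu; apply: (measurableT_comp mu); apply: measurable_cVD => //; exact: measurable_cVZ.
Qed.

Lemma measurable_along_line (u : 'cV[R]_n -> R) a x : measurable_fun setT u ->
  measurable_fun [set: measurableTypeR R] (fun r : measurableTypeR R => u (x + r *: a)).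
Proof.
by move=> mu; apply: (measurableT_comp mu); apply: measurable_cVD => //; exact: measurable_cVZ.
Qed.

Lemma measurable_cV_shift (u : 'cV[R]_n -> R) a : measurable_fun setT u ->
  measurable_fun setT (fun x : 'cV[R]_n => u (x + a)).
Proof.
by move=> mu; apply: (measurableT_comp mu); exact: measurable_cVD.
Qed.

Lemma integral_along_segments u a (c d : R) : measurable_fun setT u ->
  (\int[lam]_x \int[leb]_(r in `[c, d]) `|u (x + r *: a)%R|%:E =
   leb `[c, d]%classic * \int[lam]_x `|u x|%:E)%E.
Proof.
move=> mu; have mau : measurable_fun setT (fun x => `|u x|) by exact: measurableT_comp.
rewrite (@ge0_integral_swap_in _ _ _ _ _ lam leb setT _ _ _
  (fun x (r : measurableTypeR R) => `|u (x + r *: a)%R|%:E))//; last first.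
  by apply/measurable_EFinP; exact: (measurable_along a mau).
under eq_integral => r _.
  rewrite (@ge0_integral_cV_translation _ _ (r *: a) (fun x => `|u x|%:E))//; last exact/measurable_EFinP.
  over.
by rewrite integral_cst// muleC.
Qed.

(** By Tonelli and translation invariance, the integral over [x] of the segment integrals of [|u|]
    is the length of the segment times the L^1 norm of [u]; being finite, it forces almost every
    segment integral to be finite. *)
Lemma ae_integrable_along_segments u a (c d : R) :
  lam.-integrable setT (EFin \o u) ->
  {ae lam, forall x, leb.-integrable `[c, d] (fun r => (u (x + r *: a))%:E)}.
Proof.
move=> /integrableP[/measurable_EFinP mu iu].
have mau : measurable_fun setT (fun x => `|u x|) by exact: measurableT_comp.
pose I x := (\int[leb]_(r in `[c, d]) `|u (x + r *: a)%R|%:E)%E.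
have I0 x : (0 <= I x)%E by exact: integral_ge0.
have mI : measurable_fun setT I.
  apply: (@measurable_integral_in _ _ _ _ _ leb `[c, d]%classic _
    (fun x (r : measurableTypeR R) => `|u (x + r *: a)%R|%:E)) => //.
  by apply/measurable_EFinP; exact: (measurable_along a mau).
have iI : lam.-integrable setT I.
  apply/integrableP; split => //.
  under eq_integral do rewrite gee0_abs//.
  rewrite integral_along_segments// lte_mul_pinfty//.
  by rewrite ge0_fin_numE// lebesgue_itvcc_lty.
apply: filterS (integrable_ae measurableT iI) => x /(_ Logic.I) Ix.
apply/integrableP; split.
  by apply/measurable_EFinP; apply: measurable_funTS; exact: measurable_along_line.
have : (I x < +oo)%E by rewrite -ge0_fin_numE.
exact.
Qed.

(** Translation invariance allows averaging the integrand over the base points [x + r b], [r] in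
    [[0, 1]]. This turns the claim into the one-dimensional one on almost every line parallel to
    [b], followed by dominated convergence in [x]: the majorant is twice the integral [G] of [|u|]
    over [[-1, 2]] along the line, which is integrable in [x]. *)
Lemma L1_translation_cvg u b (s : R ^nat) :
  lam.-integrable setT (EFin \o u) -> (forall n, `|s n| <= 1) -> s @ \oo --> 0 ->
  (\int[lam]_x `|u (x + s j *: b)%R - u x|%:E)%E @[j --> \oo] --> 0%E.
Proof.
move=> iu s1 s0; have /integrableP[/measurable_EFinP mu iu'] := iu.
have mau : measurable_fun setT (fun x => `|u x|) by exact: measurableT_comp.
have mdiff t : measurable_fun setT (fun x => `|u (x + t *: b) - u x|).
  apply: measurableT_comp => //; apply: measurable_funB => //.
  exact: measurable_cV_shift.
pose J j x := (\int[leb]_(r in `[0%R, 1%R]) `|u (x + (r + s j) *: b)%R - u (x + r *: b)%R|%:E)%E.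
have mJj j : measurable_fun setT (fun p : 'cV[R]_n * measurableTypeR R =>
    `|u (p.1 + (p.2 + s j) *: b)%R - u (p.1 + p.2 *: b)%R|%:E).
  apply/measurable_EFinP; apply: measurableT_comp => //; apply: measurable_funB.
    apply: (measurableT_comp mu); apply: measurable_cVD => //.
    by apply: measurable_cVZ => //; exact: measurable_funD.
  exact: measurable_along.
have J0 j x : (0 <= J j x)%E by exact: integral_ge0.
have mJ j : measurable_fun setT (J j).
  exact: (@measurable_integral_in _ _ _ _ _ leb `[0, 1]%classic _
    (fun x (r : measurableTypeR R) => `|u (x + (r + s j) *: b)%R - u (x + r *: b)%R|%:E)).
have JE j : (\int[lam]_x `|u (x + s j *: b)%R - u x|%:E = \int[lam]_x J j x)%E.
  rewrite (@ge0_integral_swap_in _ _ _ _ _ lam leb setT `[0, 1]%classic _ _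
    (fun x (r : measurableTypeR R) => `|u (x + (r + s j) *: b)%R - u (x + r *: b)%R|%:E))//.
  under [RHS]eq_integral => r _.
    under eq_integral => x _ do rewrite scalerDl addrA.
    rewrite (@ge0_integral_cV_translation _ _ (r *: b)
      (fun x => `|u (x + s j *: b)%R - u x|%:E))//; last exact/measurable_EFinP.
    over.
  by rewrite integral_cst// [X in (_ * X)%E](lebesgue_itv01 R : _ = 1%E) mule1.
pose G x := (\int[leb]_(r in `[(- 1)%R, 2%R]) `|u (x + r *: b)%R|%:E)%E.
have G0 x : (0 <= G x)%E by exact: integral_ge0.
have mG : measurable_fun setT G.
  apply: (@measurable_integral_in _ _ _ _ _ leb `[(- 1), 2]%classic _
    (fun x (r : measurableTypeR R) => `|u (x + r *: b)%R|%:E)) => //.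
  by apply/measurable_EFinP; exact: (measurable_along b mau).
have iG : lam.-integrable setT G.
  apply/integrableP; split => //.
  under eq_integral do rewrite gee0_abs//.
  rewrite integral_along_segments// lte_mul_pinfty//.
  by rewrite ge0_fin_numE// lebesgue_itvcc_lty.
have mux t x : measurable_fun [set: measurableTypeR R]
    (fun r : measurableTypeR R => `|u (x + (r + t) *: b)|).
  apply: (measurableT_comp mau); apply: measurable_cVD => //.
  by apply: measurable_cVZ => //; exact: measurable_funD.
have mJx j x : measurable_fun [set: measurableTypeR R]
    (fun r : measurableTypeR R => `|u (x + (r + s j) *: b) - u (x + r *: b)|).
  apply: measurableT_comp => //; apply: measurable_funB.
    apply: (measurableT_comp mu); apply: measurable_cVD => //.
    by apply: measurable_cVZ => //; exact: measurable_funD.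
  exact: measurable_along_line.
have JG j x : (J j x <= G x + G x)%E.
  apply: (@le_trans _ _ (\int[leb]_(r in `[0%R, 1%R])
      (`|u (x + (r + s j) *: b)%R|%:E + `|u (x + (r + 0) *: b)%R|%:E))%E).
    apply: ge0_le_integral => //.
    - by apply: measurable_funTS; apply/measurable_EFinP; exact: (mJx j x).
    - by apply: measurable_funTS; apply: emeasurable_funD; apply/measurable_EFinP; exact: (mux _ x).
    - by move=> r _; rewrite -EFinD lee_fin addr0 ler_normB.
  rewrite ge0_integralD//; last 2 first.
  - by apply: measurable_funTS; apply/measurable_EFinP; exact: (mux _ x).
  - by apply: measurable_funTS; apply/measurable_EFinP; exact: (mux _ x).
  apply: leeD.
    apply: (@ge0_integral_itv_translation _ (s j) (fun r => `|u (x + r *: b)%R|%:E)) => //.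
    by apply/measurable_EFinP; exact: measurable_along_line mau.
  apply: (@ge0_integral_itv_translation _ 0 (fun r => `|u (x + r *: b)%R|%:E)) => //.
    by rewrite normr0.
  by apply/measurable_EFinP; exact: measurable_along_line mau.
under eq_fun do rewrite JE.
have -> : 0%E = (\int[lam]_x cst 0 x)%E :> \bar R by rewrite integral0.
have [] := @dominated_convergence _ _ _ lam setT measurableT J (cst 0%E) (G \+ G)%E mJ => //.
- apply: filterS (ae_integrable_along_segments b (- 1) 2 iu) => x ix _.
  rewrite /J.
  exact: (@L1_translation_cvg_itv _ (fun r => u (x + r *: b)) s
    (measurable_along_line b x mu) ix s1 s0).
- exact: integrableD.
- by apply: aeW => x j _; rewrite gee0_abs//; exact: JG.
Qed.

(** The sequential statement is made uniform in [t] by contradiction, with counterexamples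
    [|t| <= 1 / (k + 1)]; the uniformity is what bounds the error of all points of a step at
    once. *)
Lemma L1_translation_small u b (e : R) :
  lam.-integrable setT (EFin \o u) -> 0 < e ->
  exists2 d, 0 < d & forall t, `|t| <= d ->
    (\int[lam]_x `|u (x + t *: b)%R - u x|%:E <= e%:E)%E.
Proof.
move=> iu e0; apply: contrapT => H.
have Hs k : exists t, `|t| <= k.+1%:R^-1 /\
    ~ (\int[lam]_x `|u (x + t *: b)%R - u x|%:E <= e%:E)%E.
  apply: contrapT => Hk; apply: H; exists k.+1%:R^-1; first by rewrite invr_gt0.
  by move=> t tk; apply: contrapT => Ht; apply: Hk; exists t.
have [s Hs'] := choice Hs.
have s1 k : `|s k| <= 1.
  by have [sk _] := Hs' k; rewrite (le_trans sk)// invf_le1// ler1n.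
have s0 : s @ \oo --> 0.
  apply/cvgrPdist_le => eps eps0; near=> k; rewrite sub0r normrN.
  have [sk _] := Hs' k; rewrite (le_trans sk)// ltW//.
  near: k; exact: (near_infty_natSinv_lt (PosNum eps0)).
have J0 j : (0 <= \int[lam]_x `|u (x + s j *: b)%R - u x|%:E)%E by exact: integral_ge0.
have /(cvge0P J0)/(_ _ e0)[N /(_ _ (leqnn N))] := L1_translation_cvg b iu s1 s0.
by have [_ /[apply]] := Hs' N.
Unshelve. all: by end_near. Qed.

End L1_translation_cV.

Lemma lebesgue_itvccE (R : realType) (a b : R) : a <= b ->
  lebesgue_measure `[a, b]%classic = (b - a)%:E.
Proof.
move=> ab; rewrite lebesgue_measure_itv/= lte_fin; case: ltP => // ba.
by congr EFin; lra.
Qed.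

Lemma nneseries_lty_cvg0 (R : realType) (u : nat -> \bar R) : (forall k, 0 <= u k)%E ->
  (\sum_(0 <= k <oo) u k < +oo)%E -> u @ \oo --> 0%E.
Proof.
move=> u0 /nneseries_tail_cvg/(_ (fun k _ => u0 k)) tl.
apply/(cvge0P u0) => e e0.
have tl0 N : (0 <= \sum_(N <= k <oo) u k)%E by exact: nneseries_ge0.
have /(cvge0P tl0)/(_ _ e0)[N HN] := tl; exists N => n /HN; apply: le_trans.
have := @nneseries_lim_ge R u xpredT n n.+1 (fun k _ _ => u0 k).
by rewrite big_nat1.
Qed.

Lemma integral_itv_translation (R : realType) (a b s : R) (h : R -> \bar R) :
  measurable_fun setT h ->
  (\int[lebesgue_measure]_(r in `[a, b]) h (r + s)%R =
   \int[lebesgue_measure]_(r in `[(a + s)%R, (b + s)%R]) h r)%E.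
Proof.
move=> mh; pose mu := @lebesgue_measure R.
have ge0 (k : R -> \bar R) : measurable_fun setT k -> (forall x, 0 <= k x)%E ->
    (\int[mu]_(r in `[a, b]) k (r + s)%R = \int[mu]_(r in `[(a + s)%R, (b + s)%R]) k r)%E.
  move=> mk k0; rewrite [LHS]integral_mkcond [RHS]integral_mkcond.
  pose k' := k \_ `[(a + s)%R, (b + s)%R]%classic.
  have mk' : measurable_fun [set: measurableTypeR R] k'.
    exact: (measurable_patchT (T := measurableTypeR R)).
  have mt : measurable_fun [set: measurableTypeR R]
      ((fun x => x + s) : measurableTypeR R -> measurableTypeR R).
    exact: measurable_funD.
  rewrite -[RHS](@ge0_integral_measure_preserving _ _ _ _ _ mu mu
    ((fun x => x + s) : measurableTypeR R -> measurableTypeR R))//.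
  - apply: eq_integral => x _; rewrite /k' !patchE; congr (if _ then _ else _).
    by apply/idP/idP; rewrite !inE/= !in_itv/=; lra.
  - by move=> A mA; exact: lebesgue_measure_translation.
  - by move=> x; rewrite /k' patchE; case: ifP.
rewrite integralE [RHS]integralE.
congr (_ - _)%E.
- rewrite -(ge0 h^\+%E (measurable_funepos mh) (funepos_ge0 h)).
  apply: eq_integral => r _.
  exact: (congr1 (fun g => g r) (funepos_comp h (fun r => r + s))).
- rewrite -(ge0 h^\-%E (measurable_funeneg mh) (funeneg_ge0 h)).
  apply: eq_integral => r _.
  exact: (congr1 (fun g => g r) (funeneg_comp h (fun r => r + s))).
Qed.

(** * Increments as integrals of a directional derivative *)

Section directional_increment.
Variables (R : realType) (n : nat).
Let leb := @lebesgue_measure R.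
Let lam := lebesgue_cV R n.
Implicit Types (u v f : 'cV[R]_n -> R) (a b x : 'cV[R]_n) (E : set 'cV[R]_n).

Lemma ae_cV_translation (P : 'cV[R]_n -> Prop) a :
  {ae lam, forall x, P x} -> {ae lam, forall x, P (x + a)}.
Proof.
move=> [N [mN N0 PN]].
have ma : measurable_fun setT (fun x : 'cV[R]_n => x + a) by exact: measurable_cVD.
exists ((fun x : 'cV[R]_n => x + a) @^-1` N); split.
- by rewrite -[X in measurable X]setTI; exact: ma.
- by rewrite /lam lebesgue_cV_translation.
- by move=> x /= Px; apply: PN.
Qed.

(** The null set may depend on [s], and only starting points whose whole segment stays in [E] are
    concerned. In this form the property is inherited by sums of directions, although a given line
    in the direction [a + b] need not contain any good segment in the direction [a] or [b]. *)
Definition increment_is_integral E f a u := forall s, 0 <= s ->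
  {ae lam, forall x, (forall t, 0 <= t <= s -> E (x + t *: a)) ->
    f (x + s *: a) - f x = \int[leb]_(t in `[0, s]) u (x + t *: a)}.

Lemma is_derive_along_line f a x (s d : R) : is_derive (x + s *: a) a f d ->
  is_derive s (1 : R) (fun t => f (x + t *: a)) d.
Proof.
move=> [df dfE].
have E : (fun h => h^-1 *: (f (x + (h *: (1 : R) + s) *: a) - f (x + s *: a))) =
    (fun h => h^-1 *: (f (h *: a + (x + s *: a)) - f (x + s *: a))).
  apply/funext => h; congr (_ *: (f _ - _)).
  by rewrite scalerDl addrCA [h *: 1]mulr1.
by split; [rewrite /derivable|rewrite /derive]; rewrite /= E.
Qed.

(** On almost every segment [u] is integrable, and on those inside [E] the derivative exists at
    every point; these are exactly the conditions of [FTC2_everywhere_derivable]. *)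
Lemma increment_is_integral_derive E f a u : lam.-integrable setT (EFin \o u) ->
  (forall x, E x -> is_derive x a f (u x)) -> increment_is_integral E f a u.
Proof.
move=> iu Ef s s0.
apply: filterS (ae_integrable_along_segments a 0 s iu) => x ix Ex.
have df t : 0 <= t <= s ->
    is_derive t (1 : R) (fun t => f (x + t *: a)) (u (x + t *: a)).
  by move=> t0s; apply: is_derive_along_line; apply: Ef; exact: Ex.
have -> := FTC2_everywhere_derivable s0 df ix.
by rewrite scale0r addr0.
Qed.

Lemma increment_is_integral0 E f : increment_is_integral E f 0 (cst 0).
Proof.
move=> s s0; apply: aeW => x _; rewrite scaler0 addr0 subrr.
by rewrite Rintegral_cst// mul0r.
Qed.

(** Tube lemma: the segment is compact and [E] open. It serves to keep fine staircases around a
    diagonal segment inside [E]. *)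
Lemma segment_nbhd E x a b (s : R) : open E ->
  (forall t, 0 <= t <= s -> E (x + t *: a)) ->
  exists2 d, 0 < d & forall r, `|r| <= d ->
    forall t, 0 <= t <= s -> E (x + t *: a + r *: b).
Proof.
move=> oE Ex.
have /compact_near_coveringP/(_ R (nbhs (0 : R)) (fun r t => E (x + t *: a + r *: b)) _) :=
  @segment_compact _ 0 s.
move=> []; last first.
  move=> d /= d0 Hd; exists (d / 2) => [|r rd t t0s]; first by rewrite divr_gt0.
  apply: Hd; last by rewrite /= in_itv.
  by rewrite /= sub0r normrN (le_lt_trans rd)// ltr_pdivrMr// ltr_pMr// ltr1n.
move=> t; rewrite /= in_itv/= => t0s.
have : (fun p : R * R => x + p.1 *: a + p.2 *: b) @ (nbhs t, nbhs (0 : R))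
    --> x + t *: a + (0 : R) *: b.
  apply: cvgD; first apply: cvgD.
  - exact: cvg_cst.
  - by apply: cvgZr_tmp; exact: cvg_fst.
  - by apply: cvgZr_tmp; exact: cvg_snd.
rewrite scale0r addr0 => /(_ _ (open_nbhs_nbhs (conj oE (Ex _ t0s)))).
by apply: filterS => -[].
Qed.

End directional_increment.

(** * Sum of two directions, by staircases *)

Section directional_increment_add.
Variables (R : realType) (n : nat) (E : set 'cV[R]_n) (f u v : 'cV[R]_n -> R).
Variables (a b : 'cV[R]_n).
Let leb := @lebesgue_measure R.
Let lam := lebesgue_cV R n.
Hypotheses (oE : open E)
  (iu : lam.-integrable setT (EFin \o u)) (iv : lam.-integrable setT (EFin \o v))
  (fu : increment_is_integral E f a u) (fv : increment_is_integral E f b v).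

Let c := a + b.
Let w x := u x + v x.

Let mu : measurable_fun setT u.
Proof. by have /integrableP[/measurable_EFinP] := iu. Qed.

Let mv : measurable_fun setT v.
Proof. by have /integrableP[/measurable_EFinP] := iv. Qed.

(* Error committed by replacing, over a time [h], the diagonal motion along [c]
   by the motion along [a] followed by the motion along [b]. *)
Let err h (x : 'cV[R]_n) : \bar R :=
  (\int[leb]_(t in `[0%R, h])
     (`|u (x + t *: a)%R - u (x + t *: c)%R|%:E +
      `|v (x + h *: a + t *: b)%R - v (x + t *: c)%R|%:E))%E.

Let m_along d (T : measurableType d) (g : 'cV[R]_n -> R) (p : T -> 'cV[R]_n) :
  measurable_fun setT g -> measurable_fun setT p -> measurable_fun setT (fun z => g (p z)).
Proof. by move=> mg mp; exact: measurableT_comp mg mp. Qed.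

Let merr_u (h : R) : measurable_fun setT (fun p : 'cV[R]_n * measurableTypeR R =>
  `|u (p.1 + p.2 *: a)%R - u (p.1 + p.2 *: c)%R|%:E).
Proof.
apply/measurable_EFinP; apply: measurableT_comp => //.
by apply: measurable_funB; apply: m_along => //; apply: measurable_cVD => //;
  exact: measurable_cVZ.
Qed.

Let merr_v (h : R) : measurable_fun setT (fun p : 'cV[R]_n * measurableTypeR R =>
  `|v (p.1 + h *: a + p.2 *: b)%R - v (p.1 + p.2 *: c)%R|%:E).
Proof.
apply/measurable_EFinP; apply: measurableT_comp => //.
apply: measurable_funB; apply: m_along => //; apply: measurable_cVD => //.
- exact: measurable_cVD.
- exact: measurable_cVZ.
- exact: measurable_cVZ.
Qed.

Let err_ge0 h x : (0 <= err h x)%E.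
Proof. by apply: integral_ge0 => t _; rewrite adde_ge0. Qed.

Let merr h : measurable_fun setT (err h).
Proof.
pose F x (t : measurableTypeR R) := (`|u (x + t *: a)%R - u (x + t *: c)%R|%:E +
  `|v (x + h *: a + t *: b)%R - v (x + t *: c)%R|%:E)%E.
have mF : measurable_fun setT (fun p => F p.1 p.2).
  by apply: emeasurable_funD; [exact: merr_u|exact: merr_v].
have F0 x t : (0 <= F x t)%E by rewrite adde_ge0.
exact: (@measurable_integral_in _ _ _ _ _ leb _ (measurable_itv `[0, h]) F mF F0).
Qed.

(** The increment over [h c] is the increment over [h a] plus that over [h b] started at [x + h a].
    Each is an integral, of [u] and of [v]; subtracting the integral of [u + v] on the diagonal
    leaves the two differences measured by [err]. *)
Let one_step h : 0 <= h ->
  {ae lam, forall x,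
    (forall t, 0 <= t <= h -> E (x + t *: a)) ->
    (forall t, 0 <= t <= h -> E (x + h *: a + t *: b)) ->
    (`|f (x + h *: c) - f x - \int[leb]_(t in `[0, h]) w (x + t *: c)|%:E <= err h x)%E}.
Proof.
move=> h0; have A1 := ae_integrable_along_segments a 0 h iu.
have A2 := ae_integrable_along_segments c 0 h iu.
have A3 := ae_integrable_along_segments c 0 h iv.
have A4 := ae_cV_translation (h *: a) (ae_integrable_along_segments b 0 h iv).
have A5 := ae_cV_translation (h *: a) (fv h0).
apply: filterS3 (filterI A1 A2) (filterI A3 A4) (filterI A5 (fu h0)).
move=> x [iux iuc] [ivc ivx] [fvx fux] Ea Eb.
have := fvx Eb; have := fux Ea; rewrite -addrA -scalerDr -/c => fua fvb.
rewrite (_ : _ - _ - _ = \int[leb]_(t in `[0, h]) (u (x + t *: a) - u (x + t *: c)) +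
  \int[leb]_(t in `[0, h]) (v (x + h *: a + t *: b) - v (x + t *: c))); last first.
  by rewrite !RintegralB// /w RintegralD// -fua -fvb; lra.
rewrite /err ge0_integralD//; last 2 first.
- apply: measurable_funTS.
  by have := measurableT_comp (merr_u h) (@measurable_pair1 _ _ _ (measurableTypeR R) x).
- apply: measurable_funTS.
  by have := measurableT_comp (merr_v h) (@measurable_pair1 _ _ _ (measurableTypeR R) x).
rewrite (le_trans (y := (`|\int[leb]_(t in `[0, h]) (u (x + t *: a) - u (x + t *: c))|%:E +
  `|\int[leb]_(t in `[0, h]) (v (x + h *: a + t *: b) - v (x + t *: c))|%:E)%E))//.
  by rewrite -EFinD lee_fin ler_normD.
have le_int (g : R -> R) : leb.-integrable `[0, h] (EFin \o g) ->
    (`|\int[leb]_(t in `[0, h]) g t|%:E <= \int[leb]_(t in `[0%R, h]) `|g t|%:E)%E.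
  move=> ig; rewrite EFin_normr_Rintegral//; apply: le_abse_integral => //.
  by have /integrableP[] := ig.
by apply: leeD; apply: le_int; [exact: (integrableB _ iux iuc)|exact: (integrableB _ ivx ivc)].
Qed.

(** Relative to the diagonal point [x + t c], the corner path is displaced by [- t b] on its first
    leg and by [(h - t) a] on its second. After translating [x] by [t c], only translations of
    length at most [h] remain, to which continuity in L^1 applies. *)
Let mass_err h : 0 <= h -> (\int[lam]_x err h x =
  \int[leb]_(t in `[0%R, h]) (\int[lam]_x `|u (x + (- t) *: b)%R - u x|%:E +
    \int[lam]_x `|v (x + (h - t) *: a)%R - v x|%:E))%E.
Proof.
move=> h0; pose F x (t : measurableTypeR R) := (`|u (x + t *: a)%R - u (x + t *: c)%R|%:E +
  `|v (x + h *: a + t *: b)%R - v (x + t *: c)%R|%:E)%E.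
have mF : measurable_fun setT (fun p => F p.1 p.2).
  by apply: emeasurable_funD; [exact: merr_u|exact: merr_v].
have F0 x t : (0 <= F x t)%E by rewrite adde_ge0.
have mshift (g : 'cV[R]_n -> R) (d : 'cV[R]_n) : measurable_fun setT g ->
    measurable_fun setT (fun x : 'cV[R]_n => `|g (x + d) - g x|%:E).
  move=> mg; apply/measurable_EFinP; apply: measurableT_comp => //.
  by apply: measurable_funB => //; exact: measurable_cV_shift.
transitivity (\int[leb]_(t in `[0%R, h]) \int[lam]_x F x t)%E.
  exact: (@ge0_integral_swap_in _ _ _ _ _ lam leb setT _ measurableT (measurable_itv `[0, h]) F mF F0).
apply: eq_integral => t _; rewrite /F.
have uE : (fun x => `|u (x + t *: a)%R - u (x + t *: c)%R|%:E) =
    (fun x => `|u (x + t *: c + (- t) *: b)%R - u (x + t *: c)%R|%:E).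
  apply/funext => x; congr ((`|u _ - _|)%:E).
  by rewrite /c scaleNr scalerDr -!addrA subrr addr0.
have vE : (fun x => `|v (x + h *: a + t *: b)%R - v (x + t *: c)%R|%:E) =
    (fun x => `|v (x + t *: c + (h - t) *: a)%R - v (x + t *: c)%R|%:E).
  apply/funext => x; congr ((`|v _ - _|)%:E).
  rewrite /c scalerBl scalerDr -!addrA; congr (_ + _).
  by rewrite [RHS]addrC -[RHS]addrA subrK addrC.
rewrite ge0_integralD//; last 2 first.
- by rewrite uE; exact: (measurableT_comp (mshift u _ mu) (measurable_cVD (@measurable_id _ _ _) (measurable_cst _))).
- by rewrite vE; exact: (measurableT_comp (mshift v _ mv) (measurable_cVD (@measurable_id _ _ _) (measurable_cst _))).
rewrite uE vE; congr (_ + _)%E.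
- by rewrite (@ge0_integral_cV_translation _ _ (t *: c) (fun x => `|u (x + (- t) *: b)%R - u x|%:E)%E)//; exact: mshift.
- by rewrite (@ge0_integral_cV_translation _ _ (t *: c) (fun x => `|v (x + (h - t) *: a)%R - v x|%:E)%E)//; exact: mshift.
Qed.

Let steps h x (N : nat) : 0 <= h ->
  (forall j, (j < N)%N ->
    (`|f (x + (j%:R * h) *: c + h *: c) - f (x + (j%:R * h) *: c) -
       \int[leb]_(t in `[0, h]) w (x + (j%:R * h) *: c + t *: c)|%:E <=
     err h (x + (j%:R * h) *: c))%E) ->
  leb.-integrable `[0, N%:R * h] (fun t => (w (x + t *: c))%:E) ->
  (`|f (x + (N%:R * h) *: c) - f x - \int[leb]_(t in `[0, N%:R * h]) w (x + t *: c)|%:E <=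
   \sum_(j < N) err h (x + (j%:R * h) *: c)%R)%E.
Proof.
move=> h0; elim: N => [|N IH] step iw.
  by rewrite mul0r scale0r addr0 subrr set_itv1 Rintegral_set1 subrr normr0 big_ord0.
have Nh0 : 0 <= N%:R * h by rewrite mulr_ge0.
have NhE : N.+1%:R * h = N%:R * h + h by rewrite -natr1 mulrDl mul1r.
have Nh : N%:R * h <= N.+1%:R * h by rewrite NhE lerDl.
have iwN : leb.-integrable `[0, N%:R * h] (fun t => (w (x + t *: c))%:E).
  by apply: integrableS iw => //; apply: subset_itvl; rewrite bnd_simp.
rewrite big_ord_recr/=; apply: le_trans (leeD (IH _ iwN) (step N _)) => //; last first.
  by move=> j jN; apply: step; exact: ltnW.
rewrite -EFinD lee_fin; apply: le_trans (ler_normD _ _).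
rewrite le_eqVlt; apply/orP; left; apply/eqP; congr (`|_|).
have split_int : \int[leb]_(t in `[0, N.+1%:R * h]) w (x + t *: c) =
  \int[leb]_(t in `[0, N%:R * h]) w (x + t *: c) +
  \int[leb]_(t in `[0, h]) w (x + (N%:R * h) *: c + t *: c).
  apply/eqP; rewrite addrC -subr_eq; apply/eqP.
  rewrite Rintegral_itvB ?bnd_simp// Rintegral_itv_obnd_cbnd; last first.
    by apply: integrableS iw => //; apply: subset_itvr; rewrite bnd_simp.
  have mw : measurable_fun [set: measurableTypeR R]
      (fun r : measurableTypeR R => (w (x + r *: c))%:E).
    by apply/measurable_EFinP; apply: measurable_funD; exact: measurable_along_line.
  have := integral_itv_translation 0 h (N%:R * h) mw.
  rewrite add0r (addrC h) -NhE => ww; rewrite /Rintegral -ww; congr fine.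
  by apply: eq_integral => t _; rewrite [t + _]addrC scalerDl addrA.
have -> : x + (N.+1%:R * h) *: c = x + (N%:R * h) *: c + h *: c.
  by rewrite NhE scalerDl addrA.
rewrite split_int.
set I1 := Rintegral _ _ _; set I2 := Rintegral _ _ _.
by ring.
Qed.

Let total h x N := (\sum_(j < N) err h (x + (j%:R * h) *: c)%R)%E.

Let total_ge0 h x N : (0 <= total h x N)%E.
Proof. by apply: sume_ge0. Qed.

Let merr_shift h (d : 'cV[R]_n) : measurable_fun setT (fun x : 'cV[R]_n => err h (x + d)%R).
Proof. by apply: (measurableT_comp (merr h)); exact: measurable_cVD. Qed.

Let mtotal h N : measurable_fun setT (fun x => total h x N).
Proof. by apply: emeasurable_sum => j; exact: merr_shift. Qed.

(** A step of length [h] has mean error at most [2 e' h], with [e'] arbitrarily small: the error is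
    o(h), so that [N] steps of length [s / N] add up to [2 e' s]. The choice [e' = e / (2 (s + 1))]
    makes this at most [e], also when [s = 0]. *)
Let mass_total (s e : R) : 0 <= s -> 0 < e -> exists2 N0, (0 < N0)%N &
  forall N, (N0 <= N)%N -> (\int[lam]_x total (s / N%:R) x N <= e%:E)%E.
Proof.
move=> s0 e0; pose e' := e / (2 * (s + 1)).
have e'0 : 0 < e' by rewrite divr_gt0//; lra.
have [du du0 Hu] := L1_translation_small b iu e'0.
have [dv dv0 Hv] := L1_translation_small a iv e'0.
pose d := Num.min du dv; have d0 : 0 < d by rewrite lt_min du0.
exists (Num.bound (s / d)).+1 => // N NN.
have N0 : (0 < N)%N by exact: leq_trans NN.
have Nr0 : (0 : R) < N%:R by rewrite ltr0n.
have hd : s / N%:R <= d.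
  rewrite ler_pdivrMr// mulrC -ler_pdivrMr// ltW//.
  apply: (lt_le_trans (archi_boundP _)); first by rewrite divr_ge0// ltW.
  by rewrite ler_nat ltnW.
have h0 : 0 <= s / N%:R by rewrite divr_ge0.
set h := s / N%:R in hd h0 *.
rewrite ge0_integral_sum//.
have mdist (g : 'cV[R]_n -> R) (z : 'cV[R]_n) (p : R -> R) :
    measurable_fun setT g -> measurable_fun setT p ->
    measurable_fun [set: measurableTypeR R]
      (fun t : measurableTypeR R => \int[lam]_x `|g (x + p t *: z)%R - g x|%:E)%E.
  move=> mg mp.
  apply: (@measurable_integral_snd _ _ (measurableTypeR R) _ _ lam
    (fun t x => `|g (x + p t *: z)%R - g x|%:E)) => //.
  apply/measurable_EFinP; apply: measurableT_comp => //; apply: measurable_funB.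
    apply: m_along => //; apply: measurable_cVD => //; apply: measurable_cVZ => //.
    exact: (measurableT_comp mp measurable_fst).
  exact: (measurableT_comp mg measurable_snd).
have mopp : measurable_fun setT (fun t : R => - t) by exact: measurableT_comp.
have msub : measurable_fun setT (fun t : R => h - t) by exact: measurable_funB.
have mm j : (\int[lam]_x err h (x + (j%:R * h) *: c)%R <= (2 * e' * h)%:E)%E.
  rewrite (@ge0_integral_cV_translation _ _ ((j%:R * h) *: c) (err h))// mass_err//.
  apply: (@le_trans _ _ (\int[leb]_(t in `[0%R, h]) (2 * e')%:E)%E).
    apply: ge0_le_integral => //.
    - by move=> t _; rewrite adde_ge0// integral_ge0.
    - apply: measurable_funTS; apply: emeasurable_funD.
        exact: (mdist u b _ mu mopp).
      exact: (mdist v a _ mv msub).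
    - move=> t; rewrite /= in_itv/= => th.
      rewrite (_ : 2 * e' = e' + e'); last lra.
      rewrite EFinD leeD//.
        apply: Hu; rewrite normrN ger0_norm; last lra.
        by move: hd; rewrite le_min; lra.
      apply: Hv; rewrite ger0_norm; last lra.
      by move: hd; rewrite le_min; lra.
  by rewrite integral_cst// [X in (_ * X)%E](lebesgue_itvccE h0 : _ = _) subr0.
apply: (@le_trans _ _ (\sum_(j < N) (2 * e' * h)%:E)%E); first exact: lee_sum.
rewrite sumEFin sumr_const card_ord lee_fin -[_ *+ N]mulr_natr -[_ * N%:R]mulrA.
rewrite (_ : h * N%:R = s); last by rewrite /h divfK// gt_eqF.
rewrite (_ : 2 * e' * s = e * (s / (s + 1))); last first.
  by rewrite /e'; field; lra.
by rewrite ler_piMr ?(ltW e0)// ler_pdivrMr; lra.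
Qed.

Lemma increment_is_integralD : increment_is_integral E f c w.
Proof.
move=> s s0.
(* Borel-Cantelli argument: the mean total errors are at most [2^-(k+1)], so their series [T] is
   integrable and the errors tend to 0 almost everywhere. Asking [k <= N] makes the step length tend
   to 0. *)
have /choice[N HN] k : exists N, [/\ (0 < N)%N, (k <= N)%N &
    (\int[lam]_x total (s / N%:R) x N <= (1 / (2 ^ k.+1)%:R)%:E)%E].
  have [|N0 N00 HN0] := @mass_total s (1 / (2 ^ k.+1)%:R) s0.
    by rewrite divr_gt0// ltr0n expn_gt0.
  exists (maxn N0 k); split; last exact: (HN0 _ (leq_maxl _ _)).
    by rewrite (leq_trans N00)// leq_maxl.
  exact: leq_maxr.
pose T x := (\sum_(0 <= k <oo) total (s / (N k)%:R) x (N k))%E.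
have T0 x : (0 <= T x)%E by apply: nneseries_ge0.
have mT : measurable_fun setT T.
  have h0 k x : [set: 'cV[R]_n] x -> xpredT k -> (0 <= total (s / (N k)%:R) x (N k))%E by [].
  exact: (ge0_emeasurable_sum h0 (fun k _ => mtotal _ _)).
have iT : lam.-integrable setT T.
  apply/integrableP; split => //.
  under eq_integral do rewrite gee0_abs//.
  rewrite integral_nneseries//; apply: (@le_lt_trans _ _ 1%E); last exact: ltry.
  apply: le_trans (epsilon_trick0 xpredT ler01).
  apply: lee_nneseries => [k _ _|k _]; last by have [] := HN k.
  exact: integral_ge0.
have A1 := integrable_ae measurableT iT.
(* There are countably many grids, each with countably many grid points, so a single null set takes
   care of all the steps. *)
have A2 : {ae lam, forall x k j, let h := s / (N k)%:R in
    (forall t, 0 <= t <= h -> E (x + (j%:R * h) *: c + t *: a)) ->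
    (forall t, 0 <= t <= h -> E (x + (j%:R * h) *: c + h *: a + t *: b)) ->
    (`|f (x + (j%:R * h) *: c + h *: c) - f (x + (j%:R * h) *: c) -
       \int[leb]_(t in `[0, h]) w (x + (j%:R * h) *: c + t *: c)|%:E <=
      err h (x + (j%:R * h) *: c))%E}.
  apply: ae_foralln => k; apply: ae_foralln => j.
  have h0 : 0 <= s / (N k)%:R by rewrite divr_ge0.
  exact: ae_cV_translation (one_step h0).
have A3 := ae_integrable_along_segments c 0 s iu.
have A4 := ae_integrable_along_segments c 0 s iv.
apply: filterS2 (filterI A1 A2) (filterI A3 A4) => x [Tx step] [iux ivx] Ex.
have iw : leb.-integrable `[0, s] (fun t => (w (x + t *: c))%:E) := integrableD _ iux ivx.
have [da da0 Ha] := segment_nbhd a oE Ex.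
have [db db0 Hb] := segment_nbhd b oE Ex.
have cvg_total : (fun k => total (s / (N k)%:R) x (N k)) @ \oo --> 0%E.
  apply: nneseries_lty_cvg0 => //.
  by have := Tx Logic.I; rewrite ge0_fin_numE.
have Nr0 k : (0 : R) < (N k)%:R by rewrite ltr0n; have [] := HN k.
apply/eqP; rewrite -subr_eq0 -normr_le0; apply/ler_addgt0Pr => e e0; rewrite add0r.
have /(cvge0P (fun k => total_ge0 _ _ _))/(_ _ e0)[K HK] := cvg_total.
pose d := Num.min da db; have d0 : 0 < d by rewrite lt_min da0.
pose k := maxn K (Num.bound (s / d)).+1.
rewrite -lee_fin; apply: le_trans (HK k (leq_maxl _ _)).
have NhE : (N k)%:R * (s / (N k)%:R) = s by rewrite mulrC divfK// gt_eqF.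
have hd : s / (N k)%:R <= d.
  rewrite ler_pdivrMr// mulrC -ler_pdivrMr// ltW//.
  apply: (lt_le_trans (archi_boundP _)); first by rewrite divr_ge0// ltW.
  rewrite ler_nat; have [_ kN _] := HN k; apply: leq_trans kN.
  by rewrite /k leq_max leqnSn orbT.
have h0 : 0 <= s / (N k)%:R by rewrite divr_ge0// ltW.
set h := s / (N k)%:R in NhE hd h0 *.
have grid j t : (j < N k)%N -> 0 <= t <= h -> 0 <= j%:R * h + t <= s.
  move=> jN /andP[t0 th]; rewrite addr_ge0// ?mulr_ge0//= -NhE.
  apply: (@le_trans _ _ (j.+1%:R * h)); first by rewrite -natr1 mulrDl mul1r lerD2l.
  by rewrite ler_wpM2r// ler_nat.
have := @steps h x (N k) h0; rewrite NhE; apply; last exact: iw.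
move=> j jN; apply: step => t; rewrite -/h => th.
(* Each point of the staircase is a point of the diagonal segment displaced by at most [h <= d]
   along [b] or [a], hence in [E] by [segment_nbhd]. *)
- rewrite (_ : _ + t *: a = x + (j%:R * h + t) *: c + (- t) *: b).
    apply: Hb; last exact: grid.
    by rewrite normrN ger0_norm; move: hd; rewrite le_min; lra.
  by rewrite /c scalerDl scaleNr [t *: (a + b)]scalerDr -!addrA subrr addr0.
- rewrite (_ : _ + h *: a + t *: b = x + (j%:R * h + t) *: c + (h - t) *: a).
    apply: Ha; last exact: grid.
    by rewrite ger0_norm; move: hd; rewrite le_min; lra.
  rewrite /c scalerDl scalerBl [t *: (a + b)]scalerDr -!addrA; do 2 congr (_ + _).
  by rewrite [RHS]addrC -[RHS]addrA subrK addrC.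
Qed.

End directional_increment_add.

Section gradient_increment.
Variables (R : realType) (n : nat) (D : set 'cV[R]_n) (f : 'cV[R]_n -> R).
Let lam := lebesgue_cV R n.
Hypotheses (oD : open D)
  (df : forall x (i : 'I_n), D x -> derivable f x (delta_mx i 0)).

Lemma is_derive_of_line (g : 'cV[R]_n -> R) (a x : 'cV[R]_n) (d : R) :
  is_derive (0 : R) (1 : R) (fun t => g (x + t *: a)) d -> is_derive x a g d.
Proof.
move=> [dg dgE].
have E : (fun h => h^-1 *: (g (x + (h *: (1 : R) + 0) *: a) - g (x + 0 *: a))) =
    (fun h => h^-1 *: (g (h *: a + x) - g x)).
  apply/funext => h; congr (_ *: (g _ - g _)); last by rewrite scale0r addr0.
  by rewrite addr0 addrC [h *: 1]mulr1.
by split; [move: dg; rewrite /derivable|move: dgE; rewrite /derive]; rewrite /= E.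
Qed.

(** Chain rule for [t |-> c t] on the line through [x]; unlike a rescaling of the difference
    quotient this covers [c = 0]. *)
Lemma is_deriveZ_dir (g : 'cV[R]_n -> R) (a x : 'cV[R]_n) (c d : R) :
  is_derive x a g d -> is_derive x (c *: a) g (c * d).
Proof.
move=> dg; apply: is_derive_of_line.
have dl : is_derive (c * 0) (1 : R) (fun t => g (x + t *: a)) d.
  by rewrite mulr0; apply: is_derive_along_line; rewrite scale0r addr0.
have dc : is_derive (0 : R) (1 : R) (fun t : R => c * t) c.
  apply: (is_derive_eq (@is_deriveZ R R R id c 0 1 1 (is_derive_id _ _))).
  by rewrite [LHS]mulr1.
have := is_derive1_comp dl dc; rewrite mulrC.
by congr (is_derive _ _ _ _); apply/funext => t /=; rewrite scalerA mulrC.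
Qed.

(** The derivative is the limit of the quotients with steps [1 / (k + 1)]. They are taken for the
    zero extension of [f], which is measurable everywhere; as [D] is open, it agrees with [f] at [x]
    and, eventually, at the shifted points. *)
Lemma measurable_grad (i : 'I_n) : measurable_fun D f ->
  measurable_fun D (fun x => grad f x i 0).
Proof.
move=> mf; have mD := open_measurable_cV oD.
pose fD := f \_ D; have mfD : measurable_fun setT fD.
  exact/(measurable_restrictT _ mD).
pose e : 'cV[R]_n := delta_mx i 0.
pose q k x := k.+1%:R * (fD (x + k.+1%:R^-1 *: e) - fD x).
apply: (@measurable_fun_cvg _ _ _ _ q).
  move=> k; apply: measurable_funTS; apply: measurable_funM => //.
  apply: measurable_funB => //; apply: (measurableT_comp mfD); exact: measurable_cVD.
move=> x Dx; rewrite mxE.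
have inv_cvg : (fun k : nat => k.+1%:R^-1 : R) @ \oo --> 0^'.
  move=> A [r /= r0 rA].
  have : \forall k \near \oo, k.+1%:R^-1 < r := near_infty_natSinv_lt (PosNum r0).
  apply: filterS => k kr; apply: rA; last by rewrite /= invr_eq0 pnatr_eq0.
  by rewrite /= sub0r normrN ger0_norm.
have := cvg_comp _ _ inv_cvg (@df x i Dx); apply: cvg_trans; apply: near_eq_cvg.
have nearD : \forall k \near \oo, D (x + k.+1%:R^-1 *: e).
  have : (fun k : nat => x + (k.+1%:R^-1 : R) *: e) @ \oo --> x + (0 : R) *: e.
    apply: cvgD; first exact: cvg_cst.
    by apply: cvgZr_tmp; exact: cvg_harmonic.
  rewrite scale0r addr0; apply; exact: open_nbhs_nbhs.
near=> k; rewrite /q /fD !patchE !mem_set//; last by near: k.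
by rewrite /= invrK [x + _]addrC.
Unshelve. all: by end_near. Qed.

(** Decompose [h] on the coordinate directions, where differentiability is known, and add the
    directions one by one with [increment_is_integralD]. The subset [E] is there because the partial
    derivatives are integrable on bounded pieces of [D] only. *)
Lemma increment_is_integral_grad (E : set 'cV[R]_n) (h : 'cV[R]_n) :
  open E -> E `<=` D ->
  (forall i, lam.-integrable setT (fun x => (\1_E x * grad f x i 0)%:E)) ->
  increment_is_integral E f h (fun x => \1_E x * ((h^T *m grad f x) 0 0)).
Proof.
move=> oE ED iE.
pose a (i : 'I_n) : 'cV[R]_n := h i 0 *: delta_mx i 0.
pose u i x := h i 0 * (\1_E x * grad f x i 0).
have iu i : lam.-integrable setT (EFin \o u i).
  rewrite (_ : _ \o _ = (fun x => (h i 0)%:E * (\1_E x * grad f x i 0)%:E)%E)//.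
  exact: integrableZl.
have Hu i : increment_is_integral E f (a i) (u i).
  apply: increment_is_integral_derive => // x Ex.
  rewrite /u indicE mem_set// mul1r; apply: is_deriveZ_dir.
  by rewrite mxE; apply: derivableP; apply: df; exact: ED.
have Hs (s : seq 'I_n) : lam.-integrable setT (EFin \o (fun x => \sum_(i <- s) u i x)) /\
    increment_is_integral E f (\sum_(i <- s) a i) (fun x => \sum_(i <- s) u i x).
  elim: s => [|i s [IH1 IH2]].
    rewrite big_nil (_ : (fun=> _) = cst 0); last by apply/funext => x; rewrite big_nil.
    by split; [exact: integrable0|exact: increment_is_integral0].
  rewrite big_cons (_ : (fun=> _) = (fun x => u i x + \sum_(i <- s) u i x)); last first.
    by apply/funext => x; rewrite big_cons.
  split; last exact: increment_is_integralD.
  rewrite (_ : _ \o _ = ((EFin \o u i) \+ (EFin \o (fun x => \sum_(i <- s) u i x)%R))%E)//.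
  exact: integrableD.
have [_] := Hs (index_enum 'I_n).
rewrite (_ : \sum_(i <- _) a i = h); last first.
  by rewrite [RHS]matrix_sum_delta; apply: eq_bigr => i _; rewrite big_ord1.
congr (increment_is_integral _ _ _ _); apply/funext => x.
rewrite mxE mulr_sumr; apply: eq_bigr => i _.
by rewrite /u [h^T _ _]mxE mulrCA.
Qed.

End gradient_increment.

(** * A Poincare inequality on slices *)

(** [B (A B - C^2)] is the sum of the squares of [B a_i - C b_i]. One divides by [B], except if
    [B = 0], when all [b_i] vanish. *)
Lemma sum_cauchy_schwarz (R : realFieldType) n (a b : 'I_n -> R) :
  (\sum_i a i * b i) ^+ 2 <= (\sum_i a i ^+ 2) * (\sum_i b i ^+ 2).
Proof.
set A := \sum_i a i ^+ 2; set B := \sum_i b i ^+ 2; set C := \sum_i a i * b i.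
have B0 : 0 <= B by apply: sumr_ge0 => i _; exact: sqr_ge0.
have : 0 <= B * (A * B - C ^+ 2).
  have -> : B * (A * B - C ^+ 2) = \sum_i (B * a i - C * b i) ^+ 2.
    have -> : \sum_i (B * a i - C * b i) ^+ 2 =
        \sum_i (B ^+ 2 * a i ^+ 2 + (- 2 * B * C) * (a i * b i) + C ^+ 2 * b i ^+ 2).
      by apply: eq_bigr => i _; ring.
    by rewrite !big_split/= -!mulr_sumr -/A -/B -/C; ring.
  by apply: sumr_ge0 => i _; exact: sqr_ge0.
have [B00|B1] := eqVneq B 0; last first.
  by rewrite pmulr_rge0 ?subr_ge0// lt_neqAle eq_sym B1.
have b0 i : b i = 0.
  apply/eqP; rewrite -sqrf_eq0; apply/eqP.
  by apply: (psumr_eq0P _ B00) => // j _; exact: sqr_ge0.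
move=> _; rewrite /C big1 ?expr0n ?B00 ?mulr0// => i _.
by rewrite b0 mulr0.
Qed.

(** Jensen for the square: integrate [2 M phi q - M^2 q <= phi^2 q], which is [(phi - M)^2 q >= 0];
    as [q] has mass 1, the left side integrates to [M^2]. An infinite right side is set aside first,
    so that all integrands are integrable. *)
Lemma sq_integral_density_le d (T : measurableType d) (R : realType)
    (mu : {measure set T -> \bar R}) (D : set T) (phi q : T -> R) :
  measurable D -> measurable_fun D phi -> measurable_fun D q ->
  (forall x, D x -> 0 <= q x) -> (\int[mu]_(x in D) (q x)%:E = 1)%E ->
  mu.-integrable D (fun x => (phi x * q x)%:E) ->
  (((\int[mu]_(x in D) (phi x * q x)) ^+ 2)%:E <=
   \int[mu]_(x in D) (phi x ^+ 2 * q x)%:E)%E.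
Proof.
move=> mD mphi mq q0 q1 iphi; set M := \int[mu]_(x in D) (phi x * q x).
have sq0 x : D x -> (0 <= (phi x ^+ 2 * q x)%:E)%E.
  by move=> Dx; rewrite lee_fin mulr_ge0// ?q0// sqr_ge0.
have msq : measurable_fun D (fun x => (phi x ^+ 2 * q x)%:E).
  by apply/measurable_EFinP; apply: measurable_funM => //; exact: measurable_funX.
have [oo|fin] := eqVneq (\int[mu]_(x in D) (phi x ^+ 2 * q x)%:E)%E +oo%E.
  by rewrite oo leey.
have isq : mu.-integrable D (fun x => (phi x ^+ 2 * q x)%:E).
  apply/integrableP; split => //.
  rewrite (eq_integral (fun x => (phi x ^+ 2 * q x)%:E)); last first.
    by move=> x /set_mem Dx; rewrite gee0_abs// sq0.
  by rewrite ltey.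
have iq : mu.-integrable D (fun x => (q x)%:E).
  apply/integrableP; split; first exact/measurable_EFinP.
  rewrite (eq_integral (fun x => (q x)%:E)) ?q1 ?ltry//.
  by move=> x /set_mem Dx; rewrite gee0_abs// lee_fin q0.
have i1 : mu.-integrable D (fun x => ((2 * M)%:E * (phi x * q x)%:E)%E) := integrableZl mD _ iphi.
have i2 : mu.-integrable D (fun x => ((M ^+ 2)%:E * (q x)%:E)%E) := integrableZl mD _ iq.
apply: (@le_trans _ _ (\int[mu]_(x in D)
    ((2 * M)%:E * (phi x * q x)%:E - (M ^+ 2)%:E * (q x)%:E))%E).
  rewrite (integralB mD i1 i2) (integralZl mD iphi) (integralZl mD iq) q1 -[X in (_ * X - _)%E](fineK (integrable_fin_num mD iphi)).
  rewrite -[fine _]/M mule1 -EFinM -EFinB lee_fin le_eqVlt; apply/orP; left; apply/eqP.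
  by ring.
apply: le_integral => //; first exact: integrableB.
move=> x /set_mem Dx; rewrite -!EFinM -EFinB lee_fin -subr_ge0.
rewrite (_ : _ - _ = (phi x - M) ^+ 2 * q x); last by ring.
by rewrite mulr_ge0 ?sqr_ge0// q0.
Qed.

Lemma sq_integral_itv01_le (R : realType) (phi : R -> R) :
  measurable_fun (`[0, 1]%classic : set (measurableTypeR R)) phi ->
  lebesgue_measure.-integrable `[0, 1] (EFin \o phi) ->
  (((\int[lebesgue_measure]_(t in `[0%R, 1%R]) phi t)%R ^+ 2)%:E <=
   \int[lebesgue_measure]_(t in `[0%R, 1%R]) (phi t ^+ 2)%:E)%E.
Proof.
move=> mphi iphi.
have -> : \int[lebesgue_measure]_(t in `[0, 1]) phi t =
    \int[lebesgue_measure]_(t in `[0, 1]) (phi t * cst 1 t).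
  by apply: eq_Rintegral => t _; rewrite /= mulr1.
have -> : (\int[lebesgue_measure]_(t in `[0%R, 1%R]) (phi t ^+ 2)%:E =
    \int[lebesgue_measure]_(t in `[0%R, 1%R]) (phi t ^+ 2 * cst 1%R t)%:E)%E.
  by apply: eq_integral => t _; rewrite /= mulr1.
apply: sq_integral_density_le => //.
- rewrite -[RHS](lebesgue_itv01 R) -[RHS]mul1e.
  exact: (integral_cst lebesgue_measure (measurable_itv _) 1%:E).
- by move: iphi; apply: eq_integrable => // t _; rewrite /= mulr1.
Qed.

Section square_increment.
Variables (R : realType) (n m : nat) (rho f : 'cV[R]_n -> R) (M : 'M[R]_(n, m)).
Let lam := lebesgue_cV R n.
Let leb := @lebesgue_measure R.
Let D := dsupp rho.
Hypotheses (oD : open D)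
  (cD : forall x h t, D x -> D (x + h) -> 0 <= t <= 1 -> D (x + t *: h))
  (rho_lb : forall r : R, exists2 c, 0 < c &
     forall x, D x -> (forall i, `|x i 0| < r) -> c <= rho x)
  (mf : measurable_fun D f)
  (df : forall x (i : 'I_n), D x -> derivable f x (delta_mx i 0))
  (gf : forall i, lam.-integrable D (fun x => (grad f x i 0 ^+ 2 * rho x)%:E)).

Definition sqgrad (x : 'cV[R]_n) : R := \1_(dsupp rho) x * sqnorm (M^T *m grad f x).

Let mD : measurable D. Proof. exact: open_measurable_cV. Qed.

Let box (r : R) : set 'cV[R]_n := [set x | forall i, `|x i 0| < r].

Let open_box r : open (box r).
Proof.
move=> x bx; have Hx (i : 'I_n) : nbhs x [set y : 'cV[R]_n | `|y i 0| < r].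
  have xi : (fun y : 'cV[R]_n => y i 0) @ x --> x i 0 by exact: coord_continuous.
  have xni : (fun y : 'cV[R]_n => `|y i 0|) @ x --> `|x i 0| by exact: (cvg_norm xi).
  exact: cvgr_lt xni _ (bx i).
exact: (@filter_forall _ 'I_n (fun i : 'I_n => [set y : 'cV[R]_n | `|y i 0| < r]) (nbhs x) _ Hx).
Qed.

(** On the box [rho] is at least some [c > 0], so [|g| <= 1 + g^2 <= 1 + g^2 rho / c]. The box has
    finite measure, which takes care of the [1]. *)
Let grad_integrable r i :
  lam.-integrable setT (fun x => (\1_(D `&` box r) x * grad f x i 0)%:E).
Proof.
have [c c0 Hc] := rho_lb r.
have mbox : measurable (box r) by exact: open_measurable_cV.
have mg := measurable_grad oD df i mf.
have ibox : lam.-integrable setT (fun x => (\1_(box r) x)%:E : \bar R).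
  apply/integrableP; split; first exact/measurable_EFinP/measurable_indic.
  rewrite (eq_integral (fun x => (\1_(box r) x)%:E)); last first.
    by move=> x _; rewrite gee0_abs// lee_fin.
  rewrite integral_indic// setIT.
  apply: (@le_lt_trans _ _ (lam [set v | forall i, `[- `|r|, `|r|]%classic (v i 0)])).
    apply: le_measure; rewrite ?inE//; first exact: measurable_cV_symbox.
    move=> x bx j; rewrite /= in_itv/= -ler_norml (le_trans (ltW (bx j)))//.
    exact: ler_norm.
  by rewrite /lam lebesgue_cV_symbox// ltry.
have iD : lam.-integrable setT ((fun x => (grad f x i 0 ^+ 2 * rho x)%:E) \_ D).
  by apply/(integrable_mkcond _ mD); exact: gf.
apply: (le_integrable measurableT _ _ (integrableD measurableT ibox
  (integrableZl measurableT c^-1 iD))).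
  apply/measurable_EFinP.
  have -> : (fun x => \1_(D `&` box r) x * grad f x i 0) =
      (fun x => \1_(box r) x * ((fun x => grad f x i 0) \_ D) x).
    apply/funext => x; rewrite patchE !indicE in_setI.
    by case: (x \in D); case: (x \in box r); rewrite /= ?mul0r ?mul1r ?mulr0.
  by apply: measurable_funM => //; exact/(measurable_restrictT _ mD).
move=> x _; rewrite patchE !indicE in_setI.
have [xD|xD] := boolP (x \in D); last by rewrite mul0r abse0; exact: abse_ge0.
have [xb|xb] := boolP (x \in box r); last by rewrite mul0r abse0; exact: abse_ge0.
rewrite mul1r.
have cr : c <= rho x by exact: Hc (set_mem xD) (set_mem xb).
rewrite abse_EFin lee_fin.
set g := grad f x i 0; have g2 : 0 <= g ^+ 2 := sqr_ge0 g.
rewrite [leRHS]ger0_norm; last first.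
  by rewrite addr_ge0// mulr_ge0 ?invr_ge0 ?(ltW c0)// mulr_ge0// (le_trans (ltW c0)).
have h1 : g ^+ 2 <= c^-1 * (g ^+ 2 * rho x).
  by rewrite mulrCA ler_peMr// ler_pdivlMl ?mulr1.
have h2 : `|g| <= 1 + g ^+ 2.
  rewrite -real_normK ?num_real//; have := normr_ge0 g; nra.
by rewrite (le_trans h2)// lerD2l.
Qed.

Lemma measurable_sqgrad : measurable_fun setT sqgrad.
Proof.
rewrite (_ : sqgrad = (fun x => sqnorm (M^T *m grad f x)) \_ D); last first.
  apply/funext => x; rewrite /sqgrad patchE indicE -/D.
  by case: (x \in D); rewrite ?mul1r ?mul0r.
apply/(measurable_restrictT _ mD).
apply: measurable_sum => j; apply: measurable_funX.
under eq_fun do rewrite mxE.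
apply: measurable_sum => i; apply: measurable_funM => //.
exact: measurable_grad.
Qed.

Lemma sqgrad_ge0 x : 0 <= sqgrad x.
Proof. by rewrite mulr_ge0 ?sqnorm_ge0. Qed.

(** The increment formula is taken on all the sets [D] cut by the boxes of integer size, with one
    null set for all. Then come Jensen on [[0, 1]] and Cauchy-Schwarz for the product of [z] with
    [M^T grad f], which leaves the factor [|z|^2]. *)
Lemma ae_sq_increment_le (z : 'cV[R]_m) :
  {ae lam, forall x, D x -> D (x + M *m z) ->
    (((f (x + M *m z) - f x) ^+ 2)%:E <=
     (sqnorm z)%:E * \int[leb]_(t in `[0%R, 1%R]) (sqgrad (x + t *: (M *m z)))%:E)%E}.
Proof.
set h := M *m z.
pose E (k : nat) := D `&` box k%:R.
pose u (k : nat) x := \1_(E k) x * ((h^T *m grad f x) 0 0).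
have oEk k : open (E k) by exact: openI.
have EkD k : E k `<=` D by exact: subIsetl.
have iE k i : lam.-integrable setT (fun x => (\1_(E k) x * grad f x i 0)%:E).
  exact: grad_integrable.
have iu k : lam.-integrable setT (EFin \o u k).
  rewrite (_ : _ \o _ = (fun x => \sum_(i <- index_enum 'I_n)
      ((h i 0)%:E * (\1_(E k) x * grad f x i 0)%:E)%E)%E); last first.
    apply/funext => x; rewrite /u /= mxE mulr_sumr -sumEFin; apply: eq_bigr => i _.
    by rewrite -EFinM [h^T _ _]mxE mulrCA.
  by apply: integrable_sum => // i _; exact: integrableZl.
have A1 := ae_foralln (fun k =>
  @increment_is_integral_grad _ _ D f df _ h (oEk k) (EkD k) (iE k) _ ler01).
have A2 := ae_foralln (fun k => ae_integrable_along_segments h 0 1 (iu k)).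
apply: filterS2 A1 A2 => x fx ix Dx Dxh.
pose S := \sum_(i < n) (`|x i 0| + `|(x + h) i 0|).
have bS i : `|x i 0| <= S /\ `|(x + h) i 0| <= S.
  have h1 : `|x i 0| + `|(x + h) i 0| <= S.
    by rewrite /S (bigD1 i)//= lerDl sumr_ge0// => j _; rewrite addr_ge0.
  by split; apply: le_trans h1; rewrite ?lerDl ?lerDr.
(* [S] bounds every coordinate of both endpoints, hence of all points between them, so a box of size
   [k > S] contains the segment; convexity keeps it in [D]. *)
pose k := Num.bound S.
have Sk : S < k%:R.
  by apply: archi_boundP; apply: sumr_ge0 => i _; rewrite addr_ge0.
have seg t : 0 <= t <= 1 -> E k (x + t *: h).
  move=> t01; split; first exact: cD.
  move=> i; have [b1 b2] := bS i.
  rewrite (_ : (x + t *: h) i 0 = (1 - t) * x i 0 + t * (x + h) i 0); last first.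
    by rewrite !mxE; ring.
  apply: le_lt_trans Sk; apply: (le_trans (ler_normD _ _)); rewrite !normrM.
  rewrite (ger0_norm (_ : 0 <= 1 - t)) ?(ger0_norm (_ : 0 <= t)); [|lra..].
  have h1 : (1 - t) * `|x i 0| <= (1 - t) * S by rewrite ler_wpM2l//; lra.
  have h2 : t * `|(x + h) i 0| <= t * S by rewrite ler_wpM2l//; lra.
  lra.
have := fx k seg; rewrite scale1r => ->.
have muk : measurable_fun setT (u k) by have /integrableP[/measurable_EFinP] := iu k.
have mline : measurable_fun (`[0, 1]%classic : set (measurableTypeR R)) (fun t : R => u k (x + t *: h)).
  by apply: measurable_funTS; exact: measurable_along_line.
apply: (le_trans (sq_integral_itv01_le mline (ix k))).
have msg := measurable_sqgrad.
have msgl : measurable_fun (`[0, 1]%classic : set (measurableTypeR R)) (fun t : R => (sqgrad (x + t *: h))%:E).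
  apply/measurable_EFinP; apply: measurable_funTS.
  exact: measurable_along_line msg.
have sg0 := sqgrad_ge0.
rewrite -ge0_integralZl_EFin ?sqnorm_ge0//; last by move=> t _; rewrite lee_fin.
apply: ge0_le_integral => //.
- by move=> t _; rewrite lee_fin sqr_ge0.
- by apply/measurable_EFinP; exact: measurable_funX.
- exact: measurable_funeM.
- move=> t _; rewrite -EFinM lee_fin /u /sqgrad /E.
  have [yE|yE] := boolP (x + t *: h \in D `&` box k%:R); last first.
    by rewrite [\1_(D `&` _) _]indicE (negbTE yE) mul0r expr0n/= mulr_ge0 ?sqnorm_ge0// sg0.
  have yD : x + t *: h \in D by move: yE; rewrite !inE => -[].
  rewrite !indicE yE yD !mul1r /h trmx_mul -mulmxA mxE.
  under eq_bigr do rewrite mxE.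
  exact: (sum_cauchy_schwarz (fun i => z i 0)).
Qed.

End square_increment.

(* [x^-1] is the limit of [x / (x^2 + 1/k)], also at [0] where Rocq's inverse
   gives [0]. *)
Lemma measurable_invr (R : realType) : measurable_fun [set: R] (@GRing.inv R).
Proof.
pose q k (x : R) := x * (x ^+ 2 + k.+1%:R^-1)^-1.
have pos k (x : R) : 0 < x ^+ 2 + k.+1%:R^-1.
  by rewrite ltr_wpDl ?sqr_ge0// invr_gt0.
apply: (@measurable_fun_cvg _ _ _ _ q) => [k|x _].
  apply: continuous_measurable_fun => x; apply: cvgM; first exact: cvg_id.
  apply: cvgV; first by rewrite gt_eqF.
  by apply: cvgD; [exact: exprn_continuous|exact: cvg_cst].
have [->|x0] := eqVneq x 0.
  by rewrite invr0 /q; under eq_fun do rewrite mul0r; exact: cvg_cst.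
rewrite [X in _ --> X](_ : _ = x * (x ^+ 2 + 0)^-1); last first.
  by rewrite addr0; field.
apply: cvgM; first exact: cvg_cst.
apply: cvgV; first by rewrite addr0 sqrf_eq0.
by apply: cvgD; [exact: cvg_cst|exact: cvg_harmonic].
Qed.

Section conditional_poincare.
Variables (R : realType) (n m : nat) (rho f : 'cV[R]_n -> R) (M : 'M[R]_(n, m)).
Let lam := lebesgue_cV R n.
Let lamz := lebesgue_cV R m.
Let leb := @lebesgue_measure R.
Let D := dsupp rho.
Hypotheses (rho0 : forall x, 0 <= rho x)
  (oD : open D) (mrho : measurable_fun setT rho)
  (cD : forall x h t, D x -> D (x + h) -> 0 <= t <= 1 -> D (x + t *: h))
  (rho_lb : forall r : R, exists2 c, 0 < c &
     forall x, D x -> (forall i, `|x i 0| < r) -> c <= rho x)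
  (mf : measurable_fun D f)
  (df : forall x (i : 'I_n), D x -> derivable f x (delta_mx i 0))
  (gf : forall i, lam.-integrable D (fun x => (grad f x i 0 ^+ 2 * rho x)%:E)).

Definition slice_mass (x : 'cV[R]_n) : R :=
  \int[lebesgue_cV R m]_z rho (x + M *m z).

(** This is the conditional mean with the slice parametrized from [x] itself rather than from its
    active coordinates; so the inequality is proved for any matrix [M], without orthogonal
    coordinates. *)
Definition slice_mean (x : 'cV[R]_n) : R :=
  \int[lebesgue_cV R m]_z (f (x + M *m z) * (rho (x + M *m z) / slice_mass x)).

Hypotheses
  (mass_fin : forall x, (\int[lamz]_z (rho (x + M *m z)%R)%:E < +oo)%E)
  (mass_gt0 : forall x, D x -> 0 < slice_mass x)
  (slice_int : forall x, D x -> lamz.-integrable setT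
     (fun z => (f (x + M *m z) * (rho (x + M *m z) / slice_mass x))%:E))
  (C : R) (C0 : 0 <= C)
  (kernel_le : forall x, D x ->
    (\int[leb]_(t in `[0%R, 1%R]) \int[lamz]_z
       (sqnorm z * (rho (x - t *: (M *m z)) * rho (x + (1 - t) *: (M *m z))))%:E <=
     (C * (slice_mass x * rho x))%:E)%E).

Let mD : measurable D. Proof. exact: open_measurable_cV. Qed.

Let rho_out x : x \notin D -> rho x = 0.
Proof.
move=> /negP xD; apply/eqP; rewrite eq_le rho0 andbT leNgt; apply/negP => rx.
by apply: xD; rewrite inE.
Qed.

Let m_comp d (T : measurableType d) (g : 'cV[R]_n -> R) (p : T -> 'cV[R]_n) :
  measurable_fun setT g -> measurable_fun setT p -> measurable_fun setT (fun z => g (p z)).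
Proof. by move=> mg mp; exact: measurableT_comp mg mp. Qed.

Lemma measurable_slice_mass : measurable_fun setT slice_mass.
Proof.
have mF : measurable_fun setT (fun p : 'cV[R]_n * 'cV[R]_m => (rho (p.1 + M *m p.2)%R)%:E).
  apply/measurable_EFinP; apply: m_comp => //; apply: measurable_cVD => //.
  exact: measurable_cV_mulmx.
have mI := @measurable_integral_snd _ _ _ _ _ lamz
  (fun (x : 'cV[R]_n) (z : 'cV[R]_m) => (rho (x + M *m z)%R)%:E) mF (fun x z => rho0 _).
exact: (measurableT_comp (fine_measurable measurableT) mI).
Qed.

Lemma slice_mass_shift x z : slice_mass (x + M *m z) = slice_mass x.
Proof.
rewrite /slice_mass /Rintegral; congr fine.
under eq_integral => z' _ do rewrite -addrA -mulmxDr [z + z']addrC.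
apply: (@ge0_integral_cV_translation _ _ z (fun z => (rho (x + M *m z))%:E)); last first.
  by move=> z'; rewrite lee_fin.
apply/measurable_EFinP; apply: m_comp => //; apply: measurable_cVD => //.
exact: measurable_cV_mulmx.
Qed.

Lemma slice_massE x : ((slice_mass x)%:E = \int[lamz]_z (rho (x + M *m z)%R)%:E)%E.
Proof.
rewrite /slice_mass /Rintegral fineK// ge0_fin_numE//.
by apply: integral_ge0 => z _; rewrite lee_fin.
Qed.

(** [f] is measurable on [D] only. Its zero extension is measurable everywhere and has the same
    product with [rho]. *)
Let fb := f \_ D.

Let mfb : measurable_fun setT fb.
Proof. exact/(measurable_restrictT _ mD). Qed.

Let fbE x : D x -> fb x = f x.
Proof. by move=> Dx; rewrite /fb patchE mem_set. Qed.

Let frho x : f x * rho x = fb x * rho x.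
Proof.
rewrite /fb patchE; case: ifPn => // xD.
by rewrite rho_out// !mulr0.
Qed.

Lemma measurable_slice_mean : measurable_fun setT slice_mean.
Proof.
pose g (x : 'cV[R]_n) (z : 'cV[R]_m) : \bar R :=
  (fb (x + M *m z) * (rho (x + M *m z) / slice_mass x))%:E.
have -> : slice_mean = (fun x => fine (\int[lamz]_z g x z)%E).
  apply/funext => x; rewrite /slice_mean /Rintegral; congr fine.
  by apply: eq_integral => z _; congr EFin; rewrite !mulrA frho.
apply: (measurableT_comp (fine_measurable measurableT)).
have mg : measurable_fun setT (fun p : 'cV[R]_n * 'cV[R]_m => g p.1 p.2).
  have mxz : measurable_fun setT (fun p : 'cV[R]_n * 'cV[R]_m => p.1 + M *m p.2).
    by apply: measurable_cVD => //; exact: measurable_cV_mulmx.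
  apply/measurable_EFinP; apply: measurable_funM; first exact: m_comp.
  apply: measurable_funM; first exact: m_comp.
  apply: (measurableT_comp (@measurable_invr R)).
  exact: measurableT_comp measurable_slice_mass measurable_fst.
under eq_fun do rewrite integralE.
apply: emeasurable_funB.
- apply: (@measurable_integral_snd _ _ _ _ _ lamz (fun x => (g x)^\+%E)) => //.
  rewrite (_ : (fun p => _) = (fun p => g p.1 p.2)^\+%E); first exact: measurable_funepos.
  by apply/funext => -[x z]; exact: (congr1 (fun h => h z)
    (funepos_comp (fun p => g p.1 p.2) (pair x))).
- apply: (@measurable_integral_snd _ _ _ _ _ lamz (fun x => (g x)^\-%E)) => //.
  rewrite (_ : (fun p => _) = (fun p => g p.1 p.2)^\-%E); first exact: measurable_funeneg.
  by apply/funext => -[x z]; exact: (congr1 (fun h => h z)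
    (funeneg_comp (fun p => g p.1 p.2) (pair x))).
Qed.

Let A x z := (fb x - fb (x + M *m z)) ^+ 2 * (rho (x + M *m z) * rho x / slice_mass x).

Let slice_mass_ge0 x : 0 <= slice_mass x.
Proof. by apply: Rintegral_ge0 => z _. Qed.

Let A0 x z : 0 <= A x z.
Proof. by rewrite mulr_ge0 ?sqr_ge0// divr_ge0// mulr_ge0. Qed.

(** Jensen for the conditional density [q], applied to the difference of [fb] at [x] and at
    [x + M z], whose [q]-mean is [f x - slice_mean x]. *)
Let variance_slice x : D x ->
  (((f x - slice_mean x) ^+ 2 * rho x)%:E <= \int[lamz]_z (A x z)%:E)%E.
Proof.
move=> Dx.
have r0 := mass_gt0 Dx.
pose q z := rho (x + M *m z) / slice_mass x.
have mxz : measurable_fun setT (fun z : 'cV[R]_m => x + M *m z).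
  by apply: measurable_cVD => //; exact: measurable_cV_mulmx.
have mq : measurable_fun setT q by apply: measurable_funM => //; exact: m_comp.
have mfbz : measurable_fun setT (fun z => fb x - fb (x + M *m z)).
  by apply: measurable_funB => //; exact: m_comp.
have q0 z : 0 <= q z by rewrite divr_ge0.
have q1 : (\int[lamz]_z (q z)%:E = 1)%E.
  under eq_integral => z _ do rewrite /q mulrC EFinM.
  rewrite ge0_integralZl_EFin ?invr_ge0//; last 2 first.
  - by move=> z _; rewrite lee_fin.
  - by apply/measurable_EFinP; exact: m_comp.
  by rewrite -slice_massE -EFinM mulVf// gt_eqF.
have iq : lamz.-integrable setT (fun z => (q z)%:E).
  apply/integrableP; split; first exact/measurable_EFinP.
  rewrite (eq_integral (fun x => (q x)%:E)) ?q1 ?ltry//.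
  by move=> z _; rewrite gee0_abs// lee_fin.
have ifq : lamz.-integrable setT (fun z => (f (x + M *m z) * q z)%:E) := slice_int Dx.
have phiE z : (fb x - fb (x + M *m z)) * q z = f x * q z - f (x + M *m z) * q z.
  by rewrite mulrBl fbE// /q !mulrA frho.
have iphi : lamz.-integrable setT (fun z => ((fb x - fb (x + M *m z)) * q z)%:E).
  have -> : (fun z => ((fb x - fb (x + M *m z)) * q z)%:E) =
      (fun z => ((f x)%:E * (q z)%:E - (f (x + M *m z) * q z)%:E)%E).
    by apply/funext => z; rewrite phiE.
  by apply: integrableB => //; exact: integrableZl.
have := sq_integral_density_le measurableT mfbz mq (fun z _ => q0 z) q1 iphi.
have -> : \int[lamz]_z ((fb x - fb (x + M *m z)) * q z) = f x - slice_mean x.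
  under eq_Rintegral => z _ do rewrite phiE.
  rewrite RintegralB//; last exact: (integrableZl _ _ iq).
  rewrite RintegralZl//.
  rewrite [X in f x * X - _](_ : _ = 1) ?mulr1//.
  by rewrite /Rintegral q1.
move=> H; rewrite EFinM; apply: le_trans (lee_wpmul2r _ H) _; first by rewrite lee_fin.
rewrite -ge0_integralZr//; last 3 first.
- by apply/measurable_EFinP; apply: measurable_funM => //; exact: measurable_funX.
- by move=> z _; rewrite lee_fin mulr_ge0// sqr_ge0.
- by rewrite lee_fin.
rewrite le_eqVlt; apply/orP; left; apply/eqP; apply: eq_integral => z _.
by rewrite -EFinM; congr EFin; rewrite /A /q; ring.
Qed.

Let mA : measurable_fun setT (fun p : 'cV[R]_n * 'cV[R]_m => A p.1 p.2).
Proof.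
have mxz : measurable_fun setT (fun p : 'cV[R]_n * 'cV[R]_m => p.1 + M *m p.2).
  by apply: measurable_cVD => //; exact: measurable_cV_mulmx.
apply: measurable_funM.
  by apply: measurable_funX; apply: measurable_funB; exact: m_comp.
apply: measurable_funM; first by apply: measurable_funM; exact: m_comp.
apply: (measurableT_comp (@measurable_invr R)).
exact: measurableT_comp measurable_slice_mass measurable_fst.
Qed.

(** Bound for [A x z] before integration in [t]: the squared increment is replaced by [|z|^2] times
    the squared gradient on the segment. *)
Let B x z t := sqnorm z * (sqgrad rho f M (x + t *: (M *m z)) *
  (rho (x + M *m z) * rho x / slice_mass x)).

Let B0 x z t : 0 <= B x z t.
Proof. by rewrite mulr_ge0 ?sqnorm_ge0// mulr_ge0 ?sqgrad_ge0// divr_ge0// mulr_ge0. Qed.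

(** [B] taken at [x - t M z]: the gradient is now evaluated at [x] and the displacement has moved to
    the two densities, while [slice_mass] is constant along the slice. The integrals of [B] and [B']
    over [x] agree, and for fixed [x] the part depending on [z] and [t] is the kernel of
    [kernel_le]. *)
Let B' x z t := sqnorm z * (sqgrad rho f M x *
  (rho (x - t *: (M *m z)) * rho (x + (1 - t) *: (M *m z)) / slice_mass x)).

Let B'0 x z t : 0 <= B' x z t.
Proof. by rewrite mulr_ge0 ?sqnorm_ge0// mulr_ge0 ?sqgrad_ge0// divr_ge0// mulr_ge0. Qed.

Let B_shift x z t : B' (x + t *: (M *m z)) z t = B x z t.
Proof.
rewrite /B' /B addrK -addrA -scalerDl addrCA subrr addr0 scale1r.
by rewrite scalemxAr slice_mass_shift (mulrC (rho x)).
Qed.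

Let msg := measurable_sqgrad M oD mf df.

(* [T] stands for the space of triples (z, x, t), or for one of its slices. *)
Let mB d (T : measurableType d) (x : T -> 'cV[R]_n) (z : T -> 'cV[R]_m) (t : T -> R) :
  measurable_fun setT x -> measurable_fun setT z -> measurable_fun setT t ->
  measurable_fun setT (fun p => (B (x p) (z p) (t p))%:E).
Proof.
move=> mx mz mt; have mMz := measurable_cV_mulmx M mz.
apply/measurable_EFinP; apply: measurable_funM; first exact: measurable_sqnorm.
apply: measurable_funM.
  by apply: m_comp => //; apply: measurable_cVD => //; exact: measurable_cVZ.
apply: measurable_funM.
  by apply: measurable_funM; apply: m_comp => //; exact: measurable_cVD.
apply: (measurableT_comp (@measurable_invr R)).
exact: measurableT_comp measurable_slice_mass mx.
Qed.

Let mB' d (T : measurableType d) (x : T -> 'cV[R]_n) (z : T -> 'cV[R]_m) (t : T -> R) :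
  measurable_fun setT x -> measurable_fun setT z -> measurable_fun setT t ->
  measurable_fun setT (fun p => (B' (x p) (z p) (t p))%:E).
Proof.
move=> mx mz mt; have mMz := measurable_cV_mulmx M mz.
apply/measurable_EFinP; apply: measurable_funM; first exact: measurable_sqnorm.
apply: measurable_funM; first exact: m_comp.
apply: measurable_funM.
  apply: measurable_funM; apply: m_comp => //; apply: measurable_cVD => //.
    by apply: measurable_cVN; exact: measurable_cVZ.
  by apply: measurable_cVZ => //; exact: measurable_funB.
apply: (measurableT_comp (@measurable_invr R)).
exact: measurableT_comp measurable_slice_mass mx.
Qed.

(** If [x] or [x + M z] is outside [D], one of the densities in [A] vanishes; otherwise
    [ae_sq_increment_le] applies, for almost every [x] at this fixed [z]. *)
Let A_le_B z : (\int[lam]_x (A x z)%:E <=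
  \int[lam]_x \int[leb]_(t in `[0%R, 1%R]) (B x z t)%:E)%E.
Proof.
apply: ae_ge0_le_integral => //.
- by move=> x _; rewrite lee_fin.
- apply/measurable_EFinP; exact: (measurableT_comp mA (measurable_pair2 z)).
- by move=> x _; apply: integral_ge0 => t _; rewrite lee_fin.
- pose F x (t : measurableTypeR R) := (B x z t)%:E.
  have mF : measurable_fun setT (fun p => F p.1 p.2) by exact: mB.
  exact: (@measurable_integral_in _ _ _ _ _ leb _ (measurable_itv `[0, 1]) F mF
    (fun x t => B0 x z t)).
have := ae_sq_increment_le M oD cD rho_lb mf df gf z.
apply: filterS => x Hx _.
have [Dx|nDx] := pselect (D x); last first.
  rewrite /A (rho_out (x := x)) ?mulr0 ?mul0r ?mulr0; last by apply/negP => /set_mem.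
  by apply: integral_ge0 => t _; rewrite lee_fin.
have [Dxz|nDxz] := pselect (D (x + M *m z)); last first.
  rewrite /A (rho_out (x := x + M *m z)) ?mul0r ?mulr0; last by apply/negP => /set_mem.
  by apply: integral_ge0 => t _; rewrite lee_fin.
have c0 : 0 <= rho (x + M *m z) * rho x / slice_mass x by rewrite divr_ge0// mulr_ge0.
have := lee_wpmul2r (c0 : (0 <= (_)%:E)%E) (Hx Dx Dxz).
rewrite -EFinM -sqrrN opprB /A !fbE// => /le_trans; apply.
have mline : measurable_fun (`[0, 1]%classic : set (measurableTypeR R))
    (fun t : R => (sqgrad rho f M (x + t *: (M *m z)))%:E).
  by apply/measurable_EFinP; apply: measurable_funTS; exact: measurable_along_line.
rewrite -ge0_integralZl_EFin ?sqnorm_ge0//; last by move=> t _; rewrite lee_fin sqgrad_ge0.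
rewrite -ge0_integralZr//; last 2 first.
- exact: measurable_funeM.
- by move=> t _; rewrite mule_ge0// lee_fin ?sqnorm_ge0 ?sqgrad_ge0.
rewrite le_eqVlt; apply/orP; left; apply/eqP; apply: eq_integral => t _.
by rewrite -!EFinM; congr EFin; rewrite /B mulrA.
Qed.

Let kernel_mass x : (\int[leb]_(t in `[0%R, 1%R]) \int[lamz]_z (B' x z t)%:E <=
  (C * (sqgrad rho f M x * rho x))%:E)%E.
Proof.
have [Dx|nDx] := pselect (D x); last first.
  rewrite (_ : sqgrad rho f M x = 0); last first.
    by rewrite /sqgrad indicE memNset ?mul0r.
  rewrite mul0r mulr0 integral0_eq// => t _; apply: integral0_eq => z _.
  by rewrite /B' /sqgrad indicE memNset// !mul0r mulr0.
have r0 := mass_gt0 Dx.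
pose K z t := sqnorm z * (rho (x - t *: (M *m z)) * rho (x + (1 - t) *: (M *m z))).
have K0 z t : 0 <= K z t by rewrite mulr_ge0 ?sqnorm_ge0// mulr_ge0.
have mK d (T : measurableType d) (z : T -> 'cV[R]_m) (t : T -> R) :
    measurable_fun setT z -> measurable_fun setT t ->
    measurable_fun setT (fun p => (K (z p) (t p))%:E).
  move=> mz mt; have mMz := measurable_cV_mulmx M mz.
  apply/measurable_EFinP; apply: measurable_funM; first exact: measurable_sqnorm.
  apply: measurable_funM; apply: m_comp => //; apply: measurable_cVD => //.
    by apply: measurable_cVN; exact: measurable_cVZ.
  by apply: measurable_cVZ => //; exact: measurable_funB.
pose c := sqgrad rho f M x / slice_mass x.
have c0 : 0 <= c by rewrite divr_ge0// sqgrad_ge0.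
have B'E z t : B' x z t = c * K z t by rewrite /B' /c /K; ring.
under eq_integral => t _.
  under eq_integral => z _ do rewrite B'E EFinM.
  rewrite ge0_integralZl_EFin//; last 2 first.
  - by move=> z _; rewrite lee_fin.
  - exact: mK.
  over.
rewrite ge0_integralZl_EFin//; last 2 first.
- by move=> t _; apply: integral_ge0 => z _; rewrite lee_fin.
- apply: measurable_funTS.
  apply: (@measurable_integral_snd _ _ (measurableTypeR R) _ _ lamz
    (fun t z => (K z t)%:E)) => //; last by move=> t z; rewrite lee_fin.
  exact: mK.
apply: (le_trans (lee_wpmul2l _ (kernel_le Dx))); first by rewrite lee_fin.
rewrite -EFinM lee_fin /c le_eqVlt; apply/orP; left; apply/eqP.
by field; rewrite gt_eqF.
Qed.

(** Chain: [variance_slice] at fixed [x]; swap to put [z] outside; [A_le_B] and the translation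
    turning [B] into [B'] at fixed [z]; swap back; [kernel_mass] at fixed [x]. All integrands are
    nonnegative, so the swaps hold even for infinite integrals. *)
Lemma conditional_poincare :
  (\int[lam]_(x in D) ((f x - slice_mean x) ^+ 2 * rho x)%:E <=
   C%:E * \int[lam]_x (sqgrad rho f M x * rho x)%:E)%E.
Proof.
have mAE : measurable_fun setT (fun p : 'cV[R]_n * 'cV[R]_m => (A p.1 p.2)%:E).
  exact/measurable_EFinP.
have mswap : measurable_fun setT (fun p : 'cV[R]_m * 'cV[R]_n => (p.2, p.1)).
  exact: measurable_fun_pair.
have mswap' : measurable_fun setT (fun p : 'cV[R]_n * 'cV[R]_m => (p.2, p.1)).
  exact: measurable_fun_pair.
have A0E x z : (0 <= (A x z)%:E)%E by rewrite lee_fin.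
apply: (@le_trans _ _ (\int[lam]_x \int[lamz]_z (A x z)%:E)%E).
  rewrite integral_mkcond; apply: ge0_le_integral => //.
  - move=> x _; rewrite patchE; case: ifP => // _.
    by rewrite lee_fin mulr_ge0// sqr_ge0.
  - apply/(measurable_restrictT _ mD); apply/measurable_EFinP.
    apply: measurable_funM; last exact: measurable_funTS.
    apply: measurable_funX; apply: measurable_funB => //.
    exact: measurable_funTS measurable_slice_mean.
  - exact: (@measurable_integral_snd _ _ _ _ _ lamz (fun x z => (A x z)%:E)).
  - move=> x _; rewrite patchE; case: ifPn => [/set_mem|_]; first exact: variance_slice.
    exact: integral_ge0.
rewrite (@ge0_integral_swap _ _ _ _ _ lam lamz (fun x z => (A x z)%:E) mAE A0E).
pose F z x (t : measurableTypeR R) := (B' x z t)%:E.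
have F0 z x t : (0 <= F z x t)%E by rewrite lee_fin.
have mFz z : measurable_fun setT (fun p : 'cV[R]_n * measurableTypeR R => F z p.1 p.2).
  exact: mB'.
have mF : measurable_fun setT
    (fun p : ('cV[R]_m * 'cV[R]_n) * measurableTypeR R => F p.1.1 p.1.2 p.2).
  apply: mB' => //.
  - exact: (measurableT_comp measurable_snd measurable_fst).
  - exact: (measurableT_comp measurable_fst measurable_fst).
have mIF : measurable_fun setT
    (fun p : 'cV[R]_m * 'cV[R]_n => \int[leb]_(t in `[0%R, 1%R]) F p.1 p.2 t)%E.
  exact: (@measurable_integral_in _ _ _ _ _ leb _ (measurable_itv `[0, 1])
    (fun p : 'cV[R]_m * 'cV[R]_n => F p.1 p.2) mF (fun p t => F0 _ _ t)).
have IF0 z x : (0 <= \int[leb]_(t in `[0%R, 1%R]) F z x t)%E.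
  by apply: integral_ge0 => t _; exact: F0.
apply: (@le_trans _ _ (\int[lamz]_z \int[lam]_x \int[leb]_(t in `[0%R, 1%R]) F z x t)%E).
  have shift z : (\int[lam]_x \int[leb]_(t in `[0%R, 1%R]) (B x z t)%:E =
      \int[lam]_x \int[leb]_(t in `[0%R, 1%R]) F z x t)%E.
    have mBz : measurable_fun setT (fun p : 'cV[R]_n * measurableTypeR R => (B p.1 z p.2)%:E).
      exact: (mB measurable_fst (measurable_cst z) measurable_snd).
    rewrite (@ge0_integral_swap_in _ _ _ _ _ lam leb setT _ measurableT (measurable_itv `[0, 1])
      (fun x (t : measurableTypeR R) => (B x z t)%:E) mBz (fun x t => B0 x z t)).
    rewrite (@ge0_integral_swap_in _ _ _ _ _ lam leb setT _ measurableT (measurable_itv `[0, 1])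
      (F z) (mFz z) (F0 z)).
    apply: eq_integral => t _; under eq_integral => x _ do rewrite -B_shift.
    apply: (@ge0_integral_cV_translation _ _ (t *: (M *m z)) (fun x => F z x t)) => //.
    exact: mB'.
  apply: ge0_le_integral => //.
  - by move=> z _; apply: integral_ge0 => x _; exact: A0E.
  - exact: (@measurable_integral_snd _ _ _ _ _ lam (fun z x => (A x z)%:E)
      (measurableT_comp mAE mswap) (fun z x => A0E x z)).
  - exact: (@measurable_integral_snd _ _ _ _ _ lam
      (fun z x => \int[leb]_(t in `[0%R, 1%R]) F z x t)%E mIF IF0).
  - by move=> z _; rewrite -shift; exact: A_le_B.
rewrite (@ge0_integral_swap _ _ _ _ _ lamz lam
  (fun z x => \int[leb]_(t in `[0%R, 1%R]) F z x t)%E mIF); last first.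
  by move=> z x; exact: integral_ge0.
rewrite -ge0_integralZl_EFin//; last 2 first.
- by move=> x _; rewrite lee_fin mulr_ge0// sqgrad_ge0.
- by apply/measurable_EFinP; exact: measurable_funM.
apply: ge0_le_integral => //.
- by move=> x _; apply: integral_ge0 => z _; exact: integral_ge0.
- exact: (@measurable_integral_snd _ _ _ _ _ lamz
    (fun x z => \int[leb]_(t in `[0%R, 1%R]) F z x t)%E (measurableT_comp mIF mswap') (fun x z => IF0 z x)).
- by apply: measurable_funeM; apply/measurable_EFinP; exact: measurable_funM.
- move=> x _; apply: le_trans (kernel_mass x).
  have mFx : measurable_fun setT (fun p : 'cV[R]_m * measurableTypeR R => F p.1 x p.2).
    exact: mB'.
  by rewrite (@ge0_integral_swap_in _ _ _ _ _ lamz leb setT _ measurableT (measurable_itv `[0, 1])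
    (fun z => F z x) mFx (fun z t => F0 z x t)).
Qed.

End conditional_poincare.

(** * Kernel bounds for the two laws *)

Lemma convex_set_segment (R : realType) n (D : set 'cV[R]_n) :
  convex_set (D : set (convex_lmodType 'cV[R]_n)) ->
  forall x h t, D x -> D (x + h) -> 0 <= t <= 1 -> D (x + t *: h).
Proof.
move=> cD x h t Dx Dxh /andP[t0 t1].
have := cD (x + h) x (Itv01 t0 t1) (mem_set Dxh) (mem_set Dx).
rewrite inE; congr D.
rewrite [LHS](_ : _ = t *: (x + h) + (1 - t) *: x)//.
by rewrite scalerDr scalerBl scale1r [x - _]addrC addrACA subrr add0r addrC.
Qed.

(** The norm of a matrix is the sup norm, whence the factor [n] here and in the constant of the
    uniform law. *)
Lemma sqnorm_le (R : realType) n (x : 'cV[R]_n) : sqnorm x <= n%:R * `|x| ^+ 2.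
Proof.
rewrite /sqnorm (@le_trans _ _ (\sum_(i < n) `|x| ^+ 2))//; last first.
  by rewrite sumr_const card_ord mulr_natl.
apply: ler_sum => i _; rewrite -real_normK ?num_real// ler_pXn2r ?nnegrE//.
rewrite [leRHS]/Num.norm/= mx_normrE.
exact: (le_bigmax _ (fun ij : 'I_n * 'I_1 => `|x ij.1 ij.2|) (i, 0)).
Qed.

Lemma coord_le_sqnorm (R : realType) n (x : 'cV[R]_n) i : `|x i 0| <= sqnorm x + 1.
Proof.
have : x i 0 ^+ 2 <= sqnorm x.
  by rewrite /sqnorm (bigD1 i)//= lerDl sumr_ge0// => j _; exact: sqr_ge0.
have := sqr_ge0 (`|x i 0| - 1); rewrite sqrrB real_normK ?num_real// expr1n mulr1.
by have := normr_ge0 (x i 0); lra.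
Qed.

Section slice_scaling.
Variables (R : realType) (n m : nat) (rho : 'cV[R]_n -> R) (M : 'M[R]_(n, m)).
Hypotheses (rho0 : forall x, 0 <= rho x) (mrho : measurable_fun setT rho)
  (mass_fin : forall x, (\int[lebesgue_cV R m]_z (rho (x + M *m z)%R)%:E < +oo)%E).

Lemma measurable_slice (x : 'cV[R]_n) c :
  measurable_fun setT (fun z : 'cV[R]_m => rho (x + c *: (M *m z))).
Proof.
apply: (measurableT_comp mrho); apply: measurable_cVD => //.
by under eq_fun do rewrite scalemxAl; exact: measurable_cV_mulmx.
Qed.

(** The dilation [z |-> c z] has the factor [|c|^-m], at most [2^m] when [|c| >= 1/2]. *)
Lemma scaled_slice_mass_le x c : 2^-1 <= `|c| ->
  (\int[lebesgue_cV R m]_z (rho (x + c *: (M *m z))%R)%:E <=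
   (2 ^+ m * slice_mass rho M x)%:E)%E.
Proof.
move=> c2; have c0 : c != 0 by rewrite -normr_gt0; lra.
have mh : measurable_fun setT (fun z : 'cV[R]_m => (rho (x + M *m z)%R)%:E).
  by have := measurable_slice x 1; under eq_fun do rewrite scale1r; move/measurable_EFinP.
under eq_integral => z _ do rewrite scalemxAr.
rewrite (@ge0_integral_cV_scale _ _ c (fun z => (rho (x + M *m z)%R)%:E) c0 mh); last first.
  by move=> z; rewrite lee_fin.
rewrite -slice_massE// -EFinM lee_fin ler_wpM2r//.
  by apply: Rintegral_ge0 => z _; exact: rho0.
rewrite lerXn2r ?nnegrE ?invr_ge0// -[leRHS]invrK lef_pV2 ?posrE//.
by rewrite normr_gt0.
Qed.

End slice_scaling.

(** * The uniform law on a bounded convex set *)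

Section uniform_kernel.
Variables (R : realType) (n m : nat) (rho : 'cV[R]_n -> R) (M : 'M[R]_(n, m)).
Hypotheses (MM : M^T *m M = 1%:M) (rho0 : forall x, 0 <= rho x)
  (mrho : measurable_fun setT rho).
Variables (B c : R).
Hypotheses (B0 : 0 <= B) (c0 : 0 <= c) (bD : forall x, dsupp rho x -> `|x| <= B)
  (rhoD : forall x, dsupp rho x -> rho x = c).

Let rho_out x : ~ dsupp rho x -> rho x = 0.
Proof. by move=> xD; apply/eqP; rewrite eq_le rho0 andbT leNgt; exact/negP. Qed.

(** [M] is an isometry and the support is bounded, so the integrand is at most [c] and vanishes
    outside a cube of radius [r]. *)
Lemma uniform_slice_mass_fin x :
  (\int[lebesgue_cV R m]_z (rho (x + M *m z)%R)%:E < +oo)%E.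
Proof.
pose r := n%:R * (B + `|x|) ^+ 2 + 1.
have r0 : 0 <= r by rewrite addr_ge0// mulr_ge0// sqr_ge0.
pose E := [set z : 'cV[R]_m | forall i, `[- r, r]%classic (z i 0)].
have mE : measurable E by exact: measurable_cV_symbox.
have mrM : measurable_fun setT (fun z : 'cV[R]_m => (rho (x + M *m z)%R)%:E).
  apply/measurable_EFinP; apply: measurableT_comp mrho _.
  by apply: measurable_cVD => //; exact: measurable_cV_mulmx.
rewrite [ltLHS](_ : _ = \int[lebesgue_cV R m]_(z in E) (rho (x + M *m z)%R)%:E)%E; last first.
  rewrite [RHS]integral_mkcond; apply: eq_integral => z _; rewrite patchE; case: ifPn => // zE.
  rewrite rho_out// => Dz; move/negP: zE; apply; apply/mem_set => i /=.
  rewrite in_itv/= -ler_norml (le_trans (coord_le_sqnorm z i))// /r lerD2r.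
  rewrite -(sqnorm_isometry z MM) (le_trans (sqnorm_le _))// ler_wpM2l//.
  rewrite lerXn2r ?nnegrE ?addr_ge0//.
  rewrite (_ : M *m z = (x + M *m z) - x); last by rewrite addrC addKr.
  by rewrite (le_trans (ler_normB _ _))// lerD2r bD.
apply: (@le_lt_trans _ _ (\int[lebesgue_cV R m]_(z in E) c%:E)%E).
  apply: ge0_le_integral => //.
  - by move=> z _; rewrite lee_fin.
  - exact: measurable_funTS.
  - move=> z _; rewrite lee_fin.
    have [Dz|Dz] := pselect (dsupp rho (x + M *m z)); first by rewrite rhoD.
    by rewrite rho_out.
rewrite integral_cst// [X in (_ * X)%E](lebesgue_cV_symbox m r0 : _ = _).
by rewrite -EFinM ltry.
Qed.

Lemma uniform_kernel_le x : dsupp rho x ->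
  (\int[@lebesgue_measure R]_(t in `[0%R, 1%R]) \int[lebesgue_cV R m]_z
     (sqnorm z * (rho (x - t *: (M *m z)) * rho (x + (1 - t) *: (M *m z))))%:E <=
   (n%:R * (2 * B) ^+ 2 * 2 ^+ m * (slice_mass rho M x * rho x))%:E)%E.
Proof.
move=> Dx; pose L := n%:R * (2 * B) ^+ 2.
have L0 : 0 <= L by rewrite mulr_ge0// sqr_ge0.
(* Where both densities are nonzero, [M z] is a difference of two points of the support, so
   [|z|^2 <= n (2B)^2]. One density is then replaced by its value [c], and either one can be
   kept. *)
have key t s z : s = t + 1 -> sqnorm z * (rho (x + t *: (M *m z)) * rho (x + s *: (M *m z))) <=
    L * (c * rho (x + t *: (M *m z))) /\
    sqnorm z * (rho (x + t *: (M *m z)) * rho (x + s *: (M *m z))) <=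
    L * (c * rho (x + s *: (M *m z))).
  move=> ->.
  have [D1|D1] := pselect (dsupp rho (x + t *: (M *m z))); last first.
    by rewrite (rho_out D1) !(mul0r, mulr0); split => //; rewrite mulr_ge0// mulr_ge0.
  have [D2|D2] := pselect (dsupp rho (x + (t + 1) *: (M *m z))); last first.
    by rewrite (rho_out D2) !(mul0r, mulr0); split => //; rewrite mulr_ge0// mulr_ge0.
  have zL : sqnorm z <= L.
    rewrite -(sqnorm_isometry z MM) (le_trans (sqnorm_le _))// ler_wpM2l//.
    rewrite lerXn2r ?nnegrE ?mulr_ge0//.
    rewrite (_ : M *m z = (x + (t + 1) *: (M *m z)) - (x + t *: (M *m z))); last first.
      by rewrite scalerDl scale1r opprD addrACA subrr add0r addrAC subrr add0r.
    by rewrite (le_trans (ler_normB _ _))// mulr_natl mulr2n lerD// bD.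
  by rewrite !rhoD//; split; rewrite ler_wpM2r// mulr_ge0.
have mk : measurable_fun setT (fun p : measurableTypeR R * 'cV[R]_m =>
    (sqnorm p.2 * (rho (x - p.1 *: (M *m p.2)) * rho (x + (1 - p.1) *: (M *m p.2))))%:E).
  have mM : measurable_fun setT (fun p : measurableTypeR R * 'cV[R]_m => M *m p.2).
    by apply: measurable_cV_mulmx; exact: measurable_snd.
  apply/measurable_EFinP; apply: measurable_funM.
    by apply: measurable_sqnorm; exact: measurable_snd.
  apply: measurable_funM; apply: (measurableT_comp mrho); apply: measurable_cVD => //.
    by apply: measurable_cVN; apply: measurable_cVZ => //; exact: measurable_fst.
  by apply: measurable_cVZ => //; apply: measurable_funB => //; exact: measurable_fst.
have k0 t z : (0 <= (sqnorm z * (rho (x - t *: (M *m z)) * rho (x + (1 - t) *: (M *m z))))%:E)%E.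
  by rewrite lee_fin mulr_ge0 ?sqnorm_ge0// mulr_ge0.
have mI := @measurable_integral_snd _ _ _ _ _ (lebesgue_cV R m) (fun (t : measurableTypeR R) z =>
    (sqnorm z * (rho (x - t *: (M *m z)) * rho (x + (1 - t) *: (M *m z))))%:E) mk k0.
pose K := L * 2 ^+ m * (slice_mass rho M x * rho x).
apply: (@le_trans _ _ (\int[@lebesgue_measure R]_(t in `[0%R, 1%R]) K%:E)%E); last first.
  by rewrite integral_cst// [X in (_ * X)%E](lebesgue_itv01 R : _ = _) mule1.
apply: ge0_le_integral => //.
- by move=> t _; apply: integral_ge0.
- exact: measurable_funTS mI.
move=> t; rewrite /= in_itv/= => /andP[t0 t1].
have mkt : measurable_fun setT (fun z : 'cV[R]_m =>
    (sqnorm z * (rho (x - t *: (M *m z)) * rho (x + (1 - t) *: (M *m z))))%:E).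
  have mp : measurable_fun setT (fun z : 'cV[R]_m => (t : measurableTypeR R, z)).
    exact: measurable_fun_pair.
  exact: (measurableT_comp mk mp).
have bound s : 2^-1 <= `|s| ->
    (forall z, sqnorm z * (rho (x - t *: (M *m z)) * rho (x + (1 - t) *: (M *m z))) <=
      L * (c * rho (x + s *: (M *m z)))) ->
    (\int[lebesgue_cV R m]_z (sqnorm z * (rho (x - t *: (M *m z)) * rho (x + (1 - t) *: (M *m z))))%:E
      <= K%:E)%E.
  move=> s2 Hs; have mrs := measurable_slice M mrho x s.
  apply: (@le_trans _ _ (\int[lebesgue_cV R m]_z ((L * c)%:E * (rho (x + s *: (M *m z)))%:E))%E).
    apply: ge0_le_integral => //.
    - by apply: measurable_funeM; exact/measurable_EFinP.
    - by move=> z _; rewrite -EFinM lee_fin -mulrA.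
  rewrite ge0_integralZl_EFin//; last 3 first.
  - by move=> z _; rewrite lee_fin.
  - exact/measurable_EFinP.
  - exact: mulr_ge0.
  have Lc : (0 <= (L * c)%:E)%E by rewrite lee_fin mulr_ge0.
  apply: (le_trans (lee_wpmul2l Lc (scaled_slice_mass_le rho0 mrho uniform_slice_mass_fin x s2))).
  by rewrite -EFinM lee_fin /K (rhoD Dx) le_eqVlt; apply/orP; left; apply/eqP; ring.
(* The density kept is the one whose dilation factor, [- t] or [1 - t], has absolute value at least
   1/2. *)
have [th|th] := leP 2^-1 t.
  apply: (bound (- t)); first by rewrite normrN ger0_norm.
  by move=> z; rewrite -scaleNr; apply: (key _ _ z _).1; lra.
apply: (bound (1 - t)); first by rewrite ger0_norm; lra.
by move=> z; rewrite -scaleNr; apply: (key _ _ z _).2; lra.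
Qed.

End uniform_kernel.

(** * The standard normal law *)

Lemma sqnormDZ (R : realType) n (x y : 'cV[R]_n) s :
  sqnorm (x + s *: y) = sqnorm x + 2 * s * (x^T *m y) 0 0 + s ^+ 2 * sqnorm y.
Proof.
rewrite /sqnorm !mulr_sumr mxE mulr_sumr -!big_split/=.
by apply: eq_bigr => i _; rewrite !mxE; ring.
Qed.

(** Finiteness for [e^(-|z|^2)] follows from the one-dimensional Gauss integral by induction on the
    dimension. As only finiteness matters, [e^(-|z|^2 / 2)] is simply bounded by the dilate
    [e^(-|z / 2|^2)]. *)
Lemma gaussian_integral_lty (R : realType) n :
  (\int[lebesgue_cV R n]_z (expR (- (sqnorm z / 2)))%:E < +oo)%E.
Proof.
have mg p : measurable_fun [set: 'cV[R]_p] (fun z => expR (- sqnorm z)).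
  by apply: measurableT_comp => //; apply: measurableT_comp => //; exact: measurable_sqnorm.
have mgE p : measurable_fun [set: 'cV[R]_p] (fun z => (expR (- sqnorm z))%:E).
  by apply/measurable_EFinP; exact: mg.
have fin1 : (\int[lebesgue_cV R n]_z (expR (- sqnorm z))%:E < +oo)%E.
  elim: n => [|p IH].
    rewrite /= integral_dirac//; last exact: mgE.
    by rewrite diracE mem_set// mul1e ltry.
  rewrite ge0_integral_lebesgue_cVS; last 2 first.
  - exact: mgE.
  - by move=> x; rewrite lee_fin expR_ge0.
  pose Gp := fine (\int[lebesgue_cV R p]_z (expR (- sqnorm z))%:E)%E.
  rewrite [ltLHS](_ : _ = \int[lebesgue_measure]_x ((expR (- x ^+ 2))%:E * Gp%:E))%E.
    rewrite ge0_integralZr//.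
    - by rewrite [X in (X * _)%E](@integralT_gauss R : _ = _) -EFinM ltry.
    - by apply/measurable_EFinP; exact: measurable_gauss_fun.
    - by rewrite lee_fin fine_ge0// integral_ge0// => z _; rewrite lee_fin expR_ge0.
  apply: eq_integral => x _.
  rewrite fineK; last first.
    by rewrite ge0_fin_numE// integral_ge0// => z _; rewrite lee_fin expR_ge0.
  rewrite -ge0_integralZl_EFin ?expR_ge0//; last exact: mgE.
  apply: eq_integral => v _; rewrite -EFinM -expRD; congr (expR _)%:E.
  rewrite /sqnorm big_ord_recl cV_cons0 /= opprD; congr (_ - _).
  by apply: eq_bigr => i _; rewrite cV_consS.
have h0 : 2^-1 != 0 :> R by [].
have mE : measurable_fun [set: 'cV[R]_n] (fun z => (expR (- sqnorm z))%:E) by exact: mgE.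
have E0 (z : 'cV[R]_n) : (0 <= (expR (- sqnorm z))%:E)%E by rewrite lee_fin expR_ge0.
have H := ge0_integral_cV_scale h0 mE E0.
apply: (@le_lt_trans _ _ (\int[lebesgue_cV R n]_z (expR (- sqnorm (2^-1 *: z)))%:E)%E).
  apply: ge0_le_integral => //.
  - apply/measurable_EFinP; apply: measurableT_comp => //; apply: measurableT_comp => //.
    by apply: measurable_funM => //; exact: measurable_sqnorm.
  - apply/measurable_EFinP; apply: measurableT_comp => //; apply: measurableT_comp => //.
    by apply: measurable_sqnorm; apply: measurable_cVZ.
  - move=> z _; rewrite lee_fin ler_expR lerN2 sqnormZ; have := sqnorm_ge0 z.
    by rewrite expr2; lra.
by rewrite H lte_mul_pinfty// lee_fin exprn_ge0// invr_ge0.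
Qed.

(* [a e^(-a t (1 - t))] is at most the derivative of the function integrated
   here, since [t (1 - t)] is at least [t / 2] or [(1 - t) / 2]. *)
Lemma integral_gaussian_weight_le (R : realType) (a : R) : 0 <= a ->
  (\int[lebesgue_measure]_(t in `[0%R, 1%R]) (16 + 8 * (a * expR (- (t * (1 - t) * a))))%:E
   <= 48%:E)%E.
Proof.
move=> a0; pose mu := @lebesgue_measure R.
(* [F 1 - F 0] equals [16 + 32 (1 - e^(-a/2))], whence the [48]. *)
pose F (t : R) := 16 * t + 16 * (expR (- (a / 2) * (1 - t)) - expR (- (a / 2) * t)).
pose F' (t : R) := 16 + 8 * (a * (expR (- (a / 2) * (1 - t)) + expR (- (a / 2) * t))).
have dF (t : R) : is_derive t 1 F (F' t).
  rewrite /F /F'.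
  have d1 : is_derive t (1:R) (fun t : R => - (a / 2) * (1 - t)) (a / 2).
    by apply: is_derive_eq; rewrite /GRing.scale/=; ring.
  have d2 : is_derive t (1:R) (fun t : R => - (a / 2) * t) (- (a / 2)).
    by apply: is_derive_eq; rewrite /GRing.scale/=; ring.
  by apply: is_derive_eq; rewrite /GRing.scale/=; field.
have iF' : mu.-integrable `[0%R, 1%R] (EFin \o F').
  apply: continuous_compact_integrable; first exact: segment_compact.
  apply: continuous_subspaceT => s.
  have mulc (c : R) (g : R -> R) : {for s, continuous g} -> {for s, continuous (fun t => c * g t)}.
    by move=> cg; apply: cvgM => //; exact: cvg_cst.
  apply: cvgD; first exact: cvg_cst.
  apply: (mulc); apply: (mulc); apply: cvgD.
    apply: continuous_comp; last exact: continuous_expR.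
    by apply: (mulc); apply: cvgB; [exact: cvg_cst|exact: cvg_id].
  by apply: continuous_comp; last exact: continuous_expR; apply: (mulc); exact: cvg_id.
have FTC := @FTC2_everywhere_derivable R F F' 0 1 ler01 (fun t _ => dF t) iF'.
apply: (@le_trans _ _ (\int[mu]_(t in `[0%R, 1%R]) (F' t)%:E)%E); last first.
  rewrite -[leLHS]fineK; last exact: integrable_fin_num.
  rewrite lee_fin [leLHS]FTC /F subr0 subrr !mulr0 !mulr1 expR0.
  by have := expR_ge0 (- (a / 2)); lra.
apply: ge0_le_integral => //.
- by move=> t _; rewrite lee_fin addr_ge0// mulr_ge0// mulr_ge0// expR_ge0.
- apply/measurable_EFinP; apply: measurable_funD => //; apply: measurable_funM => //.
  apply: measurable_funM => //; apply: measurableT_comp => //; apply: measurableT_comp => //.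
  by apply: measurable_funM => //; apply: measurable_funM => //; exact: measurable_funB.
- by have /integrableP[] := iF'.
move=> t; rewrite /= in_itv/= => /andP[t0 t1]; rewrite lee_fin lerD2l ler_wpM2l// ler_wpM2l//.
have [th|th] := leP t 2^-1.
  apply: (@le_trans _ _ (expR (- (a / 2) * t))); last by rewrite lerDr expR_ge0.
  have : 0 <= a * (t * (2^-1 - t)) by rewrite !mulr_ge0// subr_ge0.
  by rewrite ler_expR mulNr lerN2; nra.
apply: (@le_trans _ _ (expR (- (a / 2) * (1 - t)))); last by rewrite lerDl expR_ge0.
have : 0 <= a * ((1 - t) * (t - 2^-1)) by rewrite !mulr_ge0// subr_ge0// ltW.
by rewrite ler_expR mulNr lerN2; nra.
Qed.

Lemma dot_cVC (R : realType) n (x y : 'cV[R]_n) : (x^T *m y) 0 0 = (y^T *m x) 0 0.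
Proof. by rewrite !mxE; apply: eq_bigr => i _; rewrite !mxE mulrC. Qed.

(* Completing the square: with [s = t^2 + (1-t)^2] the quadratic form
   [|x - t y|^2 + |x + (1-t) y|^2] in [y] is minimal at [b x], [b = -(1-2t)/s],
   and [(1-2t)^2 / s = 2 - 1/s <= 1 - 2 t (1-t)]. *)
Lemma gaussian_exponent_le (R : realType) (S a q w t : R) : 0 <= t <= 1 -> 0 <= a -> 0 <= w ->
  let b := - ((1 - 2 * t) / (t ^+ 2 + (1 - t) ^+ 2)) in
  let z := w + 2 * b * q + b ^+ 2 * a in
  let p := q + b * a in
  (- ((S - 2 * t * p + t ^+ 2 * z) / 2) - (S + 2 * (1 - t) * p + (1 - t) ^+ 2 * z) / 2 <=
   (a / 2 - S) - t * (1 - t) * a - w / 4 : Prop).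
Proof.
move=> /andP[t0 t1] a0 w0 b z p; pose s := t ^+ 2 + (1 - t) ^+ 2.
have sE : s = 1 - 2 * (t * (1 - t)) by rewrite /s; ring.
have s2 : 2^-1 <= s by rewrite sE; have := sqr_ge0 (2 * t - 1); nra.
have s0 : s != 0 by rewrite gt_eqF//; lra.
rewrite (_ : _ - _ = - S - s * w / 2 + a * (1 - s^-1 / 2)); last first.
  by rewrite /z /p /b -/s; move: s0; rewrite /s => s0; field.
have : 1 + 2 * (t * (1 - t)) <= s^-1.
  rewrite -[leRHS]mul1r ler_pdivlMr; last lra.
  by rewrite sE; have := sqr_ge0 (t * (1 - t)); rewrite expr2; lra.
move=> /(ler_wpM2l a0); have := ler_wpM2r w0 s2; nra.
Qed.

Section gaussian_kernel.
Variables (R : realType) (n m : nat) (M : 'M[R]_(n, m)).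
Hypothesis MM : M^T *m M = 1%:M.
Local Notation rho := (@std_normal_density R n).
Local Notation lamz := (lebesgue_cV R m).
Let c : R := Num.sqrt (2 * pi) ^- n.
Let gs (z : 'cV[R]_m) : R := expR (- (sqnorm z / 2)).

Lemma std_normal_density_gt0 p (x : 'cV[R]_p) : 0 < std_normal_density x.
Proof.
by rewrite mulr_gt0 ?expR_gt0// invr_gt0 exprn_gt0// sqrtr_gt0 mulr_gt0 ?pi_gt0.
Qed.

Let rhoE x : rho x = c * expR (- (sqnorm x / 2)).
Proof. by rewrite /std_normal_density mulNr. Qed.

Let c0 : 0 < c.
Proof. by rewrite invr_gt0 exprn_gt0// sqrtr_gt0 mulr_gt0 ?pi_gt0. Qed.

Let mgs : measurable_fun setT (fun z => (gs z)%:E).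
Proof.
apply/measurable_EFinP; apply: measurableT_comp => //; apply: measurableT_comp => //.
by apply: measurable_funM => //; exact: measurable_sqnorm.
Qed.

Let gs0 z : (0 <= (gs z)%:E)%E. Proof. by rewrite lee_fin expR_ge0. Qed.

Let G : R := fine (\int[lamz]_z (gs z)%:E)%E.

Let GE : (\int[lamz]_z (gs z)%:E = G%:E)%E.
Proof.
rewrite fineK// ge0_fin_numE ?gaussian_integral_lty//.
by apply: integral_ge0 => z _.
Qed.

Let G0 : 0 <= G. Proof. by rewrite fine_ge0// integral_ge0. Qed.

Let u x : 'cV[R]_m := M^T *m x.

Let cross (x : 'cV[R]_n) (z : 'cV[R]_m) : (x^T *m (M *m z)) 0 0 = ((u x)^T *m z) 0 0.
Proof. by rewrite /u trmx_mul trmxK mulmxA. Qed.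

(** With [u = M^T x] and [M] an isometry, [|x + M z|^2 = |x|^2 - |u|^2 + |z + u|^2]; translate [z]
    by [u]. The constant [G] is left unevaluated, since it occurs on both sides of the kernel
    bound. *)
Lemma gaussian_slice_integral x :
  (\int[lamz]_z (rho (x + M *m z)%R)%:E =
   (c * expR (- ((sqnorm x - sqnorm (u x)) / 2)) * G)%:E)%E.
Proof.
transitivity (\int[lamz]_z ((c * expR (- ((sqnorm x - sqnorm (u x)) / 2)))%:E *
    (gs (z + u x)%R)%:E))%E.
  apply: eq_integral => z _; rewrite -EFinM; congr EFin.
  rewrite rhoE /gs -mulrA -expRD; congr (_ * expR _).
  have := sqnormDZ x (M *m z) 1; rewrite scale1r => ->.
  have := sqnormDZ z (u x) 1; rewrite scale1r => ->.
  by rewrite cross sqnorm_isometry// (dot_cVC z); field.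
have mg : measurable_fun setT (fun z : 'cV[R]_m => (gs (z + u x)%R)%:E).
  by apply: (measurableT_comp mgs); exact: measurable_cVD.
rewrite ge0_integralZl_EFin//; last by rewrite mulr_ge0 ?expR_ge0// ltW.
by rewrite (ge0_integral_cV_translation (u x) mgs)// GE.
Qed.

Lemma gaussian_slice_mass_fin x : (\int[lamz]_z (rho (x + M *m z)%R)%:E < +oo)%E.
Proof. by rewrite gaussian_slice_integral ltry. Qed.

(** The shift of [z] by [b u x] centres the Gaussian, and [gaussian_exponent_le] leaves
    [e^(-|w|^2 / 4)]. Since [b^2 <= 4], the weight satisfies [|z|^2 <= 2 |w|^2 + 8 |u|^2]. One half
    [e^(-|w|^2 / 8)] of the Gaussian absorbs [|w|^2], as [v e^(-v/8) <= 8], which gives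
    [16 = 2 * 8]; the other half is [gs (w / 2)], kept for the integration. *)
Let kernel_pointwise x t w : 0 <= t <= 1 ->
  let z := w + (- ((1 - 2 * t) / (t ^+ 2 + (1 - t) ^+ 2))) *: u x in
  (sqnorm z * (rho (x - t *: (M *m z)) * rho (x + (1 - t) *: (M *m z))) <=
  c ^+ 2 * expR (sqnorm (u x) / 2 - sqnorm x) *
  (16 + 8 * (sqnorm (u x) * expR (- (t * (1 - t) * sqnorm (u x))))) * gs (2^-1 *: w) : Prop).
Proof.
move=> t01; set b := - _ => z; have /andP[t0 t1] := t01.
set S := sqnorm x; set a := sqnorm (u x); pose v := sqnorm w.
have a0 : 0 <= a := sqnorm_ge0 _.
have v0 : 0 <= v := sqnorm_ge0 _.
pose q := (w^T *m u x) 0 0.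
have qE : ((u x)^T *m w) 0 0 = q by exact: dot_cVC.
have zE : sqnorm z = v + 2 * b * q + b ^+ 2 * a by rewrite /z sqnormDZ.
have pE : (x^T *m (M *m z)) 0 0 = q + b * a.
  by rewrite cross /z mulmxDr -scalemxAr mxE [X in _ + X]mxE qE -sqnormE.
have b4 : b ^+ 2 <= 4.
  have s2 : 2^-1 <= t ^+ 2 + (1 - t) ^+ 2 by have := sqr_ge0 (2 * t - 1); nra.
  rewrite /b sqrrN expr_div_n ler_pdivrMr; last by rewrite exprn_gt0//; lra.
  have : 2^-1 ^+ 2 <= (t ^+ 2 + (1 - t) ^+ 2) ^+ 2 by rewrite lerXn2r ?nnegrE//; lra.
  by rewrite [2^-1 ^+ 2]expr2; nra.
have z2 : sqnorm z <= 2 * v + 8 * a.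
  have := sqnorm_ge0 (w + (- b) *: u x); rewrite sqnormDZ -/v -/q -/a zE sqrrN.
  by have := ler_wpM2r a0 b4; lra.
have e := gaussian_exponent_le S q t01 a0 v0; move: e; rewrite /= -/b -zE -pE => e.
have rr : rho (x - t *: (M *m z)) * rho (x + (1 - t) *: (M *m z)) <=
    c ^+ 2 * (expR (a / 2 - S) * expR (- (t * (1 - t) * a)) * expR (- (v / 4))).
  rewrite -scaleNr !rhoE mulrACA -expr2 ler_wpM2l ?sqr_ge0// -!expRD ler_expR.
  rewrite !sqnormDZ (sqnorm_isometry _ MM) sqrrN -/S.
  by move: e; lra.
have gE : gs (2^-1 *: w) = expR (- (v / 8)).
  by rewrite /gs sqnormZ -/v; congr expR; field.
have e4 : expR (- (v / 4)) = expR (- (v / 8)) * expR (- (v / 8)).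
  by rewrite -expRD; congr expR; field.
have v8 : v * expR (- (v / 8)) <= 8.
  rewrite expRN -ler_pdivlMr ?invr_gt0 ?expR_gt0// invrK.
  by have := expR_ge1Dx (v / 8); lra.
have E1 : expR (- (v / 8)) <= 1 by rewrite -[leRHS]expR0 ler_expR oppr_le0 divr_ge0.
have Q1 : expR (- (t * (1 - t) * a)) <= 1.
  by rewrite -[leRHS]expR0 ler_expR oppr_le0 !mulr_ge0// subr_ge0.
apply: (le_trans (ler_wpM2l (sqnorm_ge0 z) rr)).
rewrite gE e4; move: (expR_ge0 (- (t * (1 - t) * a))) (expR_ge0 (- (v / 8))) Q1 E1 v8.
set Q := expR (- (t * (1 - t) * a)); set E := expR (- (v / 8)) => Q0 E0 Q1 E1 v8.
pose A := c ^+ 2 * expR (a / 2 - S).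
have A0 : 0 <= A by rewrite mulr_ge0 ?sqr_ge0 ?expR_ge0.
rewrite [leLHS](_ : _ = A * E * (sqnorm z * (Q * E))); last by rewrite /A; ring.
rewrite [leRHS](_ : _ = A * E * (16 + 8 * (a * Q))); last by rewrite /A; ring.
rewrite (ler_wpM2l (mulr_ge0 A0 E0))//.
apply: (@le_trans _ _ ((2 * v + 8 * a) * (Q * E))).
  by rewrite ler_wpM2r// mulr_ge0.
have h1 : v * E * Q <= 8 by rewrite (le_trans _ v8)// ler_piMr// mulr_ge0.
have h2 : a * Q * E <= a * Q by rewrite ler_piMr// mulr_ge0.
by move: h1 h2; nra.
Qed.

(** Integrating [gs (w / 2)] gives [2^m G], integrating the weight over [t] gives at most [48], and
    the remaining factor [A G] is exactly [slice_mass x * rho x]. *)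
Lemma gaussian_kernel_le x :
  (\int[@lebesgue_measure R]_(t in `[0%R, 1%R]) \int[lebesgue_cV R m]_z
     (sqnorm z * (rho (x - t *: (M *m z)) * rho (x + (1 - t) *: (M *m z))))%:E <=
   (48 * 2 ^+ m * (slice_mass rho M x * rho x))%:E)%E.
Proof.
set S := sqnorm x; set a := sqnorm (u x).
have a0 : 0 <= a := sqnorm_ge0 _.
pose A := c ^+ 2 * expR (a / 2 - S).
have A0 : 0 <= A by rewrite mulr_ge0 ?sqr_ge0 ?expR_ge0.
pose J (t : R) := 16 + 8 * (a * expR (- (t * (1 - t) * a))).
have J0 t : 0 <= J t by rewrite addr_ge0// mulr_ge0// mulr_ge0// expR_ge0.
have mJ : measurable_fun setT J.
  apply: measurable_funD => //; apply: measurable_funM => //.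
  apply: measurable_funM => //; apply: measurableT_comp => //; apply: measurableT_comp => //.
  by apply: measurable_funM => //; apply: measurable_funM => //; exact: measurable_funB.
have mrho : measurable_fun setT rho.
  apply: (eq_measurable_fun (fun x => c * expR (- (sqnorm x / 2)))) => [y _|]; first by rewrite rhoE.
  apply: measurable_funM => //; apply: measurableT_comp => //; apply: measurableT_comp => //.
  by apply: measurable_funM => //; exact: measurable_sqnorm.
have rho0 y : 0 <= rho y by exact: ltW (std_normal_density_gt0 y).
pose k t z := (sqnorm z * (rho (x - t *: (M *m z)) * rho (x + (1 - t) *: (M *m z))))%:E.
have mk : measurable_fun setT (fun p : measurableTypeR R * 'cV[R]_m => k p.1 p.2).
  have mM : measurable_fun setT (fun p : measurableTypeR R * 'cV[R]_m => M *m p.2).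
    by apply: measurable_cV_mulmx; exact: measurable_snd.
  apply/measurable_EFinP; apply: measurable_funM.
    by apply: measurable_sqnorm; exact: measurable_snd.
  apply: measurable_funM; apply: (measurableT_comp mrho); apply: measurable_cVD => //.
    by apply: measurable_cVN; apply: measurable_cVZ => //; exact: measurable_fst.
  by apply: measurable_cVZ => //; apply: measurable_funB => //; exact: measurable_fst.
have k0 t z : (0 <= k t z)%E.
  by rewrite lee_fin mulr_ge0 ?sqnorm_ge0// mulr_ge0.
have mI := @measurable_integral_snd _ _ _ _ _ (lebesgue_cV R m)
  (fun (t : measurableTypeR R) z => k t z) mk k0.
have G2 : (\int[lamz]_w (gs (2^-1 *: w))%:E = (2 ^+ m * G)%:E)%E.
  have h0 : 2^-1 != 0 :> R by [].
  by rewrite (ge0_integral_cV_scale h0 mgs gs0) GE ger0_norm// invrK.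
have inner t : 0 <= t <= 1 -> (\int[lamz]_z k t z <= (A * 2 ^+ m * G)%:E * (J t)%:E)%E.
  move=> t01; pose b := - ((1 - 2 * t) / (t ^+ 2 + (1 - t) ^+ 2)).
  have mkt : measurable_fun setT (k t).
    have mp : measurable_fun setT (fun z : 'cV[R]_m => (t : measurableTypeR R, z)).
      exact: measurable_fun_pair.
    exact: (measurableT_comp mk mp).
  rewrite -(ge0_integral_cV_translation (b *: u x) mkt (k0 t)).
  have mg2 : measurable_fun setT (fun w : 'cV[R]_m => (gs (2^-1 *: w))%:E).
    by apply: (measurableT_comp mgs); apply: measurable_cVZ.
  apply: (@le_trans _ _ (\int[lamz]_w ((A * J t)%:E * (gs (2^-1 *: w))%:E))%E).
    apply: ge0_le_integral => //.
    - by apply: (measurableT_comp mkt); exact: measurable_cVD.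
    - exact: measurable_funeM.
    - by move=> w _; rewrite -EFinM lee_fin; exact: kernel_pointwise.
  rewrite ge0_integralZl_EFin//; last by rewrite mulr_ge0.
  rewrite G2 -!EFinM lee_fin le_eqVlt; apply/orP; left; apply/eqP; by ring.
apply: (@le_trans _ _ (\int[@lebesgue_measure R]_(t in `[0%R, 1%R])
    ((A * 2 ^+ m * G)%:E * (J t)%:E))%E).
  apply: ge0_le_integral => //.
  - by move=> t _; apply: integral_ge0 => z _; exact: k0.
  - exact: measurable_funTS mI.
  - by apply: measurable_funeM; apply/measurable_EFinP; exact: measurable_funTS.
have AG : 0 <= A * 2 ^+ m * G by rewrite mulr_ge0// mulr_ge0// exprn_ge0.
rewrite ge0_integralZl_EFin//; last 2 first.
- by move=> t _; rewrite lee_fin.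
- by apply/measurable_EFinP; exact: measurable_funTS.
have AGE : (0 <= (A * 2 ^+ m * G)%:E)%E by rewrite lee_fin.
apply: (le_trans (lee_wpmul2l AGE (integral_gaussian_weight_le a0))).
rewrite -EFinM lee_fin /slice_mass /Rintegral gaussian_slice_integral /= rhoE -/S -/a.
rewrite le_eqVlt; apply/orP; left; apply/eqP.
rewrite (_ : A = c * expR (- ((S - a) / 2)) * (c * expR (- (S / 2)))); first by ring.
rewrite mulrACA -expr2 -expRD /A; congr (_ * expR _); by field.
Qed.

End gaussian_kernel.

(** * The inactive gradient and the last eigenvalues *)

Section gradient_spectrum.
Variables (R : realType) (k m : nat).
Variables (rho f : 'cV[R]_(k + m) -> R).
Let lam := lebesgue_cV R (k + m).
Let D := dsupp rho.
Hypotheses (rho0 : forall x, 0 <= rho x) (oD : open D) (mrho : measurable_fun setT rho)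
  (mf : measurable_fun D f)
  (df : forall x (i : 'I_(k + m)), D x -> derivable f x (delta_mx i 0))
  (gf : forall i, lam.-integrable D (fun x => (grad f x i 0 ^+ 2 * rho x)%:E)).

Let mD : measurable D. Proof. exact: open_measurable_cV. Qed.

Lemma integrable_grad_prod i j :
  lam.-integrable D (fun x => (grad f x i 0 * grad f x j 0 * rho x)%:E).
Proof.
apply: (le_integrable mD _ _ (integrableD mD (gf i) (gf j))).
  apply/measurable_EFinP; apply: measurable_funM; last exact: measurable_funTS.
  by apply: measurable_funM; exact: measurable_grad.
move=> x _; rewrite -EFinD !abse_EFin lee_fin -mulrDl !normrM ler_wpM2r//.
rewrite -normrM [leRHS]ger0_norm ?addr_ge0 ?sqr_ge0//.
set a := grad f x i 0; set b := grad f x j 0.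
rewrite ler_norml; move: (sqr_ge0 (a + b)) (sqr_ge0 (a - b)) (sqr_ge0 a) (sqr_ge0 b).
by rewrite sqrrD sqrrB; lra.
Qed.

(** [lambda_(k+i)] is the diagonal entry of [W^T C W], that is the quadratic form of [grad_outer] at
    the [i]-th column of [W2], which is the integral of the squared derivative along that column.
    The products of partial derivatives are integrable, so sums and integral commute. *)
Lemma integral_sqgrad_spectrum (W : 'M[R]_(k + m)) (lambda : 'rV[R]_(k + m)) :
  W^T *m W = 1%:M -> grad_outer rho f = W *m diag_mx lambda *m W^T ->
  (\int[lam]_x (sqgrad rho f (rsubmx W) x * rho x)%:E =
   (\sum_(i < m) lambda 0 (rshift k i))%:E)%E.
Proof.
move=> WW CE; set W2 := rsubmx W.
have lamE i : lambda 0 (rshift k i) =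
    \sum_a \sum_b W2 a i * W2 b i * grad_outer rho f a b.
  have : (W^T *m grad_outer rho f *m W) (rshift k i) (rshift k i) = lambda 0 (rshift k i).
    by rewrite CE !mulmxA WW mul1mx -mulmxA WW mulmx1 mxE eqxx mulr1n.
  move=> <-; rewrite mxE.
  under eq_bigr => b _ do rewrite mxE mulr_suml.
  rewrite exchange_big/=; apply: eq_bigr => a _; apply: eq_bigr => b _.
  by rewrite !mxE; ring.
have gE a b : ((grad_outer rho f a b)%:E =
    \int[lam]_(x in D) (grad f x a 0 * grad f x b 0 * rho x)%:E)%E.
  rewrite mxE /Rintegral fineK; last first.
    apply: integrable_fin_num => //; move: (integrable_grad_prod a b).
    by apply: eq_integrable => // x _; rewrite [(_ *m _) a b]mxE big_ord1 [_^T 0 b]mxE.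
  by apply: eq_integral => x _; rewrite [(_ *m _) a b]mxE big_ord1 [_^T 0 b]mxE.
transitivity (\int[lam]_(x in D) (\sum_(i < m) \sum_a \sum_b
    (W2 a i * W2 b i)%:E * (grad f x a 0 * grad f x b 0 * rho x)%:E))%E.
  rewrite [RHS]integral_mkcond; apply: eq_integral => x _.
  rewrite patchE /sqgrad indicE -/D; case: (x \in D); last by rewrite !mul0r.
  rewrite mul1r /sqnorm mulr_suml -sumEFin; apply: eq_bigr => i _.
  rewrite mxE expr2 mulr_suml mulr_suml -sumEFin; apply: eq_bigr => a _.
  rewrite mulr_sumr mulr_suml -sumEFin; apply: eq_bigr => b _.
  by rewrite -EFinM; congr EFin; rewrite !mxE; ring.
have iW i a b : lam.-integrable D
    (fun x => (W2 a i * W2 b i)%:E * (grad f x a 0 * grad f x b 0 * rho x)%:E)%E.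
  by apply: integrableZl => //; exact: integrable_grad_prod.
have iWb i a : lam.-integrable D (fun x => \sum_b
    (W2 a i * W2 b i)%:E * (grad f x a 0 * grad f x b 0 * rho x)%:E)%E.
  by apply: integrable_sum => // b _.
have iWa i : lam.-integrable D (fun x => \sum_a \sum_b
    (W2 a i * W2 b i)%:E * (grad f x a 0 * grad f x b 0 * rho x)%:E)%E.
  by apply: integrable_sum => // b _.
rewrite integral_sum// -sumEFin; apply: eq_bigr => i _.
rewrite integral_sum// lamE -sumEFin; apply: eq_bigr => a _.
rewrite integral_sum// -sumEFin; apply: eq_bigr => b _.
by rewrite integralZl// ?integrable_grad_prod// -gE -EFinM.
Qed.

End gradient_spectrum.

(** * Monte Carlo error *)

Section density_change_of_variables.
Context d d' (Omega : measurableType d) (T : measurableType d') (R : realType).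
Variables (P : {sigma_finite_measure set Omega -> \bar R})
  (lam : {sigma_finite_measure set T -> \bar R}).
Variables (Y : Omega -> T) (q : T -> R).
Hypotheses (mY : measurable_fun setT Y) (mq : measurable_fun setT q)
  (q0 : forall y, 0 <= q y)
  (lawY : forall B, measurable B -> P (Y @^-1` B) = (\int[lam]_(y in B) (q y)%:E)%E).

(* Layer cake: [H y] is the length of the set of [t >= 0] below [H y]. *)
Lemma ge0_integral_density (H : T -> R) : measurable_fun setT H -> (forall y, 0 <= H y) ->
  (\int[P]_w (H (Y w))%:E = \int[lam]_y (H y * q y)%:E)%E.
Proof.
move=> mH H0; pose leb := @lebesgue_measure R.
pose I (y : T) (t : R) : R := \1_(`[0, +oo[%classic) t * ((t < H y)%R : nat)%:R.
have I0 y t : 0 <= I y t by rewrite mulr_ge0.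
have HE y : ((H y)%:E = \int[leb]_t (I y t)%:E)%E.
  rewrite (_ : (fun t => (I y t)%:E) = (fun t => (\1_(`[0%R, H y[%classic : set R) t)%:E)); last first.
    apply/funext => t; rewrite /I !indicE -natrM mulnb; congr ((_ : bool)%:R%:E).
    apply/idP/idP; rewrite !inE/= !in_itv/= ?andbT.
      by move=> /andP[/set_mem]; rewrite /= in_itv/= andbT => -> ->.
    by move=> /andP[t0 ->]; rewrite andbT mem_set//= in_itv/= andbT.
  have lH : lebesgue_measure (`[0, H y[%classic : set R) = (H y)%:E.
    rewrite lebesgue_measure_itv/= lte_fin; case: ltP => Hy; first by rewrite oppr0 adde0.
    by congr EFin; apply/eqP; rewrite eq_le H0 Hy.
  by rewrite integral_indic// setIT; exact: esym lH.
have mI d1 (S : measurableType d1) (y : S -> T) (t : S -> R) :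
    measurable_fun setT y -> measurable_fun setT t ->
    measurable_fun setT (fun p => (I (y p) (t p))%:E).
  move=> my mt; apply/measurable_EFinP; apply: measurable_funM.
    exact: measurableT_comp (measurable_indic _) mt.
  have mb : measurable_fun setT (fun p => (t p < H (y p))%R).
    by apply: measurable_fun_ltr => //; exact: measurableT_comp mH my.
  rewrite (_ : (fun p => _) = (fun p => if (t p < H (y p))%R then 1 else 0)); last first.
    by apply/funext => p; case: (_ < _).
  exact: measurable_fun_ifT.
under eq_integral => w _ do rewrite HE.
have m1 : measurable_fun setT (fun p : Omega * measurableTypeR R => (I (Y p.1) p.2)%:E).
  by apply: mI => //; exact: measurableT_comp mY measurable_fst.
rewrite (@ge0_integral_swap _ _ _ _ _ P leb (fun w (t : measurableTypeR R) => (I (Y w) t)%:E) m1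
  (fun w t => I0 _ _)).
have m2 : measurable_fun setT (fun p : T * measurableTypeR R => (I p.1 p.2 * q p.1)%:E).
  apply/measurable_EFinP; apply: measurable_funM.
    by apply/measurable_EFinP; exact: mI.
  exact: measurableT_comp mq measurable_fst.
have Iq0 y t : (0 <= (I y t * q y)%:E)%E by rewrite lee_fin mulr_ge0.
transitivity (\int[lam]_y \int[leb]_t (I y t * q y)%:E)%E; last first.
  apply: eq_integral => y _; rewrite EFinM HE -ge0_integralZr//.
  - exact: mI.
  - by move=> t _; rewrite lee_fin.
  - by rewrite lee_fin.
rewrite (@ge0_integral_swap _ _ _ _ _ lam leb (fun y (t : measurableTypeR R) => (I y t * q y)%:E) m2 Iq0).
apply: eq_integral => t _.
pose B := [set y | (t < H y)%R].
have mB : measurable B.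
  have := mH measurableT _ (measurable_itv `]t, +oo[); rewrite setTI.
  by congr (measurable _); apply/seteqP; split => y /=; rewrite /B/= in_itv/= andbT.
have IB y : I y t = \1_(`[0, +oo[%classic) t * \1_B y.
  congr (_ * _); rewrite indicE; congr ((_ : bool)%:R).
  by apply/idP/idP; rewrite inE.
have mYB : measurable (Y @^-1` B) by rewrite -[X in measurable X]setTI; exact: mY.
transitivity ((\1_(`[0, +oo[%classic) t)%:E * P (Y @^-1` B))%E.
  have -> : P (Y @^-1` B) = (\int[P]_w (\1_(Y @^-1` B) w)%:E)%E.
    by rewrite integral_indic// setIT.
  rewrite -ge0_integralZl_EFin//; last exact/measurable_EFinP/measurable_indic.
  by apply: eq_integral => w _; rewrite IB EFinM.
rewrite lawY// integral_mkcond -ge0_integralZl_EFin//; last 2 first.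
- by move=> y _; rewrite patchE; case: ifP => // _; rewrite lee_fin.
- by apply: measurable_patchT => //; exact/measurable_EFinP.
apply: eq_integral => y _; rewrite IB patchE [\1_B y]indicE.
by case: (y \in B); rewrite ?mulr1 ?mulr0 ?mul0r ?mule0// EFinM.
Qed.

End density_change_of_variables.

Section iid_mean_square_error.
Context d d' (Omega : measurableType d) (T : measurableType d') (R : realType).
Variables (P : probability Omega R) (lam : {sigma_finite_measure set T -> \bar R}).
Variables (N : nat) (Y : 'I_N -> Omega -> T) (q phi : T -> R) (g : R).
Hypotheses (N0 : (0 < N)%N) (mq : measurable_fun setT q) (q0 : forall y, 0 <= q y)
  (mphi : measurable_fun setT phi)
  (iphi : lam.-integrable setT (fun y => (phi y * q y)%:E))
  (gE : \int[lam]_y (phi y * q y) = g)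
  (iidY : iid_law P Y (fun B => \int[lam]_(y in B) (q y)%:E)%E).

Let mY j : measurable_fun setT (Y j). Proof. by have [] := iidY. Qed.

Let psi j w := phi (Y j w) - g.

Let mpsi j : measurable_fun setT (psi j).
Proof. by apply: measurable_funB => //; exact: measurableT_comp mphi (mY j). Qed.

Let law j (H : T -> R) : measurable_fun setT H -> (forall y, 0 <= H y) ->
  (\int[P]_w (H (Y j w))%:E = \int[lam]_y (H y * q y)%:E)%E.
Proof.
by have [_ _ lawY] := iidY; apply: ge0_integral_density => // B mB; exact: lawY.
Qed.

(** The total mass is read off from the law of one sample, which exists because [N > 0]. *)
Let q1 : (\int[lam]_y (q y)%:E = 1)%E.
Proof.
have [_ _ /(_ (Ordinal N0) _ measurableT)] := iidY.
by rewrite preimage_setT probability_setT.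
Qed.

Let iq : lam.-integrable setT (fun y => (q y)%:E).
Proof.
apply/integrableP; split; first exact/measurable_EFinP.
rewrite (eq_integral (fun x => (q x)%:E)) ?q1 ?ltry//.
by move=> y _; rewrite gee0_abs// lee_fin.
Qed.

Let icenter : lam.-integrable setT (fun y => ((phi y - g) * q y)%:E).
Proof.
have -> : (fun y => ((phi y - g) * q y)%:E) =
    (fun y => ((phi y * q y)%:E - g%:E * (q y)%:E)%E).
  by apply/funext => y; rewrite -EFinM -EFinB mulrBl.
by apply: integrableB => //; exact: integrableZl.
Qed.

Let center0 : \int[lam]_y ((phi y - g) * q y) = 0.
Proof.
under eq_Rintegral => y _ do rewrite mulrBl.
rewrite RintegralB//; last exact: (integrableZl measurableT g iq).
rewrite RintegralZl// gE [X in g - g * X](_ : _ = 1) ?mulr1 ?subrr//.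
by rewrite /Rintegral q1.
Qed.

Let ipsi j : P.-integrable setT (EFin \o psi j).
Proof.
apply/integrableP; split; first exact/measurable_EFinP.
rewrite (law j (H := fun y => `|phi y - g|))//; last first.
  by apply: measurableT_comp => //; exact: measurable_funB.
have /integrableP[_] := icenter; apply: le_lt_trans.
by rewrite le_eqVlt; apply/orP; left; apply/eqP; apply: eq_integral => y _;
  rewrite abse_EFin normrM (ger0_norm (q0 y)).
Qed.

(** The transfer [law] is for nonnegative functions; it is applied to the positive and negative
    parts separately, and multiplication by [q >= 0] commutes with taking these parts. *)
Let mean_psi j : (\int[P]_w (psi j w)%:E = 0)%E.
Proof.
rewrite integralE.
have mcenter : measurable_fun setT (fun y => phi y - g) by exact: measurable_funB.
have -> : (\int[P]_w (fun w => (psi j w)%:E)^\+ w =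
    \int[lam]_y (fun y => ((phi y - g) * q y)%:E)^\+ y)%E.
  transitivity (\int[P]_w (Num.max (phi (Y j w) - g) 0)%:E)%E.
    by apply: eq_integral => w _; rewrite funeposE EFin_max.
  rewrite (law j (H := fun y => Num.max (phi y - g) 0)); last 2 first.
  - exact: measurable_maxr.
  - by move=> y; rewrite le_max lexx orbT.
  apply: eq_integral => y _; rewrite funeposE -EFin_max; congr EFin.
  by rewrite maxr_pMl// mul0r.
have -> : (\int[P]_w (fun w => (psi j w)%:E)^\- w =
    \int[lam]_y (fun y => ((phi y - g) * q y)%:E)^\- y)%E.
  transitivity (\int[P]_w (Num.max (- (phi (Y j w) - g)) 0)%:E)%E.
    by apply: eq_integral => w _; rewrite funenegE EFin_max.
  rewrite (law j (H := fun y => Num.max (- (phi y - g)) 0)); last 2 first.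
  - by apply: measurable_maxr => //; exact: measurableT_comp.
  - by move=> y; rewrite le_max lexx orbT.
  apply: eq_integral => y _; rewrite funenegE -EFinN -EFin_max; congr EFin.
  by rewrite maxr_pMl// mul0r mulNr.
rewrite -integralE -[LHS]fineK; last exact: integrable_fin_num icenter.
by congr EFin; exact: center0.
Qed.

Let indep i j (A B : set T) : i != j -> measurable A -> measurable B ->
  P ((Y i @^-1` A) `&` (Y j @^-1` B)) = (P (Y i @^-1` A) * P (Y j @^-1` B))%E.
Proof.
move=> ij mA mB; have [_ ind _] := iidY.
pose C l := if l == i then A else if l == j then B else setT.
have mC l : measurable (C l) by rewrite /C; case: ifP => // _; case: ifP.
have := ind [set i; j]%SET C mC.
rewrite big_setU1 ?inE//= big_set1 /C eqxx eq_sym (negbTE ij) eqxx => <-.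
congr (P _); apply/seteqP; split => w /=.
  move=> [wA wB] l /=; rewrite !inE => /orP[/eqP ->|/eqP ->].
    by rewrite eqxx.
  by rewrite eq_sym (negbTE ij) eqxx.
move=> H; split.
  by have := H i; rewrite /= !inE !eqxx; apply.
by have := H j; rewrite /= !inE eqxx orbT eq_sym (negbTE ij); apply.
Qed.

Hypothesis Vfin : (\int[lam]_y ((phi y - g) ^+ 2 * q y)%:E < +oo)%E.

Let square_psi j : (\int[P]_w (psi j w ^+ 2)%:E =
  \int[lam]_y ((phi y - g) ^+ 2 * q y)%:E)%E.
Proof.
apply: (law j (H := fun y => (phi y - g) ^+ 2)).
  by apply: measurable_funX; exact: measurable_funB.
by move=> y; exact: sqr_ge0.
Qed.

Let isquare_psi j : P.-integrable setT (fun w => (psi j w ^+ 2)%:E).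
Proof.
apply/integrableP; split; first by apply/measurable_EFinP; exact: measurable_funX.
rewrite (eq_integral (fun w => (psi j w ^+ 2)%:E)) ?square_psi//.
by move=> w _; rewrite gee0_abs// lee_fin sqr_ge0.
Qed.

Let iprod_psi i j : P.-integrable setT (fun w => (psi i w * psi j w)%:E).
Proof.
apply: (le_integrable measurableT _ _ (integrableD measurableT (isquare_psi i) (isquare_psi j))).
  by apply/measurable_EFinP; exact: measurable_funM.
move=> w _; rewrite -EFinD !abse_EFin lee_fin [leRHS]ger0_norm ?addr_ge0 ?sqr_ge0//.
move: (psi i w) (psi j w) => a b.
rewrite ler_norml; move: (sqr_ge0 (a + b)) (sqr_ge0 (a - b)) (sqr_ge0 a) (sqr_ge0 b).
by rewrite sqrrD sqrrB; lra.
Qed.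

(** By independence the joint law of [Y i] and [Y j] agrees with the product [Q i \x Q j] on
    rectangles, hence everywhere. Fubini then applies, and the inner integral is the mean of
    [psi j], which is 0. *)
Let cross_psi i j : i != j -> (\int[P]_w (psi i w * psi j w)%:E = 0)%E.
Proof.
move=> ij.
pose Yi l : {mfun Omega >-> T} := HB.pack (Y l) (isMeasurableFun.Build _ _ _ _ _ (mY l)).
pose Q l : probability T R := distribution P (Yi l).
have mYY : measurable_fun setT (fun w => (Y i w, Y j w)) by exact: measurable_fun_pair.
pose F (p : T * T) := ((phi p.1 - g) * (phi p.2 - g))%:E.
have mF : measurable_fun setT F.
  apply/measurable_EFinP; apply: measurable_funM; apply: measurable_funB => //.
    exact: measurableT_comp mphi measurable_fst.
  exact: measurableT_comp mphi measurable_snd.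
have PE B C : measurable B -> measurable C ->
    pushforward P (fun w => (Y i w, Y j w)) (B `*` C) = (Q i B * Q j C)%E.
  by move=> mB mC; exact: indep.
have QQ (A : set (T * T)) : measurable A -> (Q i \x Q j)%E A = pushforward P (fun w => (Y i w, Y j w)) A.
  exact: (@product_measure_unique _ _ _ _ _ (Q i) (Q j)
    (measure_function_pushforward__canonical__measure_function_Measure P mYY) PE).
have iF : (pushforward P (fun w => (Y i w, Y j w))).-integrable setT F.
  by apply: (integrable_pushforward mYY mF) => //; rewrite preimage_setT; exact: iprod_psi.
have iQ : (Q i \x Q j)%E.-integrable setT F.
  apply/integrableP; split => //.
  rewrite (eq_measure_integral (pushforward P (fun w => (Y i w, Y j w)))); last first.
    by move=> A mA _; exact: QQ.
  by have /integrableP[] := iF.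
transitivity (\int[pushforward P (fun w => (Y i w, Y j w))]_p F p)%E.
  rewrite (integral_pushforward mYY mF)//; last by rewrite preimage_setT; exact: iprod_psi.
transitivity (\int[(Q i \x Q j)%E]_p F p)%E.
  by apply: eq_measure_integral => A mA _; exact: (esym (QQ A mA)).
rewrite -(fubini1 iQ) integral0_eq// => y _; rewrite /fubini_F /F /=.
have iQj : (Q j).-integrable setT (fun z => (phi z - g)%:E).
  apply: (integrable_pushforward (mY j)) => //; last by rewrite preimage_setT; exact: ipsi.
  by apply/measurable_EFinP; exact: measurable_funB.
under eq_integral => z _ do rewrite EFinM.
rewrite integralZl// (integral_pushforward (mY j))//; last 2 first.
- by apply/measurable_EFinP; exact: measurable_funB.
- by rewrite preimage_setT; exact: ipsi.
by rewrite preimage_setT [X in (_ * X)%E](mean_psi j) mule0.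
Qed.

(** Expanding the square, the off-diagonal terms vanish by [cross_psi] and the [N] diagonal ones
    each contribute [N^-2] times the variance. *)
Lemma iid_mean_square_error_fin :
  (\int[P]_w ((g - N%:R^-1 * \sum_(j < N) phi (Y j w)) ^+ 2)%:E =
   N%:R^-1%:E * \int[lam]_y ((phi y - g) ^+ 2 * q y)%:E)%E.
Proof.
have Nr : N%:R != 0 :> R by rewrite pnatr_eq0 -lt0n.
transitivity (\int[P]_w \sum_(i < N) \sum_(j < N)
    ((N%:R^-1 ^+ 2)%:E * (psi i w * psi j w)%:E))%E.
  apply: eq_integral => w _.
  have -> : (g - N%:R^-1 * \sum_(j < N) phi (Y j w)) ^+ 2 =
      \sum_(i < N) \sum_(j < N) (N%:R^-1 ^+ 2 * (psi i w * psi j w)).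
    rewrite [RHS](eq_bigr (fun i => N%:R^-1 ^+ 2 * (psi i w * \sum_(j < N) psi j w))); last first.
      by move=> i _; rewrite -!mulr_sumr.
    rewrite -mulr_sumr -mulr_suml -expr2 -exprMn -sqrrN; congr (_ ^+ 2).
    rewrite /psi sumrB opprB mulrBr; congr (_ - _).
    by rewrite sumr_const card_ord -[g *+ N]mulr_natl mulKf.
  rewrite -sumEFin; apply: eq_bigr => i _; rewrite -sumEFin.
  by apply: eq_bigr => j _; rewrite EFinM.
have iprodZ i j : P.-integrable setT
    (fun w => (N%:R^-1 ^+ 2)%:E * (psi i w * psi j w)%:E)%E.
  exact: integrableZl.
rewrite integral_sum//; last by move=> i; apply: integrable_sum.
rewrite (eq_bigr (fun _ => ((N%:R^-1 ^+ 2)%:E *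
    \int[lam]_y ((phi y - g) ^+ 2 * q y)%:E)%E)); last first.
  move=> i _; rewrite integral_sum// (bigD1 i)//= big1 ?adde0; last first.
    by move=> j ji; rewrite integralZl// cross_psi ?mule0// eq_sym.
  by rewrite integralZl// square_psi.
have /fineK <- : (\int[lam]_y ((phi y - g) ^+ 2 * q y)%:E \is a fin_num)%E.
  rewrite ge0_fin_numE//; apply: integral_ge0 => y _.
  by rewrite lee_fin mulr_ge0// sqr_ge0.
rewrite (eq_bigr (fun _ => (N%:R^-1 ^+ 2 *
  fine (\int[lam]_y ((phi y - g) ^+ 2 * q y)%:E))%:E)) => [|i _]; last by rewrite EFinM.
rewrite sumEFin sumr_const card_ord -EFinM; congr EFin.
move: (fine _) => V; rewrite -[_ * V *+ N]mulr_natl expr2 mulrA.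
by rewrite [N%:R * _]mulrA divff// mul1r.
Qed.

End iid_mean_square_error.

(** For an infinite variance the right side is infinite, as [N^-1 > 0]; hence an inequality, valid
    without any moment condition on [phi]. *)
Lemma iid_mean_square_error d d' (Omega : measurableType d) (T : measurableType d')
  (R : realType) (P : probability Omega R) (lam : {sigma_finite_measure set T -> \bar R})
  (N : nat) (Y : 'I_N -> Omega -> T) (q phi : T -> R) (g : R) :
  (0 < N)%N -> measurable_fun setT q -> (forall y, 0 <= q y) -> measurable_fun setT phi ->
  lam.-integrable setT (fun y => (phi y * q y)%:E) ->
  \int[lam]_y (phi y * q y) = g ->
  iid_law P Y (fun B => \int[lam]_(y in B) (q y)%:E)%E ->
  (\int[P]_w ((g - N%:R^-1 * \sum_(j < N) phi (Y j w)) ^+ 2)%:E <=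
   N%:R^-1%:E * \int[lam]_y ((phi y - g) ^+ 2 * q y)%:E)%E.
Proof.
move=> N0 mq q0 mphi iphi gE iidY.
have [->|Vfin] := eqVneq (\int[lam]_y ((phi y - g) ^+ 2 * q y)%:E)%E +oo%E.
  by rewrite gt0_muley ?leey// lte_fin invr_gt0 ltr0n.
by rewrite (iid_mean_square_error_fin N0 mq q0 mphi iphi gE iidY)// ltey.
Qed.

Lemma integral_cV_translation (R : realType) n (a : 'cV[R]_n) (h : 'cV[R]_n -> \bar R) :
  measurable_fun setT h ->
  (\int[lebesgue_cV R n]_x h (x + a)%R = \int[lebesgue_cV R n]_x h x)%E.
Proof.
move=> mh; rewrite integralE [RHS]integralE; congr (_ - _)%E.
- rewrite -(ge0_integral_cV_translation a (measurable_funepos mh) (funepos_ge0 h)).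
  apply: eq_integral => x _.
  exact: (congr1 (fun g => g x) (funepos_comp h (fun x => x + a))).
- rewrite -(ge0_integral_cV_translation a (measurable_funeneg mh) (funeneg_ge0 h)).
  apply: eq_integral => x _.
  exact: (congr1 (fun g => g x) (funeneg_comp h (fun x => x + a))).
Qed.

Lemma integrable_cV_translation (R : realType) n (a : 'cV[R]_n) (h : 'cV[R]_n -> \bar R) :
  (lebesgue_cV R n).-integrable setT h ->
  (lebesgue_cV R n).-integrable setT (fun x => h (x + a)%R).
Proof.
move=> /integrableP[mh ih]; apply/integrableP; split.
  apply: (measurableT_comp mh); exact: measurable_cVD.
have mah : measurable_fun setT (abse \o h) by exact: measurableT_comp.
by rewrite (ge0_integral_cV_translation a mah)// => x; exact: abse_ge0.
Qed.

Lemma mulmx_small (R : realType) n m (M : 'M[R]_(n, m)) (e : R) : 0 < e ->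
  exists2 r, 0 < r & forall z : 'cV[R]_m, (forall i, `|z i 0| <= r) -> `|M *m z| < e.
Proof.
move=> e0; pose K := 1 + \sum_(i < n) \sum_(j < m) `|M i j|.
have S0 : 0 <= \sum_(i < n) \sum_(j < m) `|M i j|.
  by apply: sumr_ge0 => i _; exact: sumr_ge0.
have K0 : 0 < K by rewrite /K; lra.
exists (e / (2 * K)); first by rewrite divr_gt0// mulr_gt0.
move=> z zr; rewrite {1}/Num.norm/= mx_normrE.
apply/bigmax_ltP; split => //= -[i j] _ /=; rewrite ord1 mxE.
have : \sum_l `|M i l| <= K.
  rewrite /K [X in 1 + X](bigD1 i)//= addrCA lerDl addr_ge0//.
  by apply: sumr_ge0 => i' _; exact: sumr_ge0.
move=> SK; apply: (le_lt_trans (ler_norm_sum _ _ _)).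
apply: (@le_lt_trans _ _ (\sum_l `|M i l| * (e / (2 * K)))).
  by apply: ler_sum => l _; rewrite normrM ler_wpM2l.
rewrite -mulr_suml (@le_lt_trans _ _ (K * (e / (2 * K))))//.
  by rewrite ler_wpM2r// divr_ge0 ?ltW// mulr_gt0.
rewrite (_ : K * (e / (2 * K)) = e / 2); first lra.
by field; rewrite gt_eqF.
Qed.

(** * Slices of the density and active coordinates *)

Section slices.
Variables (R : realType) (n m : nat) (rho f : 'cV[R]_n -> R) (M : 'M[R]_(n, m)).
Hypotheses (rho0 : forall x, 0 <= rho x) (oD : open (dsupp rho))
  (mrho : measurable_fun setT rho).

Lemma mul_density_restrict x : f x * rho x = (f \_ (dsupp rho)) x * rho x.
Proof.
rewrite patchE; case: ifPn => // /negP xD.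
have -> : rho x = 0; last by rewrite !mulr0.
apply/eqP; rewrite eq_le rho0 andbT leNgt; apply/negP => rx.
by apply: xD; rewrite inE.
Qed.

(** The support is open, so a whole cube of [z] keeps [x + M z] in it, within a bounded region where
    [rho] is at least [c > 0]. *)
Lemma slice_mass_gt0 :
  (forall r : R, exists2 c, 0 < c &
     forall x, dsupp rho x -> (forall i, `|x i 0| < r) -> c <= rho x) ->
  (forall x, (\int[lebesgue_cV R m]_z (rho (x + M *m z)%R)%:E < +oo)%E) ->
  forall x, dsupp rho x -> 0 < slice_mass rho M x.
Proof.
move=> rho_lb mass_fin x Dx.
have /nbhs_ballP[e /= e0 xeD] := oD Dx.
have [r r0 Mr] := mulmx_small M e0.
have [c c0 crho] := rho_lb (`|x| + e).
rewrite -lte_fin slice_massE//.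
pose B := [set z : 'cV[R]_m | forall i, `[- r, r]%classic (z i 0)].
have mB : measurable B by exact: measurable_cV_symbox.
apply: (@lt_le_trans _ _ (\int[lebesgue_cV R m]_(z in B) c%:E)%E).
  rewrite integral_cst// mule_gt0 ?lte_fin//.
  rewrite [ltRHS](_ : _ = ((2 * r) ^+ m)%:E); first by rewrite lte_fin exprn_gt0// mulr_gt0.
  exact: lebesgue_cV_symbox (ltW r0).
have mrM : measurable_fun setT (fun z => (rho (x + M *m z)%R)%:E).
  apply/measurable_EFinP; apply: measurableT_comp mrho _.
  by apply: measurable_cVD => //; exact: measurable_cV_mulmx.
apply: (@le_trans _ _ (\int[lebesgue_cV R m]_(z in B) (rho (x + M *m z)%R)%:E)%E); last first.
  by apply: ge0_subset_integral => // z _; rewrite lee_fin.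
apply: ge0_le_integral => //.
- by move=> z _; rewrite lee_fin ltW.
- exact: measurable_funTS.
- move=> z Bz; rewrite lee_fin.
  have Mze : `|M *m z| < e.
    by apply: Mr => i; have := Bz i; rewrite /= in_itv/= ler_norml.
  apply: crho.
    by apply: xeD; rewrite -ball_normE /ball_/= opprD addrA subrr sub0r normrN.
  move=> i; apply: (@le_lt_trans _ _ `|x + M *m z|); last first.
    by rewrite (le_lt_trans (ler_normD _ _))// ltrD2l.
  rewrite {2}/Num.norm/= mx_normrE.
  exact: (le_bigmax _ (fun ij : 'I_n * 'I_1 => `|(x + M *m z) ij.1 ij.2|) (i, 0)).
Qed.

Let mslice (x : 'cV[R]_n) (c : R) : measurable_fun (dsupp rho) f ->
  measurable_fun setT (fun z => (f (x + M *m z) * (rho (x + M *m z) / c))%:E).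
Proof.
move=> mf.
have mD : measurable (dsupp rho) by exact: open_measurable_cV.
have mx : measurable_fun setT (fun z => x + M *m z).
  by apply: measurable_cVD => //; exact: measurable_cV_mulmx.
under eq_fun do rewrite mulrA mul_density_restrict -mulrA.
apply/measurable_EFinP; apply: measurable_funM.
  apply: measurableT_comp mx; exact/(measurable_restrictT _ mD).
by apply: measurable_funM => //; exact: measurableT_comp mrho mx.
Qed.

Lemma slice_mean_shift : measurable_fun (dsupp rho) f ->
  forall x z, slice_mean rho f M (x + M *m z) = slice_mean rho f M x.
Proof.
move=> mf x z; rewrite /slice_mean slice_mass_shift//; congr fine.
under eq_integral => z' _ do rewrite -addrA -mulmxDr [z + z']addrC.
exact: (@integral_cV_translation _ _ z (fun z =>
  (f (x + M *m z) * (rho (x + M *m z) / slice_mass rho M x))%:E) (mslice _ _ mf)).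
Qed.

End slices.

Section active_variables.
Variables (R : realType) (k m : nat) (W : 'M[R]_(k + m)) (rho f : 'cV[R]_(k + m) -> R).
Local Notation W1 := (lsubmx W).
Local Notation W2 := (rsubmx W).
Local Notation D := (dsupp rho).
Local Notation lam := (lebesgue_cV R (k + m)).
Local Notation lamy := (lebesgue_cV R k).
Local Notation lamz := (lebesgue_cV R m).
Hypotheses (WW : W^T *m W = 1%:M).

Lemma orthogonal_mul_col_mx (y : 'cV[R]_k) (z : 'cV[R]_m) :
  W *m col_mx y z = W1 *m y + W2 *m z.
Proof. by rewrite -{1}(hsubmxK W) mul_row_col. Qed.

Lemma active_decomposition (x : 'cV[R]_(k + m)) : x = W1 *m (W1^T *m x) + W2 *m (W2^T *m x).
Proof.
rewrite -orthogonal_mul_col_mx -mul_col_mx -tr_row_mx hsubmxK mulmxA.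
by rewrite (mulmx1C WW) mul1mx.
Qed.

Lemma active_coordinate (y : 'cV[R]_k) (z : 'cV[R]_m) : W1^T *m (W1 *m y + W2 *m z) = y.
Proof.
rewrite -orthogonal_mul_col_mx mulmxA.
have : W^T *m (W *m col_mx y z) = col_mx y z by rewrite mulmxA WW mul1mx.
rewrite -{1}(hsubmxK W) tr_row_mx mul_col_mx mulmxA => /(congr1 usubmx).
by rewrite !col_mxKu.
Qed.

Lemma ge0_integral_active (h : 'cV[R]_(k + m) -> \bar R) : measurable_fun setT h ->
  (forall x, 0 <= h x)%E ->
  (\int[lam]_x h x = \int[lamy]_y \int[lamz]_z h (W1 *m y + W2 *m z)%R)%E.
Proof.
move=> mh h0; rewrite -(ge0_integral_cV_orthogonal WW mh h0).
rewrite ge0_integral_lebesgue_cV_col_mx//.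
  by under eq_integral => y _ do under eq_integral => z _ do rewrite orthogonal_mul_col_mx.
by apply: (measurableT_comp mh); exact: measurable_cV_mulmx.
Qed.

Hypotheses (rho0 : forall x, 0 <= rho x) (oD : open D) (mrho : measurable_fun setT rho)
  (mf : measurable_fun D f)
  (mass_fin : forall x, (\int[lamz]_z (rho (x + W2 *m z)%R)%:E < +oo)%E)
  (mass_gt0 : forall x, D x -> 0 < slice_mass rho W2 x).

(** [Yset] is defined as an image, whose measurability is not evident; here it becomes the set where
    the measurable function [rhoY] is positive. *)
Lemma rhoY_gt0 y : (0 < rhoY W rho y) = (y \in Yset W rho).
Proof.
apply/idP/idP; last first.
  move=> /set_mem[x Dx <-].
  rewrite -[rhoY _ _ _](slice_mass_shift W2 rho0 mrho _ (W2^T *m x)) -active_decomposition.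
  exact: mass_gt0.
move=> y0; apply/mem_set; apply: contrapT => Yy.
move: y0; rewrite /rhoY; under eq_Rintegral => z _.
  rewrite (_ : rhoYZ W rho y z = 0); last first.
    apply/eqP; rewrite eq_le rho0 andbT leNgt; apply/negP => rz.
    by apply: Yy; exists (W1 *m y + W2 *m z); rewrite ?active_coordinate.
  over.
by rewrite /Rintegral integral0 /= ltxx.
Qed.

Lemma rhoY_ge0 y : 0 <= rhoY W rho y.
Proof. by apply: Rintegral_ge0 => z _; exact: rho0. Qed.

Lemma measurable_rhoY : measurable_fun setT (rhoY W rho).
Proof.
apply: (measurableT_comp (measurable_slice_mass W2 rho0 mrho)).
exact: measurable_cV_mulmx.
Qed.

Lemma measurable_Yset : measurable (Yset W rho).
Proof.
have := measurable_rhoY measurableT (measurable_itv `]0, +oo[); rewrite setTI.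
congr (measurable _); apply/seteqP; split => y /=; rewrite in_itv/= andbT rhoY_gt0.
  by move=> /set_mem.
exact: mem_set.
Qed.

Lemma measurable_gfun : measurable_fun setT (gfun W rho f).
Proof.
apply: (measurableT_comp (measurable_slice_mean W2 rho0 oD mrho mf)).
exact: measurable_cV_mulmx.
Qed.

(** [fg] parametrizes the slice from [W1 W1^T x] and [slice_mean] from [x]; the two base points
    differ by [W2 W2^T x], a translation of [z]. *)
Lemma fg_slice_mean x : fg W rho f x = slice_mean rho f W2 x.
Proof.
rewrite [in RHS](active_decomposition x).
by rewrite (slice_mean_shift W2 rho0 oD mrho mf).
Qed.

Lemma slice_integrable :
  (forall y, Yset W rho y -> lamz.-integrable setT
    (fun z => (f (W1 *m y + W2 *m z) * rhoZY W rho y z)%:E)) ->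
  forall x, D x -> lamz.-integrable setT
     (fun z => (f (x + W2 *m z) * (rho (x + W2 *m z) / slice_mass rho W2 x))%:E).
Proof.
move=> fint x Dx; pose y := W1^T *m x.
have /fint/(integrable_cV_translation (W2^T *m x)) : Yset W rho y by exists x.
apply: eq_integrable => // z _.
have E : W1 *m y + W2 *m (z + W2^T *m x) = x + W2 *m z.
  by rewrite mulmxDr addrCA -active_decomposition addrC.
rewrite /rhoZY /rhoYZ E.
congr ((_ * (_ / _))%:E).
by rewrite [in RHS](active_decomposition x) slice_mass_shift.
Qed.

(** In the orthonormal coordinates [(y, z)] the function depends on [y] only, and the inner integral
    of [rho] over [z] is [rhoY]. Extending [H] by zero makes it measurable on the whole space. *)
Lemma EX_EY (H : 'cV[R]_k -> R) : measurable_fun (Yset W rho) H -> (forall y, 0 <= H y) ->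
  EX rho (fun x => H (W1^T *m x)) = EY W rho H.
Proof.
move=> mH H0; have mY := measurable_Yset.
pose H' := H \_ (Yset W rho).
have H'0 y : 0 <= H' y by rewrite /H' patchE; case: ifP.
have mH' : measurable_fun setT H' by exact/(measurable_restrictT _ mY).
have mHx : measurable_fun setT (fun x : 'cV[R]_(k + m) => (H' (W1^T *m x) * rho x)%:E).
  apply/measurable_EFinP; apply: measurable_funM => //.
  by apply: (measurableT_comp mH'); exact: measurable_cV_mulmx.
transitivity (\int[lam]_x (H' (W1^T *m x) * rho x)%:E)%E.
  rewrite /EX integral_mkcond; apply: eq_integral => x _.
  rewrite patchE; case: ifPn => [/set_mem Dx|xD].
    by rewrite /H' patchE mem_set//; exists x.
  have -> : rho x = 0; last by rewrite mulr0.
  apply/eqP; rewrite eq_le rho0 andbT leNgt; apply: contra xD => rx.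
  by rewrite inE.
rewrite ge0_integral_active//; last by move=> x; rewrite lee_fin mulr_ge0.
rewrite /EY [RHS]integral_mkcond; apply: eq_integral => y _.
under eq_integral => z _ do rewrite active_coordinate EFinM.
have mz : measurable_fun setT (fun z => (rho (W1 *m y + W2 *m z)%R)%:E).
  apply/measurable_EFinP; apply: measurableT_comp mrho _.
  by apply: measurable_cVD => //; exact: measurable_cV_mulmx.
rewrite ge0_integralZl_EFin//; last by move=> z _; rewrite lee_fin.
rewrite -slice_massE// patchE /H' patchE; case: ifP => _; rewrite ?mul0e//.
Qed.

End active_variables.

Section monte_carlo_error.
Variables (R : realType) (k m : nat) (W : 'M[R]_(k + m)) (rho f : 'cV[R]_(k + m) -> R).
Local Notation W1 := (lsubmx W).
Local Notation W2 := (rsubmx W).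
Local Notation D := (dsupp rho).
Local Notation lam := (lebesgue_cV R (k + m)).
Local Notation lamy := (lebesgue_cV R k).
Local Notation lamz := (lebesgue_cV R m).
Hypotheses (WW : W^T *m W = 1%:M)
  (rho0 : forall x, 0 <= rho x) (oD : open D) (mrho : measurable_fun setT rho)
  (mf : measurable_fun D f)
  (mass_fin : forall x, (\int[lamz]_z (rho (x + W2 *m z)%R)%:E < +oo)%E)
  (mass_gt0 : forall x, D x -> 0 < slice_mass rho W2 x)
  (fint : forall y, Yset W rho y -> lamz.-integrable setT
    (fun z => (f (W1 *m y + W2 *m z) * rhoZY W rho y z)%:E)).
Context d (Omega : measurableType d) (P : probability Omega R).
Variables (N : nat) (Z : 'I_N -> 'cV[R]_k -> Omega -> 'cV[R]_m).
Hypotheses (N0 : (0 < N)%N)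
  (mZ : forall j, measurable_fun (Yset W rho `*` setT)
         (fun p : 'cV[R]_k * Omega => Z j p.1 p.2))
  (iidZ : forall y, Yset W rho y -> iid_law P (fun j => Z j y) (lawZY W rho y)).

Let mY : measurable (Yset W rho). Proof. exact: measurable_Yset. Qed.
Let mD : measurable D. Proof. exact: open_measurable_cV. Qed.

Let f1 := f \* \1_D.

Let f1E : f1 = f \_ D.
Proof.
apply/funext => x; rewrite /f1 patchE /= indicE.
by case: (x \in D); rewrite ?mulr1 ?mulr0.
Qed.

Let mf1 : measurable_fun setT f1.
Proof. by rewrite f1E; exact/(measurable_restrictT _ mD). Qed.

Let f1rho x : f1 x * rho x = f x * rho x.
Proof. by rewrite f1E -mul_density_restrict. Qed.

Let f1q y z : f1 (W1 *m y + W2 *m z) * rhoZY W rho y z =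
  f (W1 *m y + W2 *m z) * rhoZY W rho y z.
Proof. by rewrite /rhoZY /rhoYZ !mulrA f1rho. Qed.

Let mslice y : measurable_fun setT (fun z : 'cV[R]_m => W1 *m y + W2 *m z).
Proof. by apply: measurable_cVD => //; exact: measurable_cV_mulmx. Qed.

(** The samples are jointly measurable over [Yset] only; the extension by zero makes the squared
    error [e] measurable on the whole product, as Tonelli requires. *)
Let Z' j y w : 'cV[R]_m := ((fun p : 'cV[R]_k * Omega => Z j p.1 p.2) \_ (Yset W rho `*` setT)) (y, w).

Let e y w : R := (gfun W rho f y -
  N%:R^-1 * \sum_(j < N) f1 (W1 *m y + W2 *m Z' j y w)) ^+ 2.

Let eE y w : Yset W rho y -> e y w = (gfun W rho f y - gN W rho f Z y w) ^+ 2.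
Proof.
move=> Yy; rewrite /e /gN; congr ((_ - _ * _) ^+ 2); apply: eq_bigr => j _.
by rewrite /Z' patchE mem_set.
Qed.

Let me : measurable_fun setT (fun p : 'cV[R]_k * Omega => e p.1 p.2).
Proof.
apply: measurable_funX; apply: measurable_funB.
  exact: measurableT_comp (measurable_gfun W rho0 oD mrho mf) measurable_fst.
apply: measurable_funM => //; apply: measurable_sum => j.
apply: (measurableT_comp mf1); apply: measurable_cVD; apply: measurable_cV_mulmx.
  exact: measurable_fst.
rewrite (_ : (fun p => _) = (fun p : 'cV[R]_k * Omega => Z j p.1 p.2) \_ (Yset W rho `*` setT)).
  have mYO : measurable (Yset W rho `*` [set: Omega]) by exact: measurableX.
  exact/(measurable_restrictT _ mYO).
by apply/funext => -[].
Qed.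

Lemma monte_carlo_EX_EY :
  (\int[P]_w EX rho (fun x => (fg W rho f x - fgN W rho f Z x w) ^+ 2)%R =
   \int[P]_w EY W rho (fun y => (gfun W rho f y - gN W rho f Z y w) ^+ 2)%R)%E.
Proof.
apply: eq_integral => w _.
apply: (EX_EY WW rho0 mrho mass_fin mass_gt0
  (H := fun y => (gfun W rho f y - gN W rho f Z y w) ^+ 2)).
  apply: (eq_measurable_fun (fun y => e y w)).
    by move=> y /set_mem Yy; rewrite eE.
  apply: measurable_funTS.
  have mp : measurable_fun setT (fun y : 'cV[R]_k => (y, w)) by exact: measurable_fun_pair.
  exact: (measurableT_comp me mp).
by move=> y; exact: sqr_ge0.
Qed.

(** Swap the sampling variable and [y], and apply [iid_mean_square_error] at each fixed [y].
    Multiplying the conditional variance by [rhoY] turns [rhoZY] back into [rho], and integrating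
    over [y] in the coordinates [(y, z)] rebuilds [E[(f - f_g)^2]]. The projection bound then passes
    over with the same constant. *)
Lemma monte_carlo_error_le :
  (\int[P]_w EY W rho (fun y => (gfun W rho f y - gN W rho f Z y w) ^+ 2)%R <=
   N%:R^-1%:E * EX rho (fun x => (f x - fg W rho f x) ^+ 2)%R)%E.
Proof.
have mrY := measurable_rhoY W rho0 mrho.
have rY0 := rhoY_ge0 W rho0.
rewrite [leLHS](_ : _ =
    \int[P]_w \int[lamy]_(y in Yset W rho) (e y w * rhoY W rho y)%:E)%E; last first.
  by apply: eq_integral => w _; apply: eq_integral => y /set_mem Yy; rewrite eE.
have mF : measurable_fun setT (fun p : Omega * 'cV[R]_k => (e p.2 p.1 * rhoY W rho p.2)%:E).
  apply/measurable_EFinP; apply: measurable_funM.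
    have mp : measurable_fun setT (fun p : Omega * 'cV[R]_k => (p.2, p.1)).
      by apply: measurable_fun_pair; [exact: measurable_snd|exact: measurable_fst].
    exact: (measurableT_comp me mp).
  exact: measurableT_comp mrY measurable_snd.
have F0 w y : (0 <= (e y w * rhoY W rho y)%:E)%E by rewrite lee_fin mulr_ge0// sqr_ge0.
rewrite (@ge0_integral_swap_in _ _ _ _ _ P lamy setT (Yset W rho) measurableT mY
  (fun w y => (e y w * rhoY W rho y)%:E) mF F0).
pose G x := ((f1 x - fg W rho f x) ^+ 2 * rho x)%:E.
have mG : measurable_fun setT G.
  apply/measurable_EFinP; apply: measurable_funM => //; apply: measurable_funX.
  apply: measurable_funB => //.
  apply: (measurableT_comp (measurable_gfun W rho0 oD mrho mf)).
  exact: measurable_cV_mulmx.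
have G0 x : (0 <= G x)%E by rewrite lee_fin mulr_ge0// sqr_ge0.
have GY y z : y \notin Yset W rho -> G (W1 *m y + W2 *m z) = 0%E.
  move=> yY; rewrite /G.
  have -> : rho (W1 *m y + W2 *m z) = 0; last by rewrite mulr0.
  apply/eqP; rewrite eq_le rho0 andbT leNgt; apply: contra yY => r0.
  by apply/mem_set; exists (W1 *m y + W2 *m z) => //; rewrite active_coordinate.
have -> : EX rho (fun x => (f x - fg W rho f x) ^+ 2) =
    (\int[lamy]_(y in Yset W rho) \int[lamz]_z G (W1 *m y + W2 *m z)%R)%E.
  rewrite [RHS]integral_mkcond.
  transitivity (\int[lamy]_y \int[lamz]_z G (W1 *m y + W2 *m z)%R)%E; last first.
    apply: eq_integral => y _; rewrite patchE; case: ifPn => // yY.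
    by rewrite integral0_eq// => z _; exact: GY.
  rewrite -ge0_integral_active// /EX integral_mkcond; apply: eq_integral => x _.
  rewrite /G f1E !patchE; case: ifPn => // xD.
  have -> : rho x = 0; last by rewrite mulr0.
  apply/eqP; rewrite eq_le rho0 andbT leNgt; apply: contra xD => rx.
  by rewrite inE.
have mGyz : measurable_fun setT (fun p : 'cV[R]_k * 'cV[R]_m => G (W1 *m p.1 + W2 *m p.2)).
  apply: (measurableT_comp mG); apply: measurable_cVD; apply: measurable_cV_mulmx.
    exact: measurable_fst.
  exact: measurable_snd.
have mGy := @measurable_integral_snd _ _ _ _ _ lamz
  (fun (y : 'cV[R]_k) (z : 'cV[R]_m) => G (W1 *m y + W2 *m z)) mGyz (fun _ _ => G0 _).
rewrite -ge0_integralZl_EFin//; last 2 first.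
- by move=> y _; apply: integral_ge0.
- exact: measurable_funTS.
have mFs : measurable_fun setT (fun y : 'cV[R]_k => \int[P]_w (e y w * rhoY W rho y)%:E)%E.
  apply: (@measurable_integral_snd _ _ _ _ _ P (fun y w => (e y w * rhoY W rho y)%:E)) => //.
  apply/measurable_EFinP; apply: measurable_funM => //.
  exact: measurableT_comp mrY measurable_fst.
apply: ge0_le_integral => //.
- by move=> y _; apply: integral_ge0.
- exact: measurable_funTS.
- by apply: measurable_funTS; exact: measurable_funeM.
move=> y Yy.
have ry0 : 0 < rhoY W rho y by rewrite (rhoY_gt0 WW)// mem_set.
have mey : measurable_fun setT (fun w => (e y w)%:E).
  apply/measurable_EFinP.
  have mp : measurable_fun setT (fun w : Omega => (y, w)) by exact: measurable_fun_pair.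
  exact: (measurableT_comp me mp).
under eq_integral => w _ do rewrite EFinM.
rewrite ge0_integralZr//; last 2 first.
- by move=> w _; rewrite lee_fin sqr_ge0.
- by rewrite lee_fin.
have mq : measurable_fun setT (rhoZY W rho y).
  by apply: measurable_funM => //; exact: measurableT_comp mrho (mslice y).
have q0 z : 0 <= rhoZY W rho y z by exact: divr_ge0 (rho0 _) (rY0 _).
pose phi z := f1 (W1 *m y + W2 *m z).
have mphi : measurable_fun setT phi by exact: measurableT_comp mf1 (mslice y).
have iphi : lamz.-integrable setT (fun z => (phi z * rhoZY W rho y z)%:E).
  by apply: eq_integrable (fint Yy) => // z _; rewrite /phi f1q.
have phig : \int[lamz]_z (phi z * rhoZY W rho y z) = gfun W rho f y.
  by apply: eq_Rintegral => z _; rewrite /phi f1q.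
have := iid_mean_square_error N0 mq q0 mphi iphi phig (iidZ Yy).
rewrite [leLHS](_ : _ = \int[P]_w (e y w)%:E)%E; last first.
  by apply: eq_integral => w _; rewrite eE.
have ry0E : (0 <= (rhoY W rho y)%:E)%E by rewrite lee_fin.
move=> /(lee_wpmul2r ry0E)/le_trans; apply.
rewrite -muleA; apply: lee_wpmul2l; first by rewrite lee_fin.
rewrite -ge0_integralZr//; last 2 first.
- apply/measurable_EFinP; apply: measurable_funM => //; apply: measurable_funX.
  exact: measurable_funB.
- by move=> z _; rewrite lee_fin mulr_ge0// sqr_ge0.
rewrite le_eqVlt; apply/orP; left; apply/eqP; apply: eq_integral => z _.
have qE : rhoZY W rho y z * rhoY W rho y = rho (W1 *m y + W2 *m z).
  exact: divfK (lt0r_neq0 ry0) _.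
have gE : fg W rho f (W1 *m y + W2 *m z) = gfun W rho f y by rewrite /fg active_coordinate.
by rewrite -EFinM -mulrA qE /G gE.
Qed.

End monte_carlo_error.

(** The four properties by which the law of X enters: segments stay in the support, the density is
    bounded below on bounded parts of it, slices have finite mass, and the kernel bound holds with
    constant [C]. *)
Definition poincare_density (R : realType) n m (rho : 'cV[R]_n -> R) (M : 'M[R]_(n, m))
    (C : R) : Prop :=
  [/\ forall x h t, dsupp rho x -> dsupp rho (x + h) -> 0 <= t <= 1 -> dsupp rho (x + t *: h),
      forall r : R, exists2 c, 0 < c &
        forall x, dsupp rho x -> (forall i, `|x i 0| < r) -> c <= rho x,
      forall x, (\int[lebesgue_cV R m]_z (rho (x + M *m z)%R)%:E < +oo)%E &
      forall x, dsupp rho x ->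
        (\int[@lebesgue_measure R]_(t in `[0%R, 1%R]) \int[lebesgue_cV R m]_z
           (sqnorm z * (rho (x - t *: (M *m z)) * rho (x + (1 - t) *: (M *m z))))%:E <=
         (C * (slice_mass rho M x * rho x))%:E)%E].

Lemma uniform_poincare_density (R : realType) n m (rho : 'cV[R]_n -> R) (M : 'M[R]_(n, m)) :
  M^T *m M = 1%:M -> (forall x, 0 <= rho x) -> measurable_fun setT rho ->
  bounded_set (dsupp rho) -> convex_set (dsupp rho : set (convex_lmodType 'cV[R]_n)) ->
  rho = uniform_density (dsupp rho) -> exists2 C, 0 < C & poincare_density rho M C.
Proof.
move=> MM rho0 mrho [B0 [_ bD]] cvx rhoE.
pose B := `|B0| + 1; have B_ge0 : 0 <= B by rewrite addr_ge0.
have DB x : dsupp rho x -> `|x| <= B.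
  by apply: bD; rewrite (le_lt_trans (ler_norm _))// ltrDl.
pose c := (fine (lebesgue_cV R n (dsupp rho)))^-1.
have c0 : 0 <= c by rewrite invr_ge0 fine_ge0.
have rhoc x : dsupp rho x -> rho x = c.
  by move=> Dx; rewrite rhoE /uniform_density indicE mem_set// mul1r.
have K0 : 0 <= n%:R * (2 * B) ^+ 2 * 2 ^+ m by rewrite !mulr_ge0 ?sqr_ge0 ?exprn_ge0.
(* The added 1 makes the constant positive for every [n], including 0. *)
exists (n%:R * (2 * B) ^+ 2 * 2 ^+ m + 1); first by rewrite ltr_wpDl.
split.
- exact: convex_set_segment.
(* If the support has a point, [c] is the value of [rho] there, hence positive; the default 1 only
   matters when the support is empty. *)
- move=> r; exists (if 0 < c then c else 1); first by case: ifP.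
  by move=> x Dx _; rewrite -(rhoc _ Dx) ifT.
- exact: (uniform_slice_mass_fin MM rho0 mrho B_ge0 c0 DB rhoc).
- move=> x Dx; apply: (le_trans (uniform_kernel_le MM rho0 mrho B_ge0 c0 DB rhoc Dx)).
  rewrite lee_fin ler_wpM2r ?lerDl// mulr_ge0//.
  by apply: Rintegral_ge0 => z _; exact: rho0.
Qed.

Lemma gaussian_poincare_density (R : realType) n m (M : 'M[R]_(n, m)) : M^T *m M = 1%:M ->
  exists2 C, 0 < C & poincare_density (@std_normal_density R n) M C.
Proof.
move=> MM; exists (48 * 2 ^+ m); first by rewrite mulr_gt0// exprn_gt0.
split.
- by move=> x h t _ _ _; exact: std_normal_density_gt0.
- move=> r; exists (Num.sqrt (2 * pi) ^- n * expR (- (n%:R * r ^+ 2) / 2)).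
    by rewrite mulr_gt0 ?expR_gt0// invr_gt0 exprn_gt0// sqrtr_gt0 mulr_gt0 ?pi_gt0.
  move=> x _ xr; rewrite ler_wpM2l ?invr_ge0 ?exprn_ge0 ?sqrtr_ge0// ler_expR.
  rewrite !mulNr lerN2 ler_wpM2r// (@le_trans _ _ (\sum_(i < n) r ^+ 2))//.
    apply: ler_sum => i _; have xir := xr i.
    by rewrite -real_normK ?num_real// lerXn2r ?nnegrE ?(ltW xir)// (le_trans _ (ltW xir)).
  by rewrite sumr_const card_ord mulr_natl.
- exact: gaussian_slice_mass_fin.
- by move=> x _; exact: gaussian_kernel_le.
Qed.

Theorem theorem4p3 (R : realType)
  (* n = k + m, with k and m = n - k positive *)
  (k m : nat) (k_gt0 : (0 < k)%N) (m_gt0 : (0 < m)%N)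
  (d : measure_display) (Omega : measurableType d) (P : probability Omega R)
  (rho : 'cV[R]_(k + m) -> R)
  (rho_ge0 : forall x, 0 <= rho x)
  (rho_measurable : measurable_fun [set: 'cV[R]_(k + m)] rho)
  (rho_int1 : (\int[lebesgue_cV R (k + m)]_x (rho x)%:E = 1)%E)
  (supp_open : open (dsupp rho))
  (supp_boundary : lebesgue_cV R (k + m)
     (closure (dsupp rho) `\` interior (dsupp rho)) = 0%E)
  (rho_bounded : exists M : R, forall x, dsupp rho x -> rho x <= M)
  (rho_continuous : {within dsupp rho, continuous rho})
  (X : {RV P >-> 'cV[R]_(k + m)})
  (X_density : forall A : set 'cV[R]_(k + m), measurable A ->
     (distribution P X A = \int[lebesgue_cV R (k + m)]_(x in A) (rho x)%:E)%E)
  (f : 'cV[R]_(k + m) -> R)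
  (f_measurable : measurable_fun (dsupp rho) f)
  (f_derivable : forall x (i : 'I_(k + m)),
     dsupp rho x -> derivable f x (delta_mx i 0))
  (f_grad_sqint : forall i : 'I_(k + m),
     (lebesgue_cV R (k + m)).-integrable (dsupp rho)
       (fun x => (grad f x i 0 ^+ 2 * rho x)%:E))
  (W : 'M[R]_(k + m)) (lambda : 'rV[R]_(k + m))
  (W_orthogonal : W^T *m W = 1%:M)
  (C_eigen : grad_outer rho f = W *m diag_mx lambda *m W^T)
  (lambda_noninc : forall i j : 'I_(k + m), (i <= j)%N ->
     lambda 0 j <= lambda 0 i)
  (lambda_ge0 : forall i, 0 <= lambda 0 i)
  (f_slice_integrable : forall y, Yset W rho y ->
     (lebesgue_cV R m).-integrable [set: 'cV[R]_m]
       (fun z => (f (lsubmx W *m y + rsubmx W *m z) * rhoZY W rho y z)%:E))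
  (X_law :
     [/\ bounded_set (dsupp rho),
         convex_set (dsupp rho : set (convex_lmodType 'cV[R]_(k + m))) &
         rho = uniform_density (dsupp rho)]
     \/ rho = @std_normal_density R (k + m)) :
  exists C : R, 0 < C /\
    (EX rho (fun x => (f x - fg W rho f x) ^+ 2)%R <=
       (C * \sum_(i < m) lambda 0 (rshift k i))%:E)%E /\
    forall (N : nat), (1 <= N)%N ->
    forall Z : 'I_N -> 'cV[R]_k -> Omega -> 'cV[R]_m,
      (forall j, measurable_fun (Yset W rho `*` [set: Omega])
         (fun p : 'cV[R]_k * Omega => Z j p.1 p.2)) ->
      (forall y, Yset W rho y -> iid_law P (fun j => Z j y) (lawZY W rho y)) ->
      (\int[P]_w EX rho (fun x => (fg W rho f x - fgN W rho f Z x w) ^+ 2)%R =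
         \int[P]_w EY W rho (fun y => (gfun W rho f y - gN W rho f Z y w) ^+ 2)%R /\
       \int[P]_w EY W rho (fun y => (gfun W rho f y - gN W rho f Z y w) ^+ 2)%R <=
         (C / N%:R * \sum_(i < m) lambda 0 (rshift k i))%:E)%E.
Proof.
have W2W2 : (rsubmx W)^T *m rsubmx W = 1%:M.
  have := congr1 (@drsubmx _ _ _ _ _) W_orthogonal.
  rewrite -{1 2}(hsubmxK W) tr_row_mx mul_col_row block_mxKdr => ->.
  by rewrite scalar_mx_block block_mxKdr.
have [C C0 [segD rho_lb mass_fin kernel_le]] : exists2 C, 0 < C & poincare_density rho (rsubmx W) C.
  case: X_law => [[bD cD rhoE]|rhoE]; first exact: uniform_poincare_density.
  by rewrite rhoE; exact: gaussian_poincare_density.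
have mass_gt0 := slice_mass_gt0 rho_ge0 supp_open rho_measurable rho_lb mass_fin.
have slice_int := slice_integrable W_orthogonal rho_ge0 rho_measurable f_slice_integrable.
have projection_le : (EX rho (fun x => (f x - fg W rho f x) ^+ 2)%R <=
    (C * \sum_(i < m) lambda 0 (rshift k i))%:E)%E.
  rewrite EFinM -(integral_sqgrad_spectrum supp_open rho_measurable f_measurable f_derivable
    f_grad_sqint W_orthogonal C_eigen).
  rewrite [leLHS](_ : _ = EX rho (fun x => (f x - slice_mean rho f (rsubmx W) x) ^+ 2)); last first.
    by apply: eq_integral => x _; rewrite (fg_slice_mean W_orthogonal).
  exact: (conditional_poincare rho_ge0 supp_open rho_measurable segD rho_lb f_measurable
    f_derivable f_grad_sqint mass_fin mass_gt0 slice_int (ltW C0) kernel_le).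
exists C; split => //; split => // N N1 Z mZ iidZ; split.
  exact: (monte_carlo_EX_EY W_orthogonal rho_ge0 supp_open rho_measurable f_measurable
    mass_fin mass_gt0).
apply: (le_trans (monte_carlo_error_le W_orthogonal rho_ge0 supp_open rho_measurable
  f_measurable mass_gt0 f_slice_integrable N1 mZ iidZ)).
have NV0 : (0 <= N%:R^-1%:E :> \bar R)%E by rewrite lee_fin invr_ge0.
apply: (le_trans (lee_wpmul2l NV0 projection_le)).
by rewrite -EFinM mulrA [N%:R^-1 * C]mulrC.
Qed.
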